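(* Let $\boldsymbol{\lambda},\boldsymbol{\mu},\boldsymbol{\eta}\in\mathcal{P}^{st}$ be three modified symplectic functions with $\|\boldsymbol{\eta}\|=\|\boldsymbol{\lambda}\|+\|\boldsymbol{\mu}\|$. Then $c_{\boldsymbol{\lambda},\boldsymbol{\mu}}^{\boldsymbol{\eta}}(n)$ (defined for all $n$ with $\|\overline{\boldsymbol{\eta}}\|\le 2n$) is a non-negative integer independent of $n$.
   Context: Let $q$ be an odd prime power. Let $V_\infty$ be the $\mathbb{F}_q$-space with basis $e_1,f_1,e_2,f_2,\dots$ and alternating form $Q$ with $Q(e_i,f_j)=\delta_{ij}$, $Q(e_i,e_j)=Q(f_i,f_j)=0$; $V_n=\langle e_1,f_1,\dots,e_n,f_n\rangle$; $Sp_n(q)\subset GL_{2n}(q)$ is the isometry group of $(V_n,Q)$. For $m\le n$, $Sp_m(q)$ is embedded in $Sp_n(q)$ by $U\mapsto U^{\uparrow\uparrow n}=\begin{bmatrix}U&0\\0&I_{2n-2m}\end{bmatrix}$, and $Sp_\infty(q)=\bigcup_n Sp_n(q)$. Combinatorics. $\Phi$ is the set of monic irreducible polynomials in $\mathbb{F}_q[t]$ other than $t$. The dual of a monic $f=\sum_{i=0}^d a_it^i$, $a_0\ne0$, is $\overline f=\sum_{i=0}^d a_ia_0^{-1}t^{d-i}$. $\Phi^s$ consists of the self-dual $f\in\Phi$ and the products $g\overline g$ with $g\in\Phi$, $g\neq\overline g$. The weight $\|\lambda\|$ of a partition is the sum of its parts. A partition valued function on $\Phi^s$ assigns to each $f\in\Phi^s$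 a partition $\boldsymbol\lambda(f)$, empty for almost all $f$; its weight is $\|\boldsymbol\lambda\|=\sum_f\deg(f)\|\boldsymbol\lambda(f)\|$. A signed partition is a partition with a sign $h_i\in\{\pm1\}$ attached to each occurring part size $i$; it is a symplectic partition if, for every odd $i$, the multiplicity of $i$ is even and $h_i=-1$. A symplectic function is a triple $(\boldsymbol\lambda,h^+,h^-)$ with $\boldsymbol\lambda$ a partition valued function on $\Phi^s$ such that $(\boldsymbol\lambda(t-1),h^-)$ and $(\boldsymbol\lambda(t+1),h^+)$ are symplectic partitions; its weight is $\|\boldsymbol\lambda\|$. The modification of a symplectic function changes only the signed partition at $t-1$: each part is decreased by 1 (parts equal to 1 disappear), and the remaining parts keep their signs. $\mathcal P^{st}$, the set of modified symplectic functions, is the set of modifications of all symplectic functions; a modified symplectic function is abbreviated $\boldsymbol\lambda$ and its weight $\|\boldsymbol\lambda\|$ is defined by the same formula. The completion $\overline{\boldsymbol\lambda}$ of $\boldsymbol\lambda\in\mathcal P^{st}$ is obtained by increasing each part at $t-1$ by 1, keeping signs; it is a symplectic function. Types. The symplectic type of $U\in Sp_n(q)$ is the symplectic function of weight $2n$ defined as follows. View $V_n$ as an $\mathbb F_q[t]$-module with $t$ acting as $U$. For $f\in\Phi^s$ irreducible, $\boldsymbol\lambda(f)$ lists the exponents $r$ of the primary cyclic summands $\mathbb F_q[t]/(f^r)$; for $f=g\overline g$, $\boldsymbol\lambda(f)$ is the analogous partition for $g$ (equal to that for $\overline g$). For $\epsilon=\pm1$, the generalized $\epsilon$-eigenspace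 is an orthogonal sum of $U$-invariant subspaces $W^i$ with $W^i$ free over $\mathbb F_q[t]/(t-\epsilon)^i$; for even $i$ the form $(\bar v,\bar w)\mapsto Q((U-U^{-1})^{i-1}v,w)$ on $W^i/(U-\epsilon)W^i$ is symmetric and non-degenerate, and the sign attached to the part $i$ at $t-\epsilon$ is $+1$ if its Gram determinant is a square in $\mathbb F_q^\times$ and $-1$ otherwise; for odd $i$ the sign is $-1$. The symplectic type determines the $Sp_n(q)$-conjugacy class and every symplectic function of weight $2n$ occurs. The modified symplectic type of $U$ is the modification of its symplectic type; it is unchanged under $U\mapsto U^{\uparrow\uparrow n}$ and labels the conjugacy classes of $Sp_\infty(q)$ by $\mathcal P^{st}$. Structure constants. For $\boldsymbol\lambda\in\mathcal P^{st}$ let $\boldsymbol\lambda(n)$ be the set of elements of $Sp_n(q)$ with modified symplectic type $\boldsymbol\lambda$; it is a conjugacy class if $\|\overline{\boldsymbol\lambda}\|\le 2n$ and empty otherwise. Put $K_{\boldsymbol\lambda}(n)=\sum_{g\in\boldsymbol\lambda(n)}g\in\mathbb Z[Sp_n(q)]$ (zero if $\boldsymbol\lambda(n)=\emptyset$). The nonzero $K_{\boldsymbol\lambda}(n)$ form a $\mathbb Z$-basis of the center of $\mathbb Z[Sp_n(q)]$, and $c_{\boldsymbol\lambda,\boldsymbol\mu}^{\boldsymbol\eta}(n)$, defined when $\boldsymbol\eta(n)\ne\emptyset$, is the coefficient of $K_{\boldsymbol\eta}(n)$ in $K_{\boldsymbol\lambda}(n)K_{\boldsymbol\mu}(n)$.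 *)

(* Defs.v *)
From HB Require Import structures.
From mathcomp Require Import all_boot all_order all_fingroup all_algebra finmap.
From mathcomp Require Import boolp zify.

Set Implicit Arguments.
Unset Strict Implicit.
Unset Printing Implicit Defensive.

Import GRing.Theory.
Local Open Scope ring_scope.

(* Gram matrix of Q in the ordered basis e_1, f_1, e_2, f_2, ..., whose
   0-based indices are 0, 1, 2, 3, ... *)
Definition sp_form (F : finFieldType) (n : nat) : 'M[F]_(n.*2) :=
  \matrix_(i, j)
    if ~~ odd i && (j == i.+1 :> nat) then 1
    else if ~~ odd j && (i == j.+1 :> nat) then -1 else 0.

(* Matrices act on column vectors. *)
Definition Qform (F : finFieldType) (n : nat) (v w : 'cV[F]_(n.*2)) : F :=
  (v^T *m sp_form F n *m w) 0 0.

Definition is_sp (F : finFieldType) (n : nat) (U : 'M[F]_(n.*2)) : bool :=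
  U^T *m sp_form F n *m U == sp_form F n.

Record Sp (F : finFieldType) (n : nat) :=
  MkSp { Spval :> 'M[F]_(n.*2); _ : is_sp Spval }.

HB.instance Definition _ (F : finFieldType) (n : nat) :=
  [isSub for @Spval F n].
HB.instance Definition _ (F : finFieldType) (n : nat) :=
  [Finite of Sp F n by <:].

Section SpGroup.
Variables (F : finFieldType) (n : nat).
Local Notation J := (sp_form F n).

Lemma sp_form_sq : J *m J = - 1%:M.
Proof.
have odd_lt (i : 'I_(n.*2)) : ~~ odd i -> (i.+1 < n.*2)%N.
  by have := ltn_ord i; lia.
apply/matrixP => i k; rewrite !mxE -val_eqE /=.
case: (boolP (odd i)) => oi.
- have Hp : (i.-1 < n.*2)%N by have := ltn_ord i; lia.
  rewrite (bigD1 (Ordinal Hp)) //= big1 => [|j nj]; rewrite !mxE /=.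
    rewrite oi addr0 /= ifT; last by lia.
    rewrite mulN1r; congr (- _).
    case: (altP (i =P k :> nat)) => e; first by rewrite ifT //; lia.
    by rewrite ifF ?ifF //; lia.
  have {}nj : j != i.-1 :> nat by rewrite -val_eqE in nj.
  by rewrite oi /= ifF ?mul0r //; lia.
- have Hp := odd_lt _ oi.
  rewrite (bigD1 (Ordinal Hp)) //= big1 => [|j nj]; rewrite !mxE /=.
    rewrite oi addr0 eqxx /= mul1r.
    case: (altP (i =P k :> nat)) => e; first by rewrite ifT //; lia.
    by rewrite ifF ?oppr0 //; lia.
  have {}nj : j != i.+1 :> nat by rewrite -val_eqE in nj.
  by rewrite oi /= (negPf nj) ifF ?mul0r //; lia.
Qed.

Lemma sp_inv (U : Sp F n) : - (J *m (U : 'M_(_))^T *m J) *m U = 1%:M.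
Proof.
case: U => U /= /eqP h.
by rewrite mulNmx -!mulmxA (mulmxA U^T) h sp_form_sq opprK.
Qed.

Fact sp_mul_subproof (U V : Sp F n) : is_sp ((U : 'M_(_)) *m V).
Proof.
case: U V => [U /eqP hU] [V /eqP hV] /=.
by rewrite /is_sp trmx_mul -!mulmxA (mulmxA J) (mulmxA U^T) (mulmxA U^T) hU mulmxA hV.
Qed.

Fact sp_one_subproof : is_sp (1%:M : 'M[F]_(n.*2)).
Proof. by rewrite /is_sp trmx1 mul1mx mulmx1. Qed.

Fact sp_inv_subproof (U : Sp F n) : is_sp (invmx U).
Proof.
have [uU _] := mulmx1_unit (mulmx1C (sp_inv U)).
have /eqP h : is_sp U by case: U {uU}.
by rewrite /is_sp -{1}h -!mulmxA mulmxV // mulmx1 mulmxA -trmx_mul mulmxV // trmx1 mul1mx.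
Qed.

Definition sp_mul (U V : Sp F n) : Sp F n := MkSp (sp_mul_subproof U V).
Definition sp_one : Sp F n := MkSp sp_one_subproof.
Definition sp_invg (U : Sp F n) : Sp F n := MkSp (sp_inv_subproof U).

Fact sp_mulA : associative sp_mul.
Proof. by move=> U V W; apply/val_inj; rewrite /= mulmxA. Qed.
Fact sp_mul1 : left_id sp_one sp_mul.
Proof. by move=> U; apply/val_inj; rewrite /= mul1mx. Qed.
Fact sp_mulV : left_inverse sp_one sp_invg sp_mul.
Proof.
move=> U; apply/val_inj; rewrite /= mulVmx //.
by have [] := mulmx1_unit (mulmx1C (sp_inv U)).
Qed.

HB.instance Definition _ :=
  Finite_isGroup.Build (Sp F n) sp_mulA sp_mul1 sp_mulV.

End SpGroup.

Definition gring (gT : finGroupType) := {ffun gT -> int}.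

Definition gring_of (gT : finGroupType) (g : gT) : gring gT :=
  [ffun h => (h == g)%:R].

Definition gring_mul (gT : finGroupType) (x y : gring gT) : gring gT :=
  [ffun g => \sum_(h : gT) x h * y (h^-1 * g)%g].

Definition in_Phi (F : finFieldType) (f : {poly F}) : Prop :=
  [/\ f \is monic, irreducible_poly f & f != 'X].

Definition dual_poly (F : finFieldType) (f : {poly F}) : {poly F} :=
  \sum_(i < size f) (f`_i / f`_0) *: 'X^((size f).-1 - i).

(* The element of Phi^s attached to g in Phi. *)
Definition self_dual_of (F : finFieldType) (g : {poly F}) : {poly F} :=
  if dual_poly g == g then g else g * dual_poly g.

Definition in_Phis (F : finFieldType) (f : {poly F}) : Prop :=
  exists2 g, in_Phi g & f = self_dual_of g.

Definition is_partition (s : seq nat) : bool := sorted geq s && (0%N \notin s).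

(* The raw data (lambda, h^+, h^-).  A sign function takes the values 1 and -1
   on the occurring parts and 0 elsewhere, so that equality of raw data is
   equality of triples. *)
Record sfun (F : finFieldType) := SFun {
  sf_part : {fsfun {poly F} -> seq nat with [::]};
  sf_plus : {fsfun nat -> int with 0};
  sf_minus : {fsfun nat -> int with 0} }.

Section SfunEq.
Variable F : finFieldType.
Definition sfun_tuple (x : sfun F) := (sf_part x, sf_plus x, sf_minus x).
Definition tuple_sfun x : sfun F := SFun x.1.1 x.1.2 x.2.
Fact sfun_tupleK : cancel sfun_tuple tuple_sfun. Proof. by case. Qed.
HB.instance Definition _ := Equality.copy (sfun F) (can_type sfun_tupleK).
End SfunEq.

Definition is_signed_partition (s : seq nat) (h : nat -> int) : Prop :=
  is_partition s /\
  forall i, if i \in s then h i = 1 \/ h i = -1 else h i = 0.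

Definition is_symplectic_partition (s : seq nat) (h : nat -> int) : Prop :=
  is_signed_partition s h /\
  forall i, odd i -> i \in s -> ~~ odd (count_mem i s) /\ h i = -1.

Definition is_symplectic_function (F : finFieldType) (x : sfun F) : Prop :=
  [/\ forall f, sf_part x f != [::] -> in_Phis f,
      forall f, is_partition (sf_part x f),
      is_symplectic_partition (sf_part x ('X - 1)) (sf_minus x)
    & is_symplectic_partition (sf_part x ('X + 1)) (sf_plus x)].

Definition sf_weight (F : finFieldType) (x : sfun F) : nat :=
  (\sum_(f <- finsupp (sf_part x)) (size f).-1 * sumn (sf_part x f))%N.

Definition lower_signs (h : {fsfun nat -> int with 0}) :
    {fsfun nat -> int with 0} :=
  [fsfun i in [fset j.-1 | j in finsupp h]%fset =>
     if i == 0%N then 0 else h i.+1 | 0].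

Definition raise_signs (h : {fsfun nat -> int with 0}) :
    {fsfun nat -> int with 0} :=
  [fsfun i in [fset j.+1 | j in finsupp h]%fset => h i.-1 | 0].

Definition modification (F : finFieldType) (x : sfun F) : sfun F :=
  SFun [fsfun sf_part x with
          'X - 1 |-> [seq i.-1 | i <- sf_part x ('X - 1) & (1 < i)%N]]
       (sf_plus x) (lower_signs (sf_minus x)).

Definition completion (F : finFieldType) (x : sfun F) : sfun F :=
  SFun [fsfun sf_part x with
          'X - 1 |-> [seq i.+1 | i <- sf_part x ('X - 1)]]
       (sf_plus x) (raise_signs (sf_minus x)).

Definition Pst (F : finFieldType) (x : sfun F) : Prop :=
  exists2 y, is_symplectic_function y & x = modification y.

Section Types.
Variables (F : finFieldType) (n : nat) (U : Sp F n).
Local Notation V := 'cV[F]_(n.*2).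
Local Notation mxU := (U : 'M[F]_(n.*2)).

(* The action of F[t] on V_n, with t acting as U. *)
Definition pact (p : {poly F}) (v : V) : V :=
  \sum_(k < size p) p`_k *: (mxU ^+ k *m v).

(* F[t] v; the first 2n powers of U suffice by Cayley-Hamilton. *)
Definition cyclic_sub (v : V) : {vspace V} :=
  <<[seq mxU ^+ k *m v | k <- iota 0 n.*2]>>%VS.

(* F[t] v is isomorphic to F[t]/(f) through 1 |-> v. *)
Definition annihilator (v : V) (f : {poly F}) : Prop :=
  forall p : {poly F}, pact p v = 0 <-> f %| p.

(* (f, r, v) in D stands for the summand F[t] v, isomorphic to F[t]/(f^r). *)
Definition primary_decomposition (D : seq ({poly F} * nat * V)) : Prop :=
  [/\ forall f r v, (f, r, v) \in D ->
        [/\ in_Phi f, (0 < r)%N & annihilator v (f ^+ r)],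
      directv (\sum_(d <- D) cyclic_sub d.2)
    & (\sum_(d <- D) cyclic_sub d.2 = fullv)%VS].

Definition exponents (D : seq ({poly F} * nat * V)) (f : {poly F}) : seq nat :=
  [seq d.1.2 | d <- D & d.1.1 == f].

Definition mxend (A : 'M[F]_(n.*2)) : 'End(V) := linfun (mulmx A).

Definition gen_eigenspace (e : F) : {vspace V} :=
  lker (mxend ((mxU - e%:M) ^+ n.*2)).

(* W is free over F[t]/(t - e)^i, with basis B. *)
Definition free_mod (e : F) (i : nat) (W : {vspace V}) : Prop :=
  exists B : seq V,
    [/\ forall b, b \in B -> annihilator b (('X - e%:P) ^+ i),
        directv (\sum_(b <- B) cyclic_sub b)
      & (\sum_(b <- B) cyclic_sub b = W)%VS].

Definition orthogonal_splitting (e : F) (W : nat -> {vspace V}) : Prop :=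
  [/\ forall i, (mxend mxU @: W i <= W i)%VS /\ free_mod e i (W i),
      forall i j v w, i != j -> v \in W i -> w \in W j -> Qform v w = 0,
      directv (\sum_(1 <= i < n.*2.+1) W i)
    & (\sum_(1 <= i < n.*2.+1) W i = gen_eigenspace e)%VS].

(* The classes of the elements of X form a basis of W / (U - e) W. *)
Definition quotient_basis (e : F) (W : {vspace V}) (X : seq V) : Prop :=
  let W' := (mxend (mxU - e%:M) @: W)%VS in
  [/\ free X, (<<X>> :&: W' = 0)%VS & (<<X>> + W' = W)%VS].

Definition gram_det (i : nat) (X : seq V) : F :=
  \det (\matrix_(a < size X, b < size X)
          Qform ((mxU - invmx mxU) ^+ i.-1 *m X`_a) X`_b).

Definition square_sign (x : F) : int :=
  if [exists y : F, (y != 0) && (x == y ^+ 2)] then 1 else -1.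

(* The signs of the even parts at t - e; those of the odd parts are fixed by
   is_symplectic_partition. *)
Definition signs_at (e : F) (s : seq nat) (h : nat -> int) : Prop :=
  exists2 W : nat -> {vspace V}, orthogonal_splitting e W &
    forall i, ~~ odd i -> i \in s ->
      exists2 X, quotient_basis e (W i) X & h i = square_sign (gram_det i X).

Definition symplectic_type (x : sfun F) : Prop :=
  [/\ is_symplectic_function x,
      exists2 D, primary_decomposition D &
        forall g, in_Phi g ->
          perm_eq (sf_part x (self_dual_of g)) (exponents D g),
      signs_at 1 (sf_part x ('X - 1)) (sf_minus x)
    & signs_at (-1) (sf_part x ('X + 1)) (sf_plus x)].

Definition modified_type (x : sfun F) : Prop :=
  exists2 y, symplectic_type y & x = modification y.

End Types.

Definition sp_class (F : finFieldType) (n : nat) (x : sfun F) : {set Sp F n} :=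
  [set U : Sp F n | `[< modified_type U x >]].

Definition Ksum (F : finFieldType) (n : nat) (x : sfun F) : gring (Sp F n) :=
  \sum_(g in sp_class n x) gring_of g.

(* S enumerates the labels of the basis of nonzero K_nu(n). *)
Definition basis_labels (F : finFieldType) (n : nat) (S : seq (sfun F)) : Prop :=
  uniq S /\ forall x, x \in S <-> Pst x /\ sp_class n x != set0.

(* c is the coefficient c_{x, y}^z(n).  The relation can only hold when z(n) is
   non-empty, i.e. when the coefficient is defined. *)
Definition structure_constant (F : finFieldType) (n : nat) (x y z : sfun F)
    (c : int) : Prop :=
  exists (S : seq (sfun F)) (a : sfun F -> int),
    [/\ basis_labels n S, z \in S,
        gring_mul (Ksum n x) (Ksum n y) = \sum_(nu <- S) Ksum n nu *~ a nu
      & a z = c].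

(* Main.v *)
Require Import Defs.
From HB Require Import structures.
From mathcomp Require Import all_boot all_order all_fingroup all_algebra finmap.
From mathcomp Require Import boolp zify finfield ring.


Set Implicit Arguments.
Unset Strict Implicit.
Unset Printing Implicit Defensive.

Import GRing.Theory.
Local Open Scope ring_scope.

(** * Polynomials in a square matrix *)

Section PolyMatrix.
Variables (F : fieldType) (N : nat).
Implicit Types (U : 'M[F]_N) (p q : {poly F}).

Definition pm U p : 'M[F]_N := \sum_(k < size p) p`_k *: U ^+ k.

Lemma pmE U p m : (size p <= m)%N -> pm U p = \sum_(k < m) p`_k *: U ^+ k.
Proof.
move=> hm; rewrite /pm (big_ord_widen _ (fun k => p`_k *: U ^+ k) hm) big_mkcond /=.
apply: eq_bigr => i _; case: ltnP => // /leq_sizeP -> //; by rewrite scale0r.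
Qed.

Lemma pmD U p q : pm U (p + q) = pm U p + pm U q.
Proof.
have h := size_polyD p q.
rewrite (pmE U h) (pmE U (leq_maxl (size p) (size q))).
rewrite (pmE U (leq_maxr (size p) (size q))) -big_split /=.
by apply: eq_bigr => i _; rewrite coefD scalerDl.
Qed.

Lemma pmZ U c p : pm U (c *: p) = c *: pm U p.
Proof.
rewrite (pmE U (size_scale_leq c p)) /pm scaler_sumr.
by apply: eq_bigr => i _; rewrite coefZ scalerA.
Qed.

Lemma pm0 U : pm U 0 = 0.
Proof. by rewrite -(scale0r 0) pmZ scale0r. Qed.

Lemma pmN U p : pm U (- p) = - pm U p.
Proof. by rewrite -scaleN1r pmZ scaleN1r. Qed.

Lemma pmB U p q : pm U (p - q) = pm U p - pm U q.
Proof. by rewrite pmD pmN. Qed.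

Lemma pm_sum U I (r : seq I) (P : pred I) (G : I -> {poly F}) :
  pm U (\sum_(i <- r | P i) G i) = \sum_(i <- r | P i) pm U (G i).
Proof. by apply: (big_morph (pm U)) => [p q|]; rewrite ?pmD ?pm0. Qed.

Lemma pmXn U k : pm U 'X^k = U ^+ k.
Proof.
rewrite /pm size_polyXn big_ord_recr /= coefXn eqxx scale1r big1 ?add0r // => i _.
by rewrite coefXn (ltn_eqF (ltn_ord i)) scale0r.
Qed.

Lemma pmX U : pm U 'X = U.
Proof. by rewrite -(expr1 'X) pmXn. Qed.

Lemma pm1 U : pm U 1 = 1%:M.
Proof. by rewrite -(expr0 'X) pmXn. Qed.

Lemma pmC U c : pm U c%:P = c%:M.
Proof.
by rewrite -[c%:P]mulr1 mul_polyC pmZ pm1 scalemx1.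
Qed.

Lemma pmM U p q : pm U (p * q) = pm U p *m pm U q.
Proof.
elim/poly_ind: p => [|p c IHp]; first by rewrite mul0r pm0 mul0mx.
have step r : pm U (r * 'X) = pm U r *m U.
  rewrite -[r in LHS]coefK poly_def mulr_suml pm_sum {2}/pm mulmx_suml.
  apply: eq_bigr => i _.
  by rewrite -scalerAl pmZ -exprSr pmXn exprSr -scalemxAl.
have comm : U *m pm U q = pm U q *m U.
  rewrite /pm mulmx_suml mulmx_sumr; apply: eq_bigr => i _.
  by rewrite -scalemxAl -scalemxAr -[U *m _]/(U * _) -exprS exprSr.
have -> : (p * 'X + c%:P) * q = p * q * 'X + c *: q.
  by rewrite mulrDl mul_polyC mulrAC.
by rewrite !pmD !step IHp mulmxDl pmZ pmC mul_scalar_mx -!mulmxA comm.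
Qed.

Lemma pm_exp U p k : pm U (p ^+ k) = pm U p ^+ k.
Proof. by elim: k => [|k IHk]; rewrite ?pm1 // !exprS pmM IHk. Qed.

Lemma pmCC U p q : pm U p *m pm U q = pm U q *m pm U p.
Proof. by rewrite -!pmM mulrC. Qed.

Lemma pmCU U p : U *m pm U p = pm U p *m U.
Proof. by rewrite -{1 4}(pmX U) pmCC. Qed.

Lemma pm_tr U p : (pm U p)^T = pm U^T p.
Proof.
rewrite /pm raddf_sum; apply: eq_bigr => k _ /=.
rewrite linearZ /=; congr (_ *: _).
elim: (nat_of_ord k) => [|j IHj]; first by rewrite !expr0 trmx1.
by rewrite exprS exprSr trmx_mul IHj.
Qed.

Lemma pm_comp U p q : pm U (p \Po q) = pm (pm U q) p.
Proof.
rewrite comp_polyE pm_sum; apply: eq_bigr => i _.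
by rewrite pmZ pm_exp.
Qed.

Lemma pact_pm p (v : 'cV[F]_N) U :
  \sum_(k < size p) p`_k *: (U ^+ k *m v) = pm U p *m v.
Proof. by rewrite /pm mulmx_suml; apply: eq_bigr => i _; rewrite scalemxAl. Qed.

Definition ann U (v : 'cV[F]_N) (f : {poly F}) : Prop :=
  forall p, pm U p *m v = 0 <-> f %| p.

End PolyMatrix.

Lemma intertwine_exp (F : fieldType) (N N' : nat) (U : 'M[F]_N) (U' : 'M[F]_N')
    (P : 'M_(N', N)) k : P *m U = U' *m P -> P *m U ^+ k = U' ^+ k *m P.
Proof.
move=> h; elim: k => [|k IHk]; first by rewrite !expr0 mulmx1 mul1mx.
by rewrite !exprS -!mulmxE mulmxA h -mulmxA IHk mulmxA.
Qed.

Lemma pm_intertwine (F : fieldType) (N N' : nat) (U : 'M[F]_N) (U' : 'M[F]_N')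
    (P : 'M_(N', N)) p : P *m U = U' *m P -> P *m pm U p = pm U' p *m P.
Proof.
move=> h; rewrite /pm mulmx_sumr mulmx_suml; apply: eq_bigr => i _.
by rewrite -scalemxAr (intertwine_exp _ h) scalemxAl.
Qed.

Section Linear.
Variable F : fieldType.

Lemma unit_inj N (A : 'M[F]_N) :
  (forall x : 'cV_N, A *m x = 0 -> x = 0) -> A \in unitmx.
Proof.
move=> inj; rewrite -unitmx_tr -row_free_unit -kermx_eq0; apply/eqP/row_matrixP => i.
rewrite row0; apply: trmx_inj; rewrite trmx0; apply: inj.
rewrite -{1}[A]trmxK -trmx_mul -row_mul mulmx_ker row0 trmx0 //.
Qed.

Lemma mulmx_cV_eq m n (A B : 'M[F]_(m, n)) :
  (forall x : 'cV_n, A *m x = B *m x) -> A = B.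
Proof.
move=> h; apply/matrixP => i j.
have /matrixP/(_ i 0) := h (delta_mx j 0).
by rewrite -!colE !mxE.
Qed.

Lemma inj_left_inverse m n (A : 'M[F]_(m, n)) :
  (forall x : 'cV_n, A *m x = 0 -> x = 0) -> exists B : 'M_(n, m), B *m A = 1%:M.
Proof.
move=> inj; apply/row_fullP.
rewrite -[row_full A]/(\rank A == n) -mxrank_tr; change (row_free A^T).
rewrite -kermx_eq0; apply/eqP/row_matrixP => i.
rewrite row0; apply: trmx_inj; rewrite trmx0; apply: inj.
by rewrite -{1}[A]trmxK -trmx_mul -row_mul mulmx_ker row0 trmx0.
Qed.

Lemma surj_right_inverse m n k (A : 'M[F]_(m, n)) (C : 'M[F]_(m, k)) :
  (forall x : 'cV_k, exists c : 'cV_n, C *m x = A *m c) -> exists B, C = A *m B.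
Proof.
move=> surj.
have /fin_all_exists [g hg] : forall j : 'I_k, exists c : 'cV_n, col j C = A *m c.
  by move=> j; have [c] := surj (delta_mx j 0); rewrite -colE; exists c.
exists (\matrix_(i, j) g j i 0); apply/matrixP => i j.
have /matrixP/(_ i 0) := hg j; rewrite !mxE => ->.
by apply: eq_bigr => l _; rewrite mxE.
Qed.

Lemma two_sided_inverse m n (A : 'M[F]_(m, n)) :
  (forall x : 'cV_n, A *m x = 0 -> x = 0) ->
  (forall x : 'cV_m, exists c : 'cV_n, x = A *m c) ->
  exists B : 'M_(n, m), B *m A = 1%:M /\ A *m B = 1%:M.
Proof.
move=> /inj_left_inverse [B hB] surj.
have [B' hB'] : exists B', 1%:M = A *m B'.
  by apply: surj_right_inverse => x; rewrite mul1mx.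
exists B; split => //; suff -> : B = B' by [].
by rewrite -[B]mulmx1 hB' mulmxA hB mul1mx.
Qed.

Lemma pm_inj_exp N (U : 'M[F]_N) k : U \in unitmx -> U ^+ k \in unitmx.
Proof.
move=> uU; elim: k => [|k IHk]; first by rewrite expr0 unitmx1.
by rewrite exprS unitmx_mul uU.
Qed.

End Linear.

Lemma unitmx_finite_order (F : finFieldType) N (U : 'M[F]_N) :
  U \in unitmx -> exists k, U ^+ k.+1 = 1%:M.
Proof.
move=> uU; pose g (i : 'I_#|{: 'M[F]_N}|.+1) := U ^+ i.
have : ~~ injectiveb g.
  apply/negP => /injectiveP /leq_card; rewrite card_ord; by rewrite ltnn.
case/injectivePn => x [y nxy]; rewrite /g.
wlog: x y nxy / (x < y)%N => [W | xy] gxy.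
  case: (ltngtP x y) => c; [exact: (W x y)|apply: (W y x)|] => //.
    by rewrite eq_sym.
  by case/eqP: nxy; apply: val_inj.
exists (y - x).-1; rewrite prednK ?subn_gt0 //.
apply: (can_inj (mulKmx (pm_inj_exp x uU))).
by rewrite mulmx1 -[_ *m _]/(_ * _) -exprD subnKC // ltnW.
Qed.

(** * Isometries of symplectic spaces up to isomorphism *)

Record smod (F : fieldType) := SMod { dm : nat; act : 'M[F]_dm; frm : 'M[F]_dm }.

Section SMod.
Variable F : fieldType.
Implicit Types (A B C : smod F).

Definition good A :=
  [/\ (act A)^T *m frm A *m act A = frm A, (frm A)^T = - frm A
    & frm A \in unitmx].

Definition iso A B :=
  exists P : 'M[F]_(dm B, dm A), exists Pi,
    [/\ Pi *m P = 1%:M, P *m Pi = 1%:M, P *m act A = act B *m P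
      & P^T *m frm B *m P = frm A].

Lemma iso_refl A : iso A A.
Proof. by exists 1%:M, 1%:M; rewrite trmx1 !mulmx1 !mul1mx. Qed.

Lemma iso_sym A B : iso A B -> iso B A.
Proof.
case=> P [Pi [h1 h2 h3 h4]]; exists Pi, P; split => //.
  by rewrite -[RHS]mul1mx -h1 -!mulmxA (mulmxA P) h3 -mulmxA h2 mulmx1.
by rewrite -h4 -!mulmxA h2 mulmx1 mulmxA -trmx_mul h2 trmx1 mul1mx.
Qed.

Lemma iso_trans B A C : iso A B -> iso B C -> iso A C.
Proof.
case=> P [Pi [h1 h2 h3 h4]] [Q [Qi [k1 k2 k3 k4]]].
exists (Q *m P), (Pi *m Qi); split.
- by rewrite mulmxA -(mulmxA Pi) k1 mulmx1.
- by rewrite mulmxA -(mulmxA Q) h2 mulmx1.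
- by rewrite -mulmxA h3 mulmxA k3 mulmxA.
- by rewrite trmx_mul -!mulmxA (mulmxA Q^T) (mulmxA _ Q) k4 mulmxA h4.
Qed.

Lemma inverse_dim m n (P : 'M[F]_(m, n)) Q :
  Q *m P = 1%:M -> P *m Q = 1%:M -> m = n.
Proof.
move=> /mulmx1_min h1 /mulmx1_min h2; apply/eqP.
by rewrite eqn_leq h1 h2.
Qed.

Lemma iso_dim A B : iso A B -> dm A = dm B.
Proof. by case=> P [Pi [h1 h2 _ _]]; rewrite (inverse_dim h1 h2). Qed.

Lemma inverse_mulmx_eq0 m n k (P : 'M[F]_(m, n)) Q (X : 'M_(n, k)) :
  Q *m P = 1%:M -> P *m X = 0 -> X = 0.
Proof. by move=> h e; rewrite -[X]mul1mx -h -mulmxA e mulmx0. Qed.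

Lemma iso_good A B : iso A B -> good A -> good B.
Proof.
move=> /iso_sym [P [Pi [h1 h2 h3 h4]]] [g1 g2 g3]; split.
- rewrite -h4 !mulmxA -trmx_mul h3 -!mulmxA h3 trmx_mul -mulmxA.
  by rewrite (mulmxA (frm A)) 2!(mulmxA (act A)^T) g1.
- by rewrite -h4 !trmx_mul trmxK g2 mulNmx mulmxN mulmxA.
- apply: unit_inj => x; rewrite -h4 -!mulmxA => h0.
  have {h0} : Pi^T *m (P^T *m (frm A *m (P *m x))) = 0 by rewrite h0 mulmx0.
  rewrite mulmxA -trmx_mul h2 trmx1 mul1mx.
  by move=> /(inverse_mulmx_eq0 (mulVmx g3)); apply: inverse_mulmx_eq0 h1.
Qed.

Lemma good_act_unit A : good A -> act A \in unitmx.
Proof.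
case=> g1 _ g3; apply: unit_inj => x e; apply: (inverse_mulmx_eq0 (mulVmx g3)).
by rewrite -g1 -mulmxA e mulmx0.
Qed.

(* The adjoint of the action is its inverse. *)
Lemma good_adj A : good A -> (act A)^T *m frm A = frm A *m invmx (act A).
Proof.
move=> gA; have [g1 _ _] := gA; rewrite -[in RHS]g1.
by rewrite mulmxK // good_act_unit.
Qed.

Definition bdiag m n (X : 'M[F]_m) (Y : 'M[F]_n) : 'M_(m + n) := block_mx X 0 0 Y.

Lemma bdiag_mul m n (X X' : 'M_m) (Y Y' : 'M_n) :
  bdiag X Y *m bdiag X' Y' = bdiag (X *m X') (Y *m Y').
Proof. by rewrite /bdiag mulmx_block !(mulmx0, mul0mx, addr0, add0r). Qed.

Lemma bdiag_tr m n (X : 'M_m) (Y : 'M_n) : (bdiag X Y)^T = bdiag X^T Y^T.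
Proof. by rewrite /bdiag tr_block_mx !trmx0. Qed.

Lemma bdiag1 m n : bdiag 1%:M 1%:M = 1%:M :> 'M_(m + n).
Proof. by rewrite /bdiag -scalar_mx_block. Qed.

Lemma bdiagZ m n c (X : 'M_m) (Y : 'M_n) : c *: bdiag X Y = bdiag (c *: X) (c *: Y).
Proof. by rewrite /bdiag scale_block_mx !scaler0. Qed.

Lemma bdiagD m n (X X' : 'M_m) (Y Y' : 'M_n) :
  bdiag X Y + bdiag X' Y' = bdiag (X + X') (Y + Y').
Proof. by rewrite /bdiag add_block_mx !addr0. Qed.

Lemma bdiag_inj m n (X X' : 'M_m) (Y Y' : 'M_n) :
  bdiag X Y = bdiag X' Y' -> X = X' /\ Y = Y'.
Proof. by move=> /eq_block_mx []. Qed.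

Lemma bdiag_exp m n (X : 'M_m) (Y : 'M_n) k : bdiag X Y ^+ k = bdiag (X ^+ k) (Y ^+ k).
Proof.
elim: k => [|k IHk]; first exact: esym (bdiag1 _ _).
by rewrite !exprS IHk -!mulmxE bdiag_mul.
Qed.

Lemma bdiag_pm m n (X : 'M_m) (Y : 'M_n) p : pm (bdiag X Y) p = bdiag (pm X p) (pm Y p).
Proof.
rewrite /pm; elim/big_rec3: _ => [|i x y z _ ->]; first by rewrite /bdiag block_mx0.
by rewrite bdiag_exp bdiagZ bdiagD.
Qed.

Lemma bdiag_unit m n (X : 'M_m) (Y : 'M_n) :
  (bdiag X Y \in unitmx) = (X \in unitmx) && (Y \in unitmx).
Proof. by rewrite !unitmxE /bdiag det_ublock unitrM. Qed.

Definition dsum A B : smod F :=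
  SMod (bdiag (act A) (act B)) (bdiag (frm A) (frm B)).

Lemma good_dsum A B : good (dsum A B) <-> good A /\ good B.
Proof.
rewrite /good /=; split.
  case; rewrite !bdiag_tr !bdiag_mul bdiag_unit => /bdiag_inj [h1 h2].
  rewrite -[- bdiag _ _]scaleN1r bdiagZ !scaleN1r => /bdiag_inj [h3 h4].
  by case/andP.
case=> -[h1 h2 h3] [k1 k2 k3].
rewrite !bdiag_tr !bdiag_mul bdiag_unit h1 k1 h2 k2 h3 k3; split=> //.
by rewrite -[- bdiag _ _]scaleN1r bdiagZ !scaleN1r.
Qed.

Lemma iso_dsum A A' B B' : iso A A' -> iso B B' -> iso (dsum A B) (dsum A' B').
Proof.
case=> P [Pi [h1 h2 h3 h4]] [Q [Qi [k1 k2 k3 k4]]].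
exists (block_mx P 0 0 Q), (block_mx Pi 0 0 Qi).
split; rewrite /= ?tr_block_mx /bdiag !mulmx_block
  !(mulmx0, mul0mx, addr0, add0r, trmx0) ?(h1, h2, h3, h4, k1, k2, k3, k4) //;
  exact: esym (scalar_mx_block _ _ _).
Qed.

Definition smod0 : smod F := @SMod F 0 0 0.

Lemma dsumC A B : iso (dsum A B) (dsum B A).
Proof.
exists (block_mx 0 1%:M 1%:M 0), (block_mx 0 1%:M 1%:M 0).
by split; rewrite /= ?tr_block_mx /bdiag !mulmx_block
  !(mulmx0, mul0mx, addr0, add0r, trmx0, trmx1, mul1mx, mulmx1) // -scalar_mx_block.
Qed.

Lemma dsum_swap A B C : iso (dsum A (dsum B C)) (dsum B (dsum A C)).
Proof.
pose P a b c : 'M[F]_(a + (b + c), b + (a + c)) :=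
  block_mx 0 (row_mx 1%:M 0) (col_mx 1%:M 0) (block_mx 0 0 0 1%:M).
have PP a b c : P a b c *m P b a c = 1%:M.
  rewrite /P mulmx_block !(mulmx0, mul0mx, addr0, add0r).
  rewrite !(mul_row_col, mul_row_block, mul_col_row, mul_block_col, mulmx_block).
  rewrite !(mulmx0, mul0mx, addr0, add0r, mulmx1, mul1mx, row_mx0, col_mx0).
  by rewrite -[X in col_mx X _]row_mx0 -block_mxEv add_block_mx !(addr0, add0r) -!scalar_mx_block.
exists (P _ _ _), (P _ _ _); split; try exact: PP; rewrite /= /bdiag.
- rewrite /P; do ![rewrite !(mulmx_block, mul_row_block, mul_row_col, mul_col_row,
    mul_block_col, mul_col_mx, mul_mx_row, mulmx0, mul0mx, addr0, add0r, mulmx1,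
    mul1mx, row_mx0, col_mx0)].
  by [].
- rewrite /P; do ![rewrite !(tr_block_mx, tr_row_mx, tr_col_mx, trmx0, trmx1,
    mulmx_block, mul_row_block, mul_row_col, mul_col_row,
    mul_block_col, mul_col_mx, mul_mx_row, mulmx0, mul0mx, addr0, add0r, mulmx1,
    mul1mx, row_mx0, col_mx0)].
  by rewrite -[X in row_mx _ X]col_mx0 -block_mxEh add_block_mx !(addr0, add0r).
Qed.

(** A non-degenerate stable subspace splits off. *)
Lemma splitting A k (Z : 'M[F]_(dm A, k)) (D : 'M_k) :
  good A -> act A *m Z = Z *m D ->
  (forall c : 'cV_k, Z^T *m frm A *m Z *m c = 0 -> c = 0) ->
  exists2 A', good (dsum (SMod D (Z^T *m frm A *m Z)) A')
            & iso A (dsum (SMod D (Z^T *m frm A *m Z)) A').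
Proof.
case: A Z => N U J Z gA; rewrite /= in Z *; move=> UZ nd.
have [/= g1 g2 g3] := gA; have /= uU := good_act_unit gA.
set G := Z^T *m J *m Z; have uG : G \in unitmx by apply: unit_inj.
pose W := Z^T *m J.
have uD : D \in unitmx.
  apply: unit_inj => x Dx; apply: nd.
  suff -> : G *m x = 0 by [].
  have : U *m Z *m x = 0 by rewrite UZ -mulmxA Dx mulmx0.
  rewrite -mulmxA => /(inverse_mulmx_eq0 (mulVmx uU)) Zx.
  by rewrite /G -mulmxA Zx mulmx0.
have WU : W *m U = (invmx D)^T *m W.
  have e : Z = U *m Z *m invmx D by rewrite UZ mulmxK.
  by rewrite /W {1}e !trmx_mul -!mulmxA; congr (_ *m _); rewrite !mulmxA -(mulmxA _ _ J)
    -(mulmxA _ _ U) g1.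
have [l [Yt [hYt fY]]] : exists l (Yt : 'M_(l, N)), (Yt :=: kermx W^T)%MS /\ row_free Yt.
  by exists _, (row_base (kermx W^T)); split; [exact: eq_row_base|exact: row_base_free].
pose Y := Yt^T.
have WY : W *m Y = 0.
  by apply: trmx_inj; rewrite trmx_mul trmxK trmx0; apply/sub_kermxP; rewrite hYt.
have kerW h (X : 'M_(N, h)) : W *m X = 0 -> exists E, X = Y *m E.
  move=> e; have : (X^T <= Yt)%MS.
    by rewrite hYt; apply/sub_kermxP; rewrite -trmx_mul e trmx0.
  case/submxP => E hE; exists E^T; apply: trmx_inj.
  by rewrite hE trmx_mul !trmxK.
have injY h (E : 'M_(_, h)) : Y *m E = 0 -> E = 0.
  move=> e; apply: trmx_inj; apply: (row_free_inj fY).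
  by rewrite trmx0 mul0mx -[Yt]trmxK -trmx_mul e trmx0.
have [E UY] : exists E, U *m Y = Y *m E.
  by apply: kerW; rewrite mulmxA WU -mulmxA WY mulmx0.
have ZJY : Z^T *m J *m Y = 0 by [].
have YJZ : Y^T *m J *m Z = 0.
  apply: trmx_inj; rewrite !trmx_mul trmxK trmx0 g2 mulNmx mulmxN mulmxA.
  by rewrite ZJY oppr0.
have iA : iso (dsum (SMod D G) (SMod E (Y^T *m J *m Y))) (SMod U J).
  have [||Pi [P1 P2]] := @two_sided_inverse F _ _ (row_mx Z Y).
  - move=> x; rewrite -[x]vsubmxK mul_row_col => e.
    have : W *m (Z *m usubmx x + Y *m dsubmx x) = 0 by rewrite e mulmx0.
    rewrite mulmxDr !mulmxA WY mul0mx addr0 => /nd x0.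
    by move: e; rewrite x0 mulmx0 add0r => /injY ->; rewrite col_mx0.
  - move=> x; have e : W *m (x - Z *m (invmx G *m (W *m x))) = 0.
      by rewrite mulmxBr !mulmxA -/W -/G mulmxV // mul1mx subrr.
    have [y hy] := kerW _ _ e; exists (col_mx (invmx G *m (W *m x)) y).
    by rewrite mul_row_col -hy addrC subrK.
  exists (row_mx Z Y), Pi; split => //=.
    by rewrite /bdiag mul_row_block !mulmx0 addr0 add0r mul_mx_row UZ UY.
  by rewrite tr_row_mx mul_col_mx mul_col_row ZJY YJZ.
exists (SMod E (Y^T *m J *m Y)); last exact: iso_sym.
by apply: iso_good gA; apply: iso_sym.
Qed.

(** Comparison of two forms on the same module: the form of B, carried to A,
   is Q(x, S y) for a self-adjoint S in the centralizer of the action, and a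
   factorization of S as the adjoint of T times T turns the isomorphism of
   modules into an isometry. *)
Lemma transfer A B (P : 'M[F]_(dm B, dm A)) Pi T :
  Pi *m P = 1%:M -> P *m Pi = 1%:M -> P *m act A = act B *m P ->
  T \in unitmx -> T *m act A = act A *m T ->
  P^T *m frm B *m P = T^T *m frm A *m T -> iso A B.
Proof.
move=> h1 h2 h3 uT cT e; exists (P *m invmx T), (T *m Pi).
have cTi : invmx T *m act A = act A *m invmx T.
  apply: (can_inj (mulKmx uT)); rewrite !mulmxA mulmxV // mul1mx cT -mulmxA.
  by rewrite mulmxV // mulmx1.
split.
- by rewrite mulmxA -(mulmxA T) h1 mulmx1 mulmxV.
- by rewrite mulmxA -(mulmxA P) mulVmx // mulmx1.
- by rewrite -mulmxA cTi !mulmxA h3.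
- by rewrite trmx_mul -!mulmxA (mulmxA P^T) (mulmxA _ P) e -!mulmxA mulmxV // mulmx1
    mulmxA -trmx_mul mulmxV // trmx1 mul1mx.
Qed.

Lemma transferS A B (P : 'M[F]_(dm B, dm A)) Pi
    (S := invmx (frm A) *m (P^T *m frm B *m P)) :
  good A -> good B -> Pi *m P = 1%:M -> P *m Pi = 1%:M ->
  P *m act A = act B *m P ->
  [/\ frm A *m S = P^T *m frm B *m P, S^T *m frm A = frm A *m S,
      S *m act A = act A *m S & S \in unitmx].
Proof.
move=> gA gB h1 h2 h3; have [a1 a2 a3] := gA; have [b1 b2 b3] := gB.
have uU := good_act_unit gA.
have JS : frm A *m S = P^T *m frm B *m P by rewrite /S mulKVmx.
split => //.
- have : (frm A *m S)^T = - (frm A *m S).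
    by rewrite JS !trmx_mul trmxK b2 mulNmx mulmxN mulmxA.
  by rewrite trmx_mul a2 mulmxN => /oppr_inj.
- have : (act A)^T *m (frm A *m S) *m act A = frm A *m S.
    rewrite JS !mulmxA -trmx_mul h3 -!mulmxA h3 trmx_mul -mulmxA.
    by rewrite (mulmxA (frm B)) 2!(mulmxA (act B)^T) b1.
  rewrite mulmxA good_adj // -!mulmxA => /(can_inj (mulKmx a3)) e.
  by rewrite -[in RHS]e mulKVmx.
- rewrite unitmx_mul unitmx_inv a3 /=; apply: unit_inj => x; rewrite -!mulmxA => h0.
  have {h0} : Pi^T *m (P^T *m (frm B *m (P *m x))) = 0 by rewrite h0 mulmx0.
  rewrite mulmxA -trmx_mul h2 trmx1 mul1mx.
  by move=> /(inverse_mulmx_eq0 (mulVmx b3)); apply: inverse_mulmx_eq0 h1.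
Qed.

End SMod.

(** * Reciprocal polynomials and the set of self-dual primes *)

Section Reciprocal.
Variable F : finFieldType.
Implicit Types (f g p q : {poly F}).

Definition rvk m p : {poly F} := \sum_(i < m.+1) p`_i *: 'X^(m - i).
Definition rv p := rvk (size p).-1 p.

Lemma rvk_coef m p k : (rvk m p)`_k = if (k <= m)%N then p`_(m - k) else 0.
Proof.
rewrite /rvk coef_sum; case: leqP => hk.
  have hm : (m - k < m.+1)%N by lia.
  rewrite (bigD1 (Ordinal hm)) //= coefZ coefXn subKn // eqxx mulr1 big1 ?addr0 // => i ni.
  rewrite coefZ coefXn; case: eqP => e; rewrite ?mulr0 //.
  by case/eqP: ni; apply: val_inj => /=; have := ltn_ord i; lia.
rewrite big1 // => i _; rewrite coefZ coefXn; case: eqP => e; rewrite ?mulr0 //.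
by lia.
Qed.

Lemma rvkD m p q : rvk m (p + q) = rvk m p + rvk m q.
Proof.
by apply/polyP => k; rewrite coefD !rvk_coef; case: ifP; rewrite ?coefD ?addr0.
Qed.

Lemma rvkZ m c p : rvk m (c *: p) = c *: rvk m p.
Proof.
by apply/polyP => k; rewrite coefZ !rvk_coef; case: ifP; rewrite ?coefZ ?mulr0.
Qed.

Lemma rvk0 m : rvk m 0 = 0.
Proof. by apply/polyP => k; rewrite rvk_coef !coef0 if_same. Qed.

Lemma rvk_sum m I (r : seq I) (G : I -> {poly F}) :
  rvk m (\sum_(i <- r) G i) = \sum_(i <- r) rvk m (G i).
Proof.
apply: (big_morph (rvk m)) => [p q|]; first exact: rvkD.
exact: rvk0.
Qed.

Lemma rvkXn m k : (k <= m)%N -> rvk m 'X^k = 'X^(m - k).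
Proof.
move=> hk; apply/polyP => i; rewrite rvk_coef !coefXn.
case: ifP => hi; first by have -> : (m - i == k)%N = (i == m - k)%N by lia.
by rewrite (_ : (i == m - k)%N = false) //; lia.
Qed.

Lemma rvkM m n p q : (size p <= m.+1)%N -> (size q <= n.+1)%N ->
  rvk (m + n) (p * q) = rvk m p * rvk n q.
Proof.
have exp k (r : {poly F}) : (size r <= k.+1)%N -> r = \sum_(i < k.+1) r`_i *: 'X^i.
  move=> h; rewrite -poly_def; apply/polyP => i; rewrite coef_poly.
  by case: ltnP => // hi; apply: nth_default; apply: leq_trans h hi.
move=> hp hq; rewrite {1}(exp m p) // {1}(exp n q) // /rvk -/(rvk (m + n) _).
rewrite !mulr_suml rvk_sum; apply: eq_bigr => i _.
rewrite mulr_sumr rvk_sum mulr_sumr; apply: eq_bigr => j _.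
rewrite -!scalerAl -!scalerAr !rvkZ -exprD rvkXn; last by have := ltn_ord i; have := ltn_ord j; lia.
rewrite -exprD; congr (_ *: (_ *: 'X^_)).
by have := ltn_ord i; have := ltn_ord j; lia.
Qed.

Lemma rvM p q : rv (p * q) = rv p * rv q.
Proof.
have rv0 : rv 0 = 0 by exact: rvk0.
have [-> | p0] := eqVneq p 0; first by rewrite mul0r !rv0 mul0r.
have [-> | q0] := eqVneq q 0; first by rewrite mulr0 !rv0 mulr0.
rewrite /rv -rvkM ?leqSpred // size_mul //.
congr (rvk _ _); move: p0 q0; rewrite -!size_poly_gt0.
by case: (size p) (size q) => [|a] [|b] //= _ _; rewrite addnS.
Qed.

Lemma rv1 : rv 1 = 1.
Proof. by rewrite /rv size_poly1 -(expr0 'X) rvkXn. Qed.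

Lemma rvX p k : rv (p ^+ k) = rv p ^+ k.
Proof. by elim: k => [|k IHk]; rewrite ?rv1 // !exprS rvM IHk. Qed.

Lemma rvZ c p : rv (c *: p) = c *: rv p.
Proof.
have [-> | c0] := eqVneq c 0; last by rewrite /rv size_scale // rvkZ.
by rewrite !scale0r; apply/polyP => k; rewrite /rv rvk_coef !coef0 if_same.
Qed.

Lemma rv_coef0 p : (rv p)`_0 = lead_coef p.
Proof. by rewrite /rv rvk_coef subn0 lead_coefE. Qed.

Lemma size_rv p : p`_0 != 0 -> size (rv p) = size p.
Proof.
move=> p0; have sp : (0 < size p)%N.
  by rewrite size_poly_gt0; apply: contraNneq p0 => ->; rewrite coef0.
move: p0; rewrite /rv; case e: (size p) sp => [|n] //= _ p0.
apply/eqP; rewrite eqn_leq; apply/andP; split.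
  by apply/leq_sizeP => j hj; rewrite rvk_coef leqNgt hj.
rewrite ltnNge; apply/negP => /leq_sizeP/(_ _ (leqnn _)).
by rewrite rvk_coef leqnn subnn => p00; rewrite p00 eqxx in p0.
Qed.

Lemma rvK p : p`_0 != 0 -> rv (rv p) = p.
Proof.
move=> p0; apply/polyP => k; rewrite {1}/rv size_rv // rvk_coef.
case: leqP => hk; last by apply/esym/nth_default; apply: leq_trans (leqSpred _) hk.
by rewrite rvk_coef leq_subr subKn.
Qed.

Lemma rv_neq0 p : p != 0 -> rv p != 0.
Proof.
by move=> p0; apply/eqP => e; have := rv_coef0 p; rewrite e coef0 => /esym/eqP;
  rewrite lead_coef_eq0 (negPf p0).
Qed.

Lemma pm_inv_rv N (U : 'M[F]_N) p : U \in unitmx ->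
  pm U (rv p) = U ^+ (size p).-1 *m pm (invmx U) p.
Proof.
move=> uU; have [-> | p0] := eqVneq p 0.
  rewrite !pm0 mulmx0 (_ : rv 0 = 0) ?pm0 //.
  exact: rvk0.
rewrite (@pmE _ _ _ p (size p).-1.+1) ?leqSpred // /rv /rvk pm_sum mulmx_sumr.
apply: eq_bigr => i _; rewrite pmZ -scalemxAr pmXn; congr (_ *: _).
have : (i <= (size p).-1)%N by rewrite -ltnS.
move: (size p).-1 (nat_of_ord i) => m k hk.
rewrite -{2}(subnK hk) exprD -!mulmxE -mulmxA.
suff -> : U ^+ k *m invmx U ^+ k = 1%:M by rewrite mulmx1.
elim: (k) => [|j IHj]; first by rewrite !expr0 mulmx1.
rewrite exprSr exprS -!mulmxE -mulmxA (mulmxA U) mulmxV // mul1mx //.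
Qed.

Lemma dual_polyE g : dual_poly g = (g`_0)^-1 *: rv g.
Proof.
rewrite /dual_poly /rv /rvk scaler_sumr.
have [-> | g0] := eqVneq g 0.
  by rewrite size_poly0 big_ord0 big1 // => i _; rewrite !coef0 scale0r scaler0.
rewrite prednK ?size_poly_gt0 //; apply: eq_bigr => i _.
by rewrite scalerA mulrC.
Qed.

Section Phi.
Variable g : {poly F}.
Hypothesis Pg : in_Phi g.

Lemma Phi_coef0 : g`_0 != 0.
Proof.
case: Pg => mg irr nX; apply/negP => /eqP g0.
have : 'X %| g by rewrite -['X]subr0 -polyC0 dvdp_XsubCl /root horner_coef0 g0.
move=> /(irr.2 'X); rewrite size_polyX => /(_ isT).
by rewrite eqp_monic ?monicX // eq_sym (negPf nX).
Qed.

Lemma Phi_size : (1 < size g)%N. Proof. by case: Pg => _ []. Qed.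
Lemma Phi_monic : g \is monic. Proof. by case: Pg. Qed.
Lemma Phi_neq0 : g != 0. Proof. exact: monic_neq0 Phi_monic. Qed.

Lemma Phi_coprime p : coprimep g p = ~~ (g %| p).
Proof. by case: Pg => _ irr _; rewrite irreducible_poly_coprime. Qed.

Lemma rv_dual : rv g = g`_0 *: dual_poly g.
Proof. by rewrite dual_polyE scalerA divff ?scale1r // Phi_coef0. Qed.

Lemma dual_coef0 : (dual_poly g)`_0 = (g`_0)^-1.
Proof. by rewrite dual_polyE coefZ rv_coef0 (monicP Phi_monic) mulr1. Qed.

Lemma dualK : dual_poly (dual_poly g) = g.
Proof.
by rewrite [LHS]dual_polyE dual_coef0 invrK dual_polyE rvZ rvK ?Phi_coef0 // scalerA
  divff ?scale1r // Phi_coef0.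
Qed.

Lemma size_dual : size (dual_poly g) = size g.
Proof. by rewrite dual_polyE size_scale ?invr_eq0 ?Phi_coef0 // size_rv // Phi_coef0. Qed.

Lemma dual_Phi : in_Phi (dual_poly g).
Proof.
have c0 := Phi_coef0.
have mon : dual_poly g \is monic.
  rewrite monicE dual_polyE lead_coefZ lead_coefE size_rv // rvk_coef leqnn subnn.
  by rewrite mulVf.
split => //; last first.
  apply/eqP => e; have := dual_coef0; rewrite e coefX => /esym/eqP.
  by rewrite invr_eq0 (negPf c0).
split; first by rewrite size_dual Phi_size.
move=> q sq /dvdpP [h e].
have q0 : q`_0 != 0.
  apply: contraTneq c0 => q0; have := dual_coef0; rewrite e coef0M q0 mulr0.
  by move=> /esym/eqP; rewrite invr_eq0 => /eqP ->; rewrite eqxx.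
have := Pg; case=> _ [_ irr] _.
have : rv q %| g.
  by rewrite -[X in _ %| X]dualK dual_polyE e rvM dvdpZr ?dvdp_mull // ?invr_eq0
    -?e ?dual_coef0 ?invr_eq0.
move=> /irr; rewrite size_rv // => /(_ sq) /eqpP [[a b] /= /andP [a0 b0] ab].
have /(congr1 rv) := ab; rewrite !rvZ rvK // => e2.
apply/eqpP; exists (a, b * g`_0); rewrite /= ?a0 ?mulf_neq0 //.
by rewrite e2 rv_dual scalerA.
Qed.

End Phi.

Lemma Phi_dvd g h : in_Phi g -> in_Phi h -> (g %| h) = (g == h).
Proof.
move=> Pg Ph; apply/idP/eqP => [|->]; last exact: dvdpp.
case: (Ph) => mh [_ irr] _ /irr; rewrite neq_ltn Phi_size // orbT => /(_ isT).
by rewrite eqp_monic ?Phi_monic // => /eqP.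
Qed.

Lemma Phi_coprime_neq g h : in_Phi g -> in_Phi h -> g != h -> coprimep g h.
Proof. by move=> Pg Ph n; rewrite Phi_coprime // Phi_dvd. Qed.

Lemma PhisP f : in_Phis f -> exists2 g, in_Phi g &
  (f = g /\ dual_poly g = g) \/
  [/\ f = g * dual_poly g, dual_poly g != g & coprimep g (dual_poly g)].
Proof.
case=> g Pg ->; exists g => //; rewrite /self_dual_of; case: eqP => e; first by left.
move/eqP: e => e; right; split => //.
by apply: Phi_coprime_neq; rewrite // 1?eq_sym //; apply: dual_Phi.
Qed.

Lemma self_dual_dual g : in_Phi g -> self_dual_of (dual_poly g) = self_dual_of g.
Proof.
move=> Pg; rewrite /self_dual_of dualK // eq_sym; case: eqP => e //.
by rewrite mulrC.
Qed.

Lemma self_dual_dvd g h : in_Phi g -> in_Phi h ->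
  g %| self_dual_of h = (g == h) || (g == dual_poly h).
Proof.
move=> Pg Ph; rewrite /self_dual_of; case: ifP => [/eqP ->|_].
  by rewrite orbb Phi_dvd.
have Pd := dual_Phi Ph; rewrite -(Phi_dvd Pg Ph) -(Phi_dvd Pg Pd).
case: (boolP (g %| h)) => [d|]; first by rewrite dvdp_mulr.
by rewrite -Phi_coprime // => c; rewrite Gauss_dvdpr.
Qed.

Lemma self_dual_eq g h : in_Phi g -> in_Phi h ->
  (self_dual_of g == self_dual_of h) = (g == h) || (g == dual_poly h).
Proof.
move=> Pg Ph; apply/idP/orP => [/eqP e|]; last first.
  by case=> /eqP ->; rewrite ?self_dual_dual.
apply/orP; rewrite -self_dual_dvd // -e self_dual_dvd // eqxx //.
Qed.

Section Phis.
Variable f : {poly F}.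
Hypothesis Pf : in_Phis f.

Lemma Phis_monic : f \is monic.
Proof.
have [g Pg [[-> _]|[-> _ _]]] := PhisP Pf; first exact: Phi_monic.
by rewrite monicMl ?Phi_monic //; apply: dual_Phi.
Qed.

Lemma Phis_neq0 : f != 0. Proof. exact: monic_neq0 Phis_monic. Qed.

Lemma Phis_size : (1 < size f)%N.
Proof.
have [g Pg [[-> _]|[-> _ _]]] := PhisP Pf; first exact: Phi_size.
have s1 := Phi_size Pg; rewrite size_mul ?size_dual ?Phi_neq0 //; last exact: dual_Phi.
by case: (size g) s1 => [|[|n]] //; rewrite addnS.
Qed.

Lemma Phis_coef0 : f`_0 != 0.
Proof.
have [g Pg [[-> _]|[-> _ _]]] := PhisP Pf; first exact: Phi_coef0.
by rewrite coef0M mulf_neq0 ?Phi_coef0 //; apply: dual_Phi.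
Qed.

Lemma Phis_rv : exists2 c, c != 0 & rv f = c *: f.
Proof.
have [g Pg [[-> e]|[-> _ _]]] := PhisP Pf.
  by exists g`_0; rewrite ?Phi_coef0 // rv_dual // e.
have Pd := dual_Phi Pg.
exists (g`_0 * (dual_poly g)`_0); first by rewrite mulf_neq0 ?Phi_coef0.
rewrite rvM rv_dual // [rv (dual_poly g)]rv_dual // dualK //.
by rewrite -scalerAl -scalerAr scalerA mulrC (mulrC (dual_poly g)).
Qed.

Lemma Phis_exp_rv k : exists2 c, c != 0 & rv (f ^+ k) = c *: f ^+ k.
Proof.
have [c c0 e] := Phis_rv; exists (c ^+ k); first by rewrite expf_neq0.
by rewrite rvX e exprZn.
Qed.

(** An ideal stable under reciprocals that contains a power of f is generated
   by a power of f: the two conjugate primes behave as a single one. *)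
Lemma Phis_prime (I : {poly F} -> Prop) m p :
  (forall a b, I a -> I b -> I (a + b)) -> (forall a b, I b -> I (a * b)) ->
  (forall a, I a -> I (rv a)) ->
  I (f ^+ m) -> I p -> ~~ (f %| p) -> I 1.
Proof.
move=> ID IM Irv If Ip nf.
have coI a b : I a -> I b -> coprimep a b -> I 1.
  move=> Ia Ib /Bezout_eq1_coprimepP [[u v] /= e]; rewrite -e.
  by apply: ID; apply: IM.
have [g Pg [[ef _]|[ef ng cop]]] := PhisP Pf.
  apply: coI If Ip _; apply: coprimep_expl.
  by rewrite ef Phi_coprime // -ef.
have aux h k c : in_Phi h -> f = h * k -> coprimep h k -> c != 0 ->
    rv k = c *: h -> ~~ (h %| p) -> I 1.
  move=> Ph efk hk c0 rk nh.
  have : coprimep (h ^+ m) p by apply: coprimep_expl; rewrite Phi_coprime.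
  case/Bezout_eq1_coprimepP => [[u v] /= e].
  have Ik : I (k ^+ m).
    rewrite -[k ^+ m]mul1r -e mulrDl; apply: ID.
      by rewrite -mulrA -exprMn -efk; apply: IM.
    by rewrite mulrAC; apply: IM.
  have Ih : I (h ^+ m).
    have := Irv _ Ik; rewrite rvX rk exprZn => /(IM (c ^- m)%:P).
    by rewrite mul_polyC scalerA mulVf ?scale1r // expf_neq0.
  by apply: coI Ih Ik _; apply: coprimep_expl; apply: coprimep_expr.
have Pd := dual_Phi Pg.
case: (boolP (g %| p)) => [dg|ndg].
  apply: (aux (dual_poly g) g g`_0); rewrite ?Phi_coef0 ?rv_dual //.
  - by rewrite mulrC.
  - by rewrite coprimep_sym.
  - by apply: contra nf => dd; rewrite ef Gauss_dvdp // dg.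
apply: (aux g (dual_poly g) (dual_poly g)`_0); rewrite ?Phi_coef0 //.
by rewrite rv_dual // dualK.
Qed.

Lemma Phis_coprime_rv p : p`_0 != 0 -> coprimep f p -> coprimep f (rv p).
Proof.
move=> p0 cop.
pose I q := exists a b, q = a * f + b * rv p.
apply/Bezout_eq1_coprimepP.
suff [a [b e]] : I 1 by exists (a, b).
have [c c0 ec] := Phis_rv.
case/Bezout_eq1_coprimepP: cop => [[u v] /= e].
pose m := maxn (size (u * f)%R) (size (v * p)%R).
have h1 : (size (u * f)%R <= m.+1)%N by rewrite leqW // leq_maxl.
have h2 : (size (v * p)%R <= m.+1)%N by rewrite leqW // leq_maxr.
have hs (a b : {poly F}) : (size (a * b)%R <= m.+1)%N -> b`_0 != 0 -> exists d, rvk m (a * b) = d * rv b.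
  move=> sab b0; have [->|a0] := eqVneq a 0.
    by exists 0; rewrite !mul0r; apply/polyP => i; rewrite rvk_coef !coef0 if_same.
  have bn0 : b != 0 by apply: contraNneq b0 => ->; rewrite coef0.
  move: sab; rewrite size_mul //; move: a0 bn0; rewrite -!size_poly_gt0 => sa sb sab.
  have sm : (m - (size b).-1 + (size b).-1 = m)%N.
    by rewrite subnK //; case: (size a) (size b) sa sb sab => [|i] [|j] //=; lia.
  exists (rvk (m - (size b).-1) a); rewrite /rv -rvkM ?leqSpred ?sm //.
  by case: (size a) (size b) sa sb sab => [|i] [|j] //=; lia.
have [d1 e1] := hs _ _ h1 Phis_coef0; have [d2 e2] := hs _ _ h2 p0.
have eX : I 'X^m.
  exists (d1 * c%:P), d2; rewrite -mulrA mul_polyC -ec -e1 -e2 -rvkD e.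
  by rewrite -(expr0 'X) rvkXn // subn0.
have copX : coprimep f ('X^m).
  by apply: coprimep_expr; rewrite coprimepX /root horner_coef0 Phis_coef0.
case/Bezout_eq1_coprimepP: copX => [[x y] /= exy].
case: eX => a [b hab]; exists (x + y * a), (y * b).
by rewrite -exy hab mulrDr mulrDl !mulrA addrA.
Qed.

End Phis.

End Reciprocal.

(** * Squares in finite local rings of odd order *)

Section OddField.
Variable F : finFieldType.
Hypothesis oddF : odd #|F|.

Lemma odd_pchar : exists2 p, prime p & (p \in [pchar F]) && odd p.
Proof.
have [p pr_p chp] := finPcharP F; exists p; rewrite // chp /=.
case: (even_prime pr_p) => // p2; exfalso.
have /eqP two0 : (2%:R : F) == 0 by rewrite -p2 pcharf0.
have inv : involutive (fun x : F => x + 1) by move=> x /=; rewrite -addrA -mulr2n two0 addr0.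
have := oddF; rewrite -cardsT.
have : forall n (A : {set F}), (#|A| <= n)%N -> (forall x, (x + 1 \in A) = (x \in A)) -> ~~ odd #|A|.
  elim=> [|n IHn] A; first by rewrite leqn0 => /eqP ->.
  move=> hA stA; case: (set_0Vmem A) => [->|[x xA]]; first by rewrite cards0.
  have x1A : x + 1 \in A :\ x.
    by rewrite !inE stA xA andbT -subr_eq0 addrAC subrr add0r oner_neq0.
  rewrite (cardsD1 x) xA (cardsD1 (x + 1)) x1A /= negbK; apply: IHn.
    by move: hA; rewrite (cardsD1 x) xA (cardsD1 (x + 1)) x1A /= !add1n => /ltnW.
  move=> y; rewrite !inE stA (inj_eq (addIr _)).
  have -> : (y + 1 == x) = (y == x + 1) by rewrite -(inj_eq (addIr 1)) (inv y).
  by rewrite !andbA [(y != x + 1) && _]andbC.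
by move/(_ _ [set: F] (leqnn _)) => /(_ _)/negbTE -> // x; rewrite !inE.
Qed.

Lemma two_neq0 : (2%:R : F) != 0.
Proof.
have [p pr_p /andP [chp op]] := odd_pchar.
by rewrite -(dvdn_pcharf chp) dvdn_prime2 //; apply: contraTneq op => ->.
Qed.

Lemma scale2_eq0 m n (X : 'M[F]_(m, n)) : X + X = 0 -> X = 0.
Proof.
move=> e; apply: (scalerI two_neq0); rewrite scaler0.
by rewrite -[RHS]e scaler_nat mulr2n.
Qed.

(** A unipotent matrix has order a power of the odd characteristic, so one of
   its powers is a square root of it. *)
Lemma unipotent_sqrt N (S : 'M[F]_N) k : (S - 1%:M) ^+ k = 0 ->
  exists j, S ^+ j *m S ^+ j = S.
Proof.
move=> Sk; have [p pr_p /andP [chp op]] := odd_pchar.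
have kp : (k <= p ^ k)%N by apply/ltnW/ltn_expl; apply: prime_gt1.
have e0 : pm S (('X - 1) ^+ (p ^ k)%N) = 0.
  rewrite pm_exp pmB pmX pm1 -(subnKC kp) exprD Sk mul0r //.
have chP : p \in [pchar {poly F}] by rewrite pchar_poly.
have e1 : ('X - 1 : {poly F}) ^+ (p ^ k)%N = 'X^(p ^ k)%N - 1.
  elim: (k) => [|i IHi]; first by rewrite expn0 !expr1.
  rewrite expnSr !exprM IHi -!(pFrobenius_autE chP) pFrobenius_autB_comm ?pFrobenius_aut1 //.
  exact: mulrC.
move: e0; rewrite e1 pmB pmXn pm1 => /eqP; rewrite subr_eq0 => /eqP e.
exists ((p ^ k).+1)./2; rewrite mulmxE -exprD addnn.
have -> : ((p ^ k).+1)./2.*2 = (p ^ k).+1 by rewrite -[RHS]odd_double_half /= oddX op orbT.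
by rewrite exprS e -mulmxE mulmx1.
Qed.

End OddField.

Section Local.
Variables (F : finFieldType) (N : nat) (B : {set 'M[F]_N}).
Hypothesis oddF : odd #|F|.
Hypothesis nz1 : 1%:M != 0 :> 'M[F]_N.
Hypothesis B1 : 1%:M \in B.
Hypothesis BB : forall x y, x \in B -> y \in B -> x - y \in B.
Hypothesis BM : forall x y, x \in B -> y \in B -> x *m y \in B.
Hypothesis BC : forall x y, x \in B -> y \in B -> x *m y = y *m x.
Hypothesis Bloc : forall x, x \in B ->
  (exists k, x ^+ k = 0) \/ (exists2 y, y \in B & x *m y = 1%:M).

Let B0 : 0 \in B. Proof. by rewrite -(subrr 1%:M) BB. Qed.
Let BN x : x \in B -> - x \in B. Proof. by move=> xB; rewrite -sub0r BB. Qed.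
Let BD x y : x \in B -> y \in B -> x + y \in B.
Proof. by move=> xB yB; rewrite -[y]opprK BB // BN. Qed.
Let BX x k : x \in B -> x ^+ k \in B.
Proof. by move=> xB; elim: k => [|k IHk]; rewrite ?expr0 // exprS -mulmxE BM. Qed.

Let G := [set x in B | x \in unitmx].
Let m := [set x in B | x \notin unitmx].
Let G2 := [set x *m x | x in G].

Let GB x : x \in G -> x \in B. Proof. by rewrite inE => /andP []. Qed.
Let mB x : x \in m -> x \in B. Proof. by rewrite inE => /andP []. Qed.
Let Bcase x : x \in B -> (x \in G) = (x \notin m).
Proof. by move=> xB; rewrite !inE xB /= negbK. Qed.

Let m_nil x : x \in m -> exists k, x ^+ k = 0.
Proof.
rewrite inE => /andP [xB nu]; case: (Bloc xB) => // -[y _ e].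
by have [xu _] := mulmx1_unit e; rewrite xu in nu.
Qed.

Let G_inv x : x \in G -> invmx x \in G.
Proof.
rewrite !inE unitmx_inv => /andP [xB xu]; rewrite xu andbT.
case: (Bloc xB) => [[k xk]|[y yB e]].
  case/eqP: nz1; apply: (inverse_mulmx_eq0 (mulVmx (pm_inj_exp k xu))).
  by rewrite xk mul0mx.
by rewrite -[invmx x]mulmx1 -e mulKmx.
Qed.

Let GM x y : x \in G -> y \in G -> x *m y \in G.
Proof.
rewrite !inE unitmx_mul => /andP [xB xu] /andP [yB yu].
by rewrite BM // xu.
Qed.

Let unit_nil x y : x \in G -> y \in m -> x + y \in G.
Proof.
move=> xG ym; have [k yk] := m_nil ym; have xB := GB xG; have yB := mB ym.
move: xG; rewrite !inE BD //= => /andP [_ xu]; apply: unit_inj => v.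
rewrite mulmxDl => /eqP; rewrite addr_eq0 => /eqP e.
apply: (inverse_mulmx_eq0 (mulVmx (pm_inj_exp k xu))).
suff -> : x ^+ k *m v = (- y) ^+ k *m v by rewrite exprNn yk mulr0 mul0mx.
elim: (k) => [|j IHj]; first by rewrite !expr0.
rewrite exprSr -mulmxE -mulmxA e -mulNmx mulmxA exprS -mulmxE -[RHS]mulmxA -IHj mulmxA.
by congr (_ *m v); rewrite mulmxN mulNmx (BC yB) // BX.
Qed.

Let m_add x y : x \in m -> y \in m -> x + y \in m.
Proof.
move=> xm ym; have xB := mB xm; have yB := mB ym.
have xyB := BD xB yB; apply: contraT => nm; move: (nm); rewrite -Bcase // => uG.
have ymN : - y \in m.
  move: ym; rewrite !inE BN // => /andP [_]; apply: contra => u.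
  by rewrite -[y]opprK -scaleN1r unitmxZ // unitrN unitr1.
by have := unit_nil uG ymN; rewrite addrK Bcase // xm.
Qed.

Let zero_m : 0 \in m.
Proof.
rewrite inE B0 /=; apply/negP => u; case/eqP: nz1.
by rewrite -(mulmxV u) mul0mx.
Qed.

Let m_mul x y : x \in B -> y \in m -> x *m y \in m.
Proof.
move=> xB ym; have yB := mB ym; rewrite !inE BM //=; move: ym; rewrite inE => /andP [_].
by apply: contra; rewrite unitmx_mul => /andP [].
Qed.

Let sqM x y : x \in B -> y \in B -> x *m y *m (x *m y) = x *m x *m (y *m y).
Proof. by move=> xB yB; rewrite -!mulmxA (mulmxA y) (BC yB xB) -!mulmxA. Qed.

Let cardG : (#|G| <= 2 * #|G2|)%N.
Proof.
rewrite -sum1_card (partition_big_imset (fun x => x *m x)) /= -/G2.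
rewrite mulnC -sum_nat_const; apply: leq_sum => s /imsetP [x xG ->].
rewrite sum1dep_card.
apply: leq_trans (_ : #|[set x; - x]| <= 2)%N; last by rewrite cards2; case: (_ == _).
apply: subset_leq_card; apply/subsetP => y; rewrite !inE => /andP [/andP [yB yu] /eqP e].
have xB := GB xG.
have e2 : (y - x) *m (y + x) = 0.
  by rewrite mulmxBl !mulmxDr e (BC xB yB) [X in _ - X]addrC subrr.
case: (boolP (y - x \in m)) => h1; last first.
  rewrite -Bcase ?BB // inE in h1; case/andP: h1 => _ u.
  have := inverse_mulmx_eq0 (mulVmx u) e2.
  by move=> /eqP; rewrite addr_eq0 => ->; rewrite orbT.
case: (boolP (y + x \in m)) => h2; last first.
  rewrite -Bcase ?BD // inE in h2; case/andP: h2 => _ u.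
  have : (y + x) *m (y - x) = 0 by rewrite BC ?BB ?BD.
  by move=> /(inverse_mulmx_eq0 (mulVmx u)) /eqP; rewrite subr_eq0 => ->.
have := m_add h1 h2; rewrite addrACA [- x + x]addrC subrr addr0 => h3.
have u2 : y + y \in G.
  rewrite inE BD // -mulr2n -scaler_nat unitmxZ // unitfE; exact: two_neq0.
by rewrite Bcase ?BD // h3 in u2.
Qed.

Lemma local_nonsquare_ratio u n : u \in B -> u \in unitmx -> n \in B -> n \in unitmx ->
  ~ (exists2 b, b \in B & u = b *m b) -> ~ (exists2 b, b \in B & n = b *m b) ->
  exists2 b, b \in B & u = n *m (b *m b).
Proof.
move=> uB uu nB nu nsu nsn.
have uG : u \in G by rewrite inE uB.
have nG : n \in G by rewrite inE nB.
pose nG2 := [set n *m x | x in G2].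
have G2G x : x \in G2 -> x \in G by case/imsetP => y yG ->; apply: GM.
case: (boolP (u \in nG2)) => [/imsetP [x /imsetP [b bG ->] ->]|h].
  by exists b => //; apply: GB.
have c1 : #|nG2| = #|G2| by apply: card_imset => x y; apply: (can_inj (mulKmx nu)).
have d1 : [disjoint G2 & nG2].
  rewrite -setI_eq0; apply/eqP/setP => x; rewrite !inE; apply/negbTE/negP.
  case/andP => /imsetP [y yG ->] /imsetP [z /imsetP [w wG ->] e].
  apply: nsn; exists (y *m invmx w); first by rewrite BM ?GB ?G_inv.
  rewrite sqM ?GB ?G_inv // e -mulmxA.
  suff -> : w *m w *m (invmx w *m invmx w) = 1%:M by rewrite mulmx1.
  move: wG; rewrite inE => /andP [_ wu].
  by rewrite mulmxA -(mulmxA w) mulmxV // mulmx1 mulmxV.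
have d2 : u \notin G2 :|: nG2.
  rewrite inE negb_or h andbT; apply/negP => /imsetP [y yG e].
  by apply: nsu; exists y; rewrite ?GB.
have : (#|u |: (G2 :|: nG2)| <= #|G|)%N.
  apply: subset_leq_card; apply/subsetP => x; rewrite !inE.
  case/orP => [/eqP ->|/orP [|]]; first by rewrite uB.
    by move/G2G; rewrite inE.
  by case/imsetP => y /G2G yG ->; have := GM nG yG; rewrite inE.
rewrite cardsU1 d2 cardsU (disjoint_setI0 d1) cards0 subn0 c1 => hc.
by have := leq_trans hc cardG; rewrite mul2n -addnn add1n ltnn.
Qed.

Lemma local_sum_squares u : u \in B -> u \in unitmx ->
  exists2 a, a \in B & exists2 b, b \in B & u = a *m a + b *m b.
Proof.
move=> uB uu; have uG : u \in G by rewrite inE uB.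
case: (pselect (exists2 b, b \in B & u = b *m b)) => [[b bB ->]|nsu].
  by exists b => //; exists 0; rewrite // mul0mx addr0.
case: (pselect (exists a b, [/\ a \in G, b \in G, a *m a + b *m b \in G
    & a *m a + b *m b \notin G2])) => [[a [b [aG bG nG nn]]]|none].
  move: (nG); rewrite inE => /andP [nB nu].
  have [|c cB ->] := local_nonsquare_ratio uB uu nB nu nsu.
    case=> c cB ec; case/negP: nn; rewrite ec; apply/imsetP; exists c => //.
    rewrite inE cB; move: nu; rewrite ec unitmx_mul; by case/andP.
  have [aB bB] := (GB aG, GB bG).
  exists (a *m c); first exact: BM; exists (b *m c); first exact: BM.
  by rewrite !sqM // mulmxDl.
exfalso; pose T := G2 :|: m.
have TB x : x \in T -> x \in B.
  rewrite inE => /orP [/imsetP [y yG ->]|/mB //]; by rewrite BM ?GB.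
have sq_nil a y : a \in G -> y \in m -> a *m a + y \in G2.
  move=> aG ym; have iG := G_inv aG; have aB := GB aG.
  have ym' : invmx a *m invmx a *m y \in m by rewrite m_mul // BM ?GB.
  set n := _ *m y in ym'; have [k nk] := m_nil ym'.
  have [|j ej] := @unipotent_sqrt F oddF N (1%:M + n) k.
    by rewrite addrAC subrr add0r.
  have sG : 1%:M + n \in G by apply: unit_nil => //; rewrite inE B1 unitmx1.
  have sB := GB sG.
  apply/imsetP; exists (a *m (1%:M + n) ^+ j).
    rewrite inE BM ?BX // unitmx_mul; move: aG sG; rewrite !inE => /andP [_ ->] /andP [_ su].
    exact: pm_inj_exp.
  rewrite sqM ?BX // ej mulmxDr mulmx1 /n; congr (_ + _).
  move: aG; rewrite inE => /andP [_ au].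
  by rewrite !mulmxA -(mulmxA a) mulmxV // mulmx1 mulmxV // mul1mx.
have TD x y : x \in T -> y \in T -> x + y \in T.
  rewrite !(in_setU _ G2 m) => /orP [xs|xm] /orP [ys|ym].
  - case/imsetP: xs => a aG ->; case/imsetP: ys => b bG ->.
    have cB : a *m a + b *m b \in B by rewrite BD ?BM ?GB.
    case: (boolP (_ \in m)); rewrite ?orbT // -Bcase // => cG.
    rewrite orbF; apply: contraT => nn; case: none; exists a, b; split => //.
  - by case/imsetP: xs => a aG ->; rewrite sq_nil.
  - by case/imsetP: ys => a aG ->; rewrite addrC sq_nil.
  - by rewrite m_add ?orbT.
have T0 : 0 \in T by rewrite inE zero_m orbT.
have TMn x k : x \in T -> x *+ k \in T.
  by move=> xT; elim: k => [|k IHk]; rewrite ?mulr0n // mulrS TD.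
have TN x : x \in T -> - x \in T.
  move=> xT; have [p pr_p /andP [chp op]] := odd_pchar oddF.
  have -> : - x = x *+ p.-1; last exact: TMn.
  apply/eqP; rewrite eq_sym -subr_eq0 opprK addrC -mulrS prednK ?prime_gt0 //.
  by rewrite -scaler_nat pcharf0 ?scale0r.
pose uT := [set u + t | t in T].
have cT : #|uT| = #|T| by apply: card_imset => x y /addrI.
have d : [disjoint T & uT].
  rewrite -setI_eq0; apply/eqP/setP => x; rewrite in_setI in_set0; apply/negbTE/negP.
  case/andP => xT /imsetP [y yT ex].
  have : u \in T by rewrite -(addrK y u) -ex TD ?TN.
  rewrite inE => /orP [/imsetP [z zG ez]|um].
    by apply: nsu; exists z; rewrite ?GB.
  by rewrite Bcase // um in uG.
have sub : T :|: uT \subset B.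
  apply/subsetP => x; rewrite inE => /orP [/TB //|/imsetP [t tT ->]].
  exact: BD uB (TB _ tT).
have := subset_leq_card sub; rewrite cardsU (disjoint_setI0 d) cards0 subn0 cT.
have dm : [disjoint G2 & m].
  rewrite -setI_eq0; apply/eqP/setP => x; rewrite inE in_set0; apply/negbTE/negP.
  case/andP => /imsetP [y yG ->]; apply/negP; rewrite -Bcase ?BM ?GB //; exact: GM.
have -> : #|B| = (#|G| + #|m|)%N.
  rewrite -(cardsID [set x | x \in unitmx] B); congr (_ + _)%N; apply: eq_card => x.
    by rewrite !inE.
  by rewrite !inE andbC.
rewrite /T cardsU (disjoint_setI0 dm) cards0 subn0.
have m0 : (0 < #|m|)%N by apply/card_gt0P; exists 0.
move: cardG m0; move: #|G| #|m| #|G2| => a b c h1 h2 h3; clear -h1 h2 h3; lia.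
Qed.

End Local.

Section FieldSquares.
Variable F : finFieldType.
Hypothesis oddF : odd #|F|.

Definition issq (x : F) : bool := [exists y : F, (y != 0) && (x == y ^+ 2)].

Lemma issqP x : reflect (exists2 y, y != 0 & x = y ^+ 2) (issq x).
Proof.
apply: (iffP existsP) => [[y /andP [y0 /eqP ->]]|[y y0 ->]]; exists y => //.
by rewrite y0 eqxx.
Qed.

Let loc1 (x : 'M[F]_1) : x \in [set: 'M[F]_1] ->
  (exists k, x ^+ k = 0) \/ (exists2 y, y \in [set: 'M[F]_1] & x *m y = 1%:M).
Proof.
move=> _; have [x0|nx] := eqVneq (x 0 0) 0.
  by left; exists 1%N; rewrite expr1 [x]mx11_scalar x0 rmorph0.
right; exists (x 0 0)^-1%:M; first by rewrite inE.
by rewrite {1}[x]mx11_scalar -scalar_mxM divff.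
Qed.

Let nz11 : 1%:M != 0 :> 'M[F]_1.
Proof. by apply/eqP => /matrixP/(_ 0 0)/eqP; rewrite !mxE oner_eq0. Qed.

Let comm1 (x y : 'M[F]_1) : x *m y = y *m x.
Proof. by rewrite [x]mx11_scalar [y]mx11_scalar -!scalar_mxM mulrC. Qed.

Let unit1 (x : F) : x != 0 -> x%:M \in @unitmx F 1.
Proof. by move=> x0; rewrite unitmxE det_scalar1 unitfE. Qed.

Let sq1 (x : F) : x != 0 ->
  (exists2 b, b \in [set: 'M[F]_1] & x%:M = b *m b) -> issq x.
Proof.
move=> x0 [b _]; rewrite [b]mx11_scalar -scalar_mxM => /matrixP/(_ 0 0).
rewrite mxE eqxx mulr1n mxE eqxx mulr1n => e; apply/issqP; exists (b 0 0) => //.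
by apply: contraNneq x0 => b0; rewrite e b0 mul0r.
Qed.

Lemma nonsq_ratio u n : u != 0 -> n != 0 -> ~~ issq u -> ~~ issq n ->
  exists2 c, c != 0 & u = n * c ^+ 2.
Proof.
move=> u0 n0 nu nn.
have [||b _] := @local_nonsquare_ratio F 1 [set: 'M[F]_1] oddF nz11 (in_setT _)
  (fun _ _ _ _ => in_setT _) (fun _ _ _ _ => in_setT _) (fun x y _ _ => comm1 x y)
  loc1 u%:M n%:M (in_setT _) (unit1 u0) (in_setT _) (unit1 n0).
- by move=> /(sq1 u0); rewrite (negPf nu).
- by move=> /(sq1 n0); rewrite (negPf nn).
rewrite [b]mx11_scalar -!scalar_mxM => /matrixP/(_ 0 0).
rewrite mxE eqxx mulr1n mxE eqxx mulr1n => e; exists (b 0 0) => //.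
by apply: contraNneq u0 => b0; rewrite e b0 mul0r mulr0.
Qed.

Lemma sum_two_squares u : u != 0 -> exists a b : F, u = a ^+ 2 + b ^+ 2.
Proof.
move=> u0.
have [a _ [b _]] := @local_sum_squares F 1 [set: 'M[F]_1] oddF nz11 (in_setT _)
  (fun _ _ _ _ => in_setT _) (fun _ _ _ _ => in_setT _) (fun x y _ _ => comm1 x y)
  loc1 u%:M (in_setT _) (unit1 u0).
rewrite {1 2}[a]mx11_scalar {1 2}[b]mx11_scalar -!scalar_mxM => /matrixP/(_ 0 0).
rewrite mxE eqxx mulr1n !mxE eqxx !mulr1n => e; by exists (a 0 0), (b 0 0).
Qed.

Lemma issqM x y : x != 0 -> y != 0 -> issq (x * y) = (issq x == issq y).
Proof.
move=> x0 y0.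
have sqV z : issq z -> issq z^-1.
  by case/issqP => a a0 ->; apply/issqP; exists a^-1; rewrite ?invr_eq0 // exprVn.
have sqM a b : issq a -> issq b -> issq (a * b).
  case/issqP => c c0 -> /issqP [d d0 ->]; apply/issqP; exists (c * d).
    by rewrite mulf_neq0.
  by rewrite exprMn.
case: (boolP (issq x)) => sx; case: (boolP (issq y)) => sy /=.
- exact: sqM.
- apply/negbTE; apply: contra sy => sxy; have := sqM _ _ (sqV _ sx) sxy.
  by rewrite mulKf.
- apply/negbTE; apply: contra sx => sxy; have := sqM _ _ sxy (sqV _ sy).
  by rewrite mulfK.
- have [c c0 ->] := nonsq_ratio x0 y0 sx sy; apply/issqP; exists (y * c).
    by rewrite mulf_neq0.
  by rewrite exprMn mulrAC.
Qed.

Lemma issq_ratio x y : x != 0 -> y != 0 -> issq x = issq y ->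
  exists2 c, c != 0 & y = x * c ^+ 2.
Proof.
move=> x0 y0; case: (boolP (issq x)) => sx.
  move/esym/issqP => [b b0 ->]; case/issqP: sx => a a0 ->.
  by exists (b / a); rewrite ?mulf_neq0 ?invr_eq0 // -exprMn mulrC divfK.
by move=> /esym/negbT sy; apply: nonsq_ratio.
Qed.

Lemma exists_nonsq : exists2 d : F, d != 0 & ~~ issq d.
Proof.
pose U := [set x : F | x != 0].
case: (pselect (exists2 d : F, d != 0 & ~~ issq d)) => // none; exfalso.
have sub : U \subset [set x ^+ 2 | x in U :\ -1].
  apply/subsetP => x; rewrite inE => x0.
  have : issq x by apply: contraT => nx; case: none; exists x.
  case/issqP => y y0 ->.
  have [->|ny] := eqVneq y (-1).
    apply/imsetP; exists 1; rewrite ?sqrrN // !inE oner_neq0 andbT.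
    by rewrite eq_sym -subr_eq0 opprK -mulr2n oppr_eq0 || rewrite -addr_eq0 -mulr2n two_neq0.
  by apply/imsetP; exists y; rewrite // !inE ny.
have := leq_trans (subset_leq_card sub) (leq_imset_card _ _).
by rewrite (cardsD1 (-1) U) !inE oppr_eq0 oner_neq0 add1n ltnn.
Qed.

Lemma square_signE (x : F) : square_sign x = if issq x then 1 else -1. Proof. by []. Qed.

Lemma square_signM (x y : F) : x != 0 -> y != 0 ->
  square_sign (x * y) = square_sign x * square_sign y.
Proof.
by move=> x0 y0; rewrite !square_signE issqM //; do 2![case: issq].
Qed.

End FieldSquares.

Section PlusMinusOne.
Variable F : finFieldType.
Hypothesis oddF : odd #|F|.
Implicit Types (f g p q : {poly F}) (e : F).

Lemma sqr1_cases e : e ^+ 2 = 1 -> e = 1 \/ e = -1.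
Proof. by move/eqP; rewrite sqrf_eq1 => /orP [] /eqP ->; [left|right]. Qed.

Lemma sqr1_neq0 e : e ^+ 2 = 1 -> e != 0.
Proof. by move=> e2; apply: contra_eq_neq e2 => ->; rewrite expr0n eq_sym oner_neq0. Qed.

Lemma sqr1_inv e : e ^+ 2 = 1 -> e^-1 = e.
Proof.
by move=> e2; apply: (mulfI (sqr1_neq0 e2)); rewrite divff ?sqr1_neq0.
Qed.

Lemma Phi_XsubC e : e != 0 -> in_Phi ('X - e%:P).
Proof.
move=> e0; split; [exact: monicXsubC | exact: irredp_XsubC |].
by rewrite -subr_eq0 opprB addrCA subrr addr0 polyC_eq0 || rewrite addrC -subr_eq0 addrK oppr_eq0 polyC_eq0.
Qed.

Lemma dual_XsubC e : e ^+ 2 = 1 -> dual_poly ('X - e%:P) = 'X - e%:P.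
Proof.
move=> e2; have e0 := sqr1_neq0 e2.
rewrite dual_polyE /rv size_XsubC /= /rvk !big_ord_recl big_ord0 /= addr0.
rewrite /bump /= subn0 subnn expr1 expr0 !coefB !coefX !coefC /= sub0r subr0 scale1r.
rewrite scalerDr scalerA mulVf ?oppr_eq0 // scale1r invrN sqr1_inv // scaleNr.
by rewrite -mul_polyC mulr1.
Qed.

Lemma self_dual_XsubC e : e ^+ 2 = 1 -> self_dual_of ('X - e%:P) = 'X - e%:P.
Proof. by move=> e2; rewrite /self_dual_of dual_XsubC // eqxx. Qed.

Lemma Phis_XsubC e : e ^+ 2 = 1 -> in_Phis ('X - e%:P).
Proof.
move=> e2; exists ('X - e%:P); last by rewrite self_dual_XsubC.
exact/Phi_XsubC/sqr1_neq0.
Qed.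

Lemma Phis_coprime_sqr1 f : in_Phis f ->
  (forall e, e ^+ 2 = 1 -> f != 'X - e%:P) -> coprimep f ('X^2 - 1).
Proof.
move=> Pf nf.
have -> : 'X^2 - 1 = ('X - 1%:P) * ('X - (-1)%:P) :> {poly F}.
  by rewrite rmorphN opprK rmorph1 -subr_sqr expr1n.
have aux g e : e ^+ 2 = 1 -> in_Phi g -> self_dual_of g = f -> coprimep g ('X - e%:P).
  move=> e2 Pg eg; apply: Phi_coprime_neq => //; first exact/Phi_XsubC/sqr1_neq0.
  by apply: contraNneq (nf e e2) => eg2; rewrite -eg eg2 self_dual_XsubC.
have aux2 g : in_Phi g -> self_dual_of g = f ->
    coprimep g (('X - 1%:P) * ('X - (-1)%:P)).
  by move=> Pg eg; rewrite coprimepMr !aux ?sqrrN ?expr1n.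
have [g Pg ef] := Pf; rewrite ef /self_dual_of; case: ifP => _.
  exact: aux2.
by rewrite coprimepMl !aux2 // ?self_dual_dual //; apply: dual_Phi.
Qed.

End PlusMinusOne.

(** * Norms in the algebra of a cyclic module *)

Section Star.
Variables (F : finFieldType) (A : smod F).
Hypothesis gA : good A.
Local Notation U := (act A).
Local Notation J := (frm A).
Implicit Types p q : {poly F}.

Let uU : U \in unitmx := good_act_unit gA.

Lemma star_pm p : (pm U p)^T *m J = J *m pm (invmx U) p.
Proof.
rewrite pm_tr; symmetry; apply: pm_intertwine.
by rewrite good_adj.
Qed.

Lemma frm_pm p (x y : 'cV_(dm A)) :
  (pm U p *m x)^T *m J *m y = x^T *m J *m (pm (invmx U) p *m y).
Proof. by rewrite trmx_mul -(mulmxA x^T (pm U p)^T) star_pm !mulmxA. Qed.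

Lemma inv_pm2 : exists k, (forall p, pm (invmx U) p = pm U (p \Po 'X^k)) /\
  (forall p, pm U p = pm (invmx U) (p \Po 'X^k)).
Proof.
have [k ek] := unitmx_finite_order uU.
have eV : invmx U = U ^+ k.
  by apply: (can_inj (mulKmx uU)); rewrite mulmxV // -[RHS]/(U * _) -exprS.
exists k; split=> p; rewrite pm_comp pmXn -?eV //; congr pm.
have ekV : U ^+ k *m invmx U ^+ k = 1%:M.
  rewrite mulmxE -exprMn_comm ?mulrV // -?mulmxE ?mulmxV //.
    by elim: (k) => [|j IHj]; rewrite ?expr0 // exprS IHj mulr1.
  by rewrite /GRing.comm -!mulmxE mulmxV ?mulVmx.
apply: (can_inj (mulKmx (_ : invmx U \in unitmx))); first by rewrite unitmx_inv.
by rewrite mulVmx // {1}eV ekV.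
Qed.

Lemma inv_pm : exists k, forall p, pm (invmx U) p = pm U (p \Po 'X^k).
Proof. by have [k [ek _]] := inv_pm2; exists k. Qed.

Lemma frm_sym (x y : 'cV_(dm A)) : (x^T *m J *m y) 0 0 = - (y^T *m J *m x) 0 0.
Proof.
have [_ gJ _] := gA.
rewrite -[LHS]/((x^T *m J *m y) 0 0) -[x^T *m J *m y]trmxK mxE.
by rewrite !trmx_mul trmxK gJ mulNmx mulmxN mxE mulmxA.
Qed.

End Star.

Section Norm.
Variables (F : finFieldType) (A : smod F) (f : {poly F}) (r : nat).
Hypotheses (oddF : odd #|F|) (gA : good A) (Pf : in_Phis f).
Hypothesis nf : forall e, e ^+ 2 = 1 -> f != 'X - e%:P.
Local Notation U := (act A).
Local Notation J := (frm A).
Hypothesis Ufr : pm U (f ^+ r) = 0.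

Let uU : U \in unitmx := good_act_unit gA.
Let uJ : J \in unitmx. Proof. by case: gA. Qed.

Let B : {set 'M[F]_(dm A)} := [set x | `[< exists p, x = pm U p >] && (x^T *m J == J *m x)].

Let BP x : reflect ((exists p, x = pm U p) /\ x^T *m J = J *m x) (x \in B).
Proof.
by rewrite inE; apply: (iffP andP) => [[/asboolP h /eqP]|[h ->]] //; split => //; apply/asboolP.
Qed.

Let B1 : 1%:M \in B.
Proof. by apply/BP; split; [exists 1; rewrite pm1 | rewrite trmx1 mul1mx mulmx1]. Qed.

Let BB x y : x \in B -> y \in B -> x - y \in B.
Proof.
move=> /BP [[p ->] ep] /BP [[q ->] eq]; apply/BP; split.
  by exists (p - q); rewrite pmB.
by rewrite linearB /= mulmxBl mulmxBr ep eq.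
Qed.

Let BC x y : x \in B -> y \in B -> x *m y = y *m x.
Proof. by move=> /BP [[p ->] _] /BP [[q ->] _]; rewrite pmCC. Qed.

Let BM x y : x \in B -> y \in B -> x *m y \in B.
Proof.
move=> xB yB; have cxy := BC xB yB; move: cxy.
move: xB yB => /BP [[p ->] ep] /BP [[q ->] eq] cxy; apply/BP; split.
  by exists (p * q); rewrite pmM.
by rewrite {1}cxy trmx_mul -mulmxA eq mulmxA ep mulmxA.
Qed.

Let Bloc x : x \in B ->
  (exists k, x ^+ k = 0) \/ (exists2 y, y \in B & x *m y = 1%:M).
Proof.
move=> xB; case/BP: (xB) => [[p ep] sx].
case: (boolP (f %| p)) => [/dvdpP [q eq]|nfp].
  by left; exists r; rewrite ep -pm_exp eq exprMn pmM Ufr mulmx0.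
right; pose I q := exists b, pm U q = x *m pm U b.
have [k ek] := inv_pm gA.
have [||||||b] := @Phis_prime F f Pf I r p; rewrite ?pm1.
- move=> a b [c ec] [d ed]; exists (c + d); by rewrite !pmD ec ed mulmxDr.
- move=> a b [c ec]; exists (a * c); rewrite !pmM ec !mulmxA; congr (_ *m _).
  by rewrite ep pmCC.
- move=> a [c ec]; exists ('X^((size a).-1) * (c \Po 'X^k)).
  rewrite pm_inv_rv // pmM pmXn mulmxA.
  have -> : x *m U ^+ (size a).-1 = U ^+ (size a).-1 *m x.
    by rewrite ep -pmXn pmCC.
  rewrite -mulmxA; congr (_ *m _); apply: (can_inj (mulKmx uJ)).
  by rewrite -star_pm // ec trmx_mul -mulmxA sx mulmxA star_pm // ek -mulmxA ep pmCC.
- by exists 0; rewrite Ufr pm0 mulmx0.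
- by exists 1; rewrite pm1 mulmx1.
- by [].
move=> /esym e; exists (pm U b) => //; apply/BP; split; first by exists b.
have xT : (pm U b)^T *m x^T = 1%:M by rewrite -trmx_mul e trmx1.
by rewrite -[LHS]mulmx1 -e -!mulmxA (mulmxA J) -sx !mulmxA xT mul1mx.
Qed.

Let theta := U - invmx U.

Let theta_star : theta^T *m J = - (J *m theta).
Proof.
rewrite /theta linearB /= mulmxBl good_adj //.
have -> : (invmx U)^T *m J = J *m U.
  have [g1 _ _] := gA; transitivity ((invmx U)^T *m (U^T *m J *m U)); first by rewrite g1.
  by rewrite !mulmxA -trmx_mul mulmxV // trmx1 mul1mx.
by rewrite mulmxBr opprB.
Qed.

Let theta_pm : exists t, theta = pm U t.
Proof.
by have [k ek] := inv_pm gA; exists ('X - ('X \Po 'X^k)); rewrite pmB -ek !pmX.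
Qed.

Let theta_unit : theta \in unitmx.
Proof.
have : pm U ('X^2 - 1) \in unitmx.
  have : coprimep (f ^+ r) ('X^2 - 1).
    by apply/coprimep_expl/Phis_coprime_sqr1.
  case/Bezout_eq1_coprimepP => [[u v] /= /(congr1 (pm U))].
  by rewrite pmD !pmM Ufr mulmx0 add0r pm1 => /mulmx1_unit [].
have -> : pm U ('X^2 - 1) = U *m theta.
  by rewrite pmB pm1 -['X^2]/('X * 'X) pmM pmX mulmxBr mulmxV.
by rewrite unitmx_mul => /andP [].
Qed.

Let theta_comm x : x \in B -> theta *m x = x *m theta.
Proof. by case/BP => [[p ->] _]; have [t ->] := theta_pm; rewrite pmCC. Qed.

Lemma cyclic_norm s (S := pm U s) : S^T *m J = J *m S -> S \in unitmx ->
  exists T, [/\ T \in unitmx, T *m U = U *m T & J *m S = T^T *m J *m T].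
Proof.
move=> sS uS.
have [n1|nz1] := eqVneq (1%:M : 'M[F]_(dm A)) 0.
  have z m (X : 'M[F]_(dm A, m)) : X = 0 by rewrite -[X]mul1mx n1 mul0mx.
  by exists 1%:M; rewrite unitmx1; split=> //; rewrite [LHS]z [RHS]z.
have SB : S \in B by apply/BP; split => //; exists s.
pose K := - (theta *m theta).
have KB : K \in B.
  apply/BP; split; first by have [t et] := theta_pm; exists (- (t * t)); rewrite pmN pmM -et.
  rewrite /K linearN /= trmx_mul mulNmx -mulmxA theta_star mulmxN mulmxA theta_star.
  by rewrite mulNmx opprK mulmxN mulmxA.
have uK : K \in unitmx by rewrite /K -scaleN1r unitmxZ ?unitrN ?unitr1 // unitmx_mul theta_unit.
suff [a [b [aB bB eS]]] : exists a b, [/\ a \in B, b \in B & S = a *m a + K *m (b *m b)].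
  pose T := a + theta *m b.
  have [pT ePT] : exists p, T = pm U p.
    case/BP: aB => [[p ep] _]; case/BP: bB => [[q eq] _]; have [t et] := theta_pm.
    by exists (p + t * q); rewrite /T pmD pmM ep et eq.
  have eT : J *m S = T^T *m J *m T.
    have [_ sa] := BP _ aB; have [_ sb] := BP _ bB.
    have eT : T^T *m J = J *m (a - theta *m b).
      have -> : T^T = a^T + b^T *m theta^T by rewrite -trmx_mul -linearD.
      rewrite mulmxDl -mulmxA theta_star mulmxN (mulmxA b^T) sb sa.
      by rewrite (theta_comm bB) [RHS]mulmxBr mulmxA.
    rewrite eT -mulmxA; congr (_ *m _).
    rewrite eS mulmxBl !mulmxDr opprD /K mulNmx.
    have -> : theta *m b *m (theta *m b) = theta *m theta *m (b *m b).
      by rewrite -!mulmxA (mulmxA b) -(theta_comm bB) !mulmxA.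
    have -> : theta *m b *m a = a *m (theta *m b).
      by rewrite -mulmxA (BC bB aB) !mulmxA (theta_comm aB).
    by rewrite addrA addrK.
  exists T; split => //; last by rewrite ePT pmCU.
  apply: unit_inj => x Tx; apply: (inverse_mulmx_eq0 (mulVmx uS)).
  apply: (inverse_mulmx_eq0 (mulVmx uJ)); by rewrite mulmxA eT -(mulmxA _ T x) Tx mulmx0.
have B0 : 0 \in B by rewrite -(subrr 1%:M) BB.
case: (pselect (exists2 c, c \in B & K = c *m c)) => [[c cB ec]|nK].
  have [a aB [b bB e]] := local_sum_squares oddF nz1 B1 BB BM BC Bloc SB uS.
  have uc : c \in unitmx by move: uK; rewrite ec unitmx_mul => /andP [].
  have [d dB ed] : exists2 d, d \in B & c *m d = 1%:M.
    case: (Bloc cB) => // -[k ek]; case/eqP: nz1.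
    by apply: (inverse_mulmx_eq0 (mulVmx (pm_inj_exp k uc))); rewrite ek mul0mx.
  exists a, (d *m b); rewrite aB BM //; split => //; rewrite e ec; congr (_ + _).
  rewrite -!mulmxA (mulmxA b d b) (BC bB dB) -!mulmxA (mulmxA c d) ed mul1mx.
  by rewrite (mulmxA c d) ed mul1mx.
case: (pselect (exists2 c, c \in B & S = c *m c)) => [[c cB ec]|nS].
  by exists c, 0; rewrite mulmx0 mulmx0 addr0.
have [b bB e] := local_nonsquare_ratio oddF nz1 B1 BB BM BC Bloc SB uS KB uK nS nK.
by exists 0, b; rewrite mulmx0 add0r.
Qed.

End Norm.

(** * Cyclic modules *)

Section Krylov.
Variables (F : fieldType).
Implicit Types (p q f : {poly F}).

Definition cp d (c : 'cV[F]_d) : {poly F} := rVpoly c^T.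
Definition cv d p : 'cV[F]_d := (poly_rV p)^T.

Lemma size_cp d (c : 'cV_d) : (size (cp c) <= d)%N.
Proof. exact: size_poly. Qed.

Lemma cpK d (c : 'cV_d) : cv d (cp c) = c.
Proof. by rewrite /cv /cp rVpolyK trmxK. Qed.

Lemma cvK d p : (size p <= d)%N -> cp (cv d p) = p.
Proof. by move=> h; rewrite /cv /cp trmxK poly_rV_K. Qed.

Lemma cvD d p q : cv d (p + q) = cv d p + cv d q.
Proof. by rewrite /cv linearD /= linearD. Qed.

Lemma cvZ d a p : cv d (a *: p) = a *: cv d p.
Proof. by rewrite /cv linearZ /= linearZ. Qed.

Variable N : nat.
Implicit Types (U : 'M[F]_N) (v : 'cV[F]_N).

Definition kry U v d : 'M[F]_(N, d) := \matrix_(i, j) (U ^+ j *m v) i 0.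
Definition gen U v := forall x, exists p, x = pm U p *m v.

Lemma kryE U v d (c : 'cV_d) : kry U v d *m c = pm U (cp c) *m v.
Proof.
rewrite (pmE U (size_cp c)) mulmx_suml; apply/matrixP => i j.
rewrite [LHS]mxE summxE; apply: eq_bigr => k _; rewrite ord1.
rewrite -scalemxAl [RHS]mxE /cp coef_rVpoly_ord.
by rewrite [X in X * _ = _]mxE [X in _ = X * _]mxE mulrC.
Qed.

Lemma kry_cv U v d p : (size p <= d)%N -> kry U v d *m cv d p = pm U p *m v.
Proof. by move=> h; rewrite kryE cvK. Qed.

Lemma pm_mod U v f p : pm U f *m v = 0 -> pm U (p %% f) *m v = pm U p *m v.
Proof.
move=> h; rewrite {2}(divp_eq p f) pmD pmM mulmxDl -mulmxA h mulmx0 add0r //.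
Qed.

Lemma ann0 U v f : ann U v f -> pm U f *m v = 0.
Proof. by move=> h; apply/h; rewrite dvdpp. Qed.

Definition cmp f : 'M[F]_((size f).-1) := \matrix_(i, j) ('X^(j.+1) %% f)`_i.

Lemma size_modp f p : f != 0 -> (size (p %% f)%R <= (size f).-1)%N.
Proof. by move=> f0; rewrite -ltnS prednK ?size_poly_gt0 // ltn_modp. Qed.

Lemma col_cmp f (j : 'I_(size f).-1) : col j (cmp f) = cv _ ('X^(j.+1) %% f).
Proof. by apply/matrixP => i k; rewrite !mxE. Qed.

Lemma kry_cmp U v f : f != 0 -> pm U f *m v = 0 ->
  U *m kry U v (size f).-1 = kry U v (size f).-1 *m cmp f.
Proof.
move=> f0 h; apply: trmx_inj; apply/row_matrixP => j; rewrite -!tr_col; congr trmx.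
rewrite !colE -!mulmxA -!colE col_cmp kry_cv ?size_modp // pm_mod // pmXn exprS -mulmxE -mulmxA.
by congr (_ *m _); apply/matrixP => i k; rewrite !mxE ord1.
Qed.

Lemma kry_inj U v f (c : 'cV_(size f).-1) : f != 0 -> ann U v f -> kry U v (size f).-1 *m c = 0 -> c = 0.
Proof.
move=> f0 hv; rewrite kryE => /hv /dvdp_leq h; rewrite -[c]cpK.
suff -> : cp c = 0 by rewrite /cv linear0 trmx0.
have sc : (size (cp c) < size f)%N.
  by apply: leq_ltn_trans (size_cp c) _; rewrite ltn_predL size_poly_gt0.
by apply/eqP; apply: contraT => /h; rewrite leqNgt sc.
Qed.

Lemma kry_surj U v f p : f != 0 -> pm U f *m v = 0 ->
  pm U p *m v = kry U v (size f).-1 *m cv _ (p %% f).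
Proof. by move=> f0 h; rewrite kry_cv ?size_modp // pm_mod. Qed.

Lemma kry_inverse U v f : f != 0 -> ann U v f -> gen U v ->
  exists Ki, Ki *m kry U v (size f).-1 = 1%:M /\ kry U v (size f).-1 *m Ki = 1%:M.
Proof.
move=> f0 hv gv; apply: two_sided_inverse => x; first exact: kry_inj.
by have [p ->] := gv x; exists (cv _ (p %% f)); apply: kry_surj => //; apply: ann0.
Qed.

End Krylov.

Lemma cmp_mul (F : fieldType) (f q : {poly F}) : f != 0 -> (size q <= (size f).-1)%N ->
  cmp f *m cv _ q = cv _ (('X * q) %% f).
Proof.
move=> f0 hq; apply/matrixP => i j; rewrite mxE ord1 {j}.
transitivity ((\sum_(k < (size f).-1) q`_k *: ('X^(k.+1) %% f))`_i).
  rewrite coef_sum; apply: eq_bigr => k _; rewrite !mxE mulrC coefZ //.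
rewrite !mxE; congr (nth _ _ _); congr polyseq.
have -> : 'X * q = \sum_(k < (size f).-1) q`_k *: 'X^(k.+1).
  rewrite {1}(_ : q = \sum_(k < (size f).-1) q`_k *: 'X^k).
    by rewrite mulr_sumr; apply: eq_bigr => k _; rewrite -scalerAr exprS.
  rewrite -poly_def; apply/polyP => k; rewrite coef_poly.
  by case: ltnP => // h; apply: nth_default; apply: leq_trans hq h.
elim/big_rec2: _ => [|k x y _ ->]; first by rewrite mod0p.
by rewrite modpD modpZl.
Qed.

Lemma cmp_pm (F : fieldType) (f p : {poly F}) : (1 < size f)%N ->
  pm (cmp f) p *m cv _ 1 = cv _ (p %% f).
Proof.
move=> sf; have f0 : f != 0 by rewrite -size_poly_gt0 ltnW.
elim/poly_ind: p => [|p c IHp].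
  by rewrite pm0 mul0mx mod0p /cv linear0 trmx0.
rewrite pmD pmM pmX pmC mulmxDl -pmCU -mulmxA IHp cmp_mul ?size_modp //.
rewrite modp_mul mul_scalar_mx -cvZ -cvD; congr cv.
rewrite modpD mulrC; congr (_ + _); rewrite modp_small; first by rewrite -mul_polyC mulr1.
by apply: leq_ltn_trans sf; rewrite size_polyC leq_b1.
Qed.

Lemma cmp_ann (F : fieldType) (f : {poly F}) : (1 < size f)%N ->
  ann (cmp f) (cv _ 1) f /\ gen (cmp f) (cv _ 1).
Proof.
move=> sf; have f0 : f != 0 by rewrite -size_poly_gt0 ltnW.
split=> [p|x].
  rewrite cmp_pm // /dvdp; split=> [e|/eqP ->].
    by rewrite -[p %% f](@cvK _ (size f).-1) ?size_modp // e /cp trmx0 linear0.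
  by rewrite /cv linear0 trmx0.
exists (cp x); rewrite cmp_pm // modp_small ?cpK //.
by apply: leq_ltn_trans (size_cp x) _; rewrite ltn_predL ltnW.
Qed.

Section Eigen.
Variables (F : fieldType) (N : nat) (U : 'M[F]_N).

Lemma pm_eigen (V : 'M[F]_N) c p (z : 'cV_N) : V *m z = c *: z -> pm V p *m z = p.[c] *: z.
Proof.
move=> h; elim/poly_ind: p => [|p a IHp]; first by rewrite pm0 mul0mx horner0 scale0r.
rewrite pmD pmM pmX pmC mulmxDl -mulmxA h -scalemxAr IHp mul_scalar_mx.
by rewrite hornerMXaddC scalerDl scalerA mulrC.
Qed.

Lemma exp_eigen (V : 'M[F]_N) c k (z : 'cV_N) : V *m z = c *: z -> V ^+ k *m z = c ^+ k *: z.
Proof. by move=> h; rewrite -pmXn (pm_eigen _ h) hornerXn. Qed.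

Variables (e : F) (r : nat).
Hypotheses (e2 : e ^+ 2 = 1) (uU : U \in unitmx) (r_gt0 : (0 < r)%N).
Let M := U - e%:M.

Lemma pm_XsubC k : pm U (('X - e%:P) ^+ k) = M ^+ k.
Proof. by rewrite pm_exp pmB pmX pmC. Qed.

Lemma top_eigen (y : 'cV_N) : M ^+ r *m y = 0 -> U *m (M ^+ r.-1 *m y) = e *: (M ^+ r.-1 *m y).
Proof.
move=> h; have : M *m (M ^+ r.-1 *m y) = 0 by rewrite mulmxA mulmxE -exprS prednK.
by rewrite {1}/M mulmxBl mul_scalar_mx => /eqP; rewrite subr_eq0 => /eqP.
Qed.

Lemma inv_eigen (y : 'cV_N) : U *m y = e *: y -> invmx U *m y = e *: y.
Proof.
move=> h; apply: (can_inj (mulKmx uU)); rewrite mulKVmx // -scalemxAr h scalerA -expr2 e2.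
by rewrite scale1r.
Qed.

Lemma skew_pow (y : 'cV_N) : M ^+ r *m y = 0 ->
  (U - invmx U) ^+ r.-1 *m y = 2%:R ^+ r.-1 *: (M ^+ r.-1 *m y).
Proof.
move=> h; pose K := 1%:M + e *: invmx U.
have eN : U - invmx U = K *m M.
  rewrite /K /M mulmxDl mul1mx mulmxBr -!scalemxAl mulVmx // mul_mx_scalar scalerA -expr2 e2.
  by rewrite scale1r scalemx1 addrA subrK.
have cKM : GRing.comm K M.
  rewrite /GRing.comm -!mulmxE /K /M mulmxDl mulmxDr mul1mx mulmx1; congr (_ + _).
  rewrite -scalemxAl -scalemxAr; congr (_ *: _).
  by rewrite mulmxBl mulmxBr mulVmx // mulmxV // scalar_mxC.
rewrite eN -[K *m M]/(K * M) exprMn_comm // -mulmxE -mulmxA.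
have te := top_eigen h.
apply: exp_eigen; rewrite /K mulmxDl mul1mx -scalemxAl (inv_eigen te) scalerA -expr2 e2.
by rewrite scale1r -{1 2}[_ *m y]scale1r -scalerDl.
Qed.

End Eigen.

(** * Indecomposable blocks *)

Section Unipotent.
Variable F : finFieldType.
Hypothesis oddF : odd #|F|.
Implicit Types (A B : smod F).

Lemma frm_top A e r (p : {poly F}) (x y : 'cV_(dm A)) : good A -> e ^+ 2 = 1 -> (0 < r)%N ->
  (act A - e%:M) ^+ r *m y = 0 ->
  (pm (act A) p *m x)^T *m frm A *m ((act A - e%:M) ^+ r.-1 *m y) =
  p.[e] *: (x^T *m frm A *m ((act A - e%:M) ^+ r.-1 *m y)).
Proof.
move=> gA e2 r0 h; have uU := good_act_unit gA.
rewrite frm_pm // (@pm_eigen _ _ (invmx (act A)) e) -?scalemxAr //.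
by apply: inv_eigen => //; apply: top_eigen.
Qed.

(** On a module that is free over F[t]/(t - e)^r the form is determined up to
   isometry by the form that it induces on the socle: the comparison map S is
   congruent to 1 modulo t - e, hence unipotent. *)
Lemma free_iso A B e r (P : 'M[F]_(dm B, dm A)) Pi :
  let M := act A - e%:M in
  good A -> good B -> Pi *m P = 1%:M -> P *m Pi = 1%:M -> P *m act A = act B *m P ->
  M ^+ r = 0 ->
  (forall x : 'cV_(dm A), M ^+ r.-1 *m x = 0 -> exists y, x = M *m y) ->
  (forall x y : 'cV_(dm A), (P *m x)^T *m frm B *m (P *m (M ^+ r.-1 *m y)) =
     x^T *m frm A *m (M ^+ r.-1 *m y)) ->
  iso A B.
Proof.
move=> M gA gB h1 h2 h3 Mr fr top; have [_ _ uJ] := gA.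
have [e1 e2 e3 uS] := transferS gA gB h1 h2 h3.
set S := invmx _ *m _ in e1 e2 e3 uS.
have cSM k : S *m M ^+ k = M ^+ k *m S.
  apply: intertwine_exp; rewrite /M mulmxBr mulmxBl e3; congr (_ - _).
  by rewrite scalar_mxC.
have top1 : (S - 1%:M) *m M ^+ r.-1 = 0.
  apply: mulmx_cV_eq => y; rewrite mul0mx mulmxBl mul1mx mulmxBl.
  apply/eqP; rewrite subr_eq0; apply/eqP; apply: (can_inj (mulKmx uJ)).
  have id (z : 'cV[F]_(dm A)) (z' : 'cV_(dm A)) : (forall x : 'cV_(dm A), x^T *m z = x^T *m z') -> z = z'.
    by move=> hz; apply/colP => i; have := hz (delta_mx i 0);
      rewrite trmx_delta -!rowE => /matrixP/(_ 0 0); rewrite !mxE.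
  apply: id => x; rewrite -(mulmxA S).
  have -> : frm A *m (S *m (M ^+ r.-1 *m y)) = P^T *m (frm B *m (P *m (M ^+ r.-1 *m y))).
    by rewrite mulmxA e1 -!mulmxA.
  by rewrite mulmxA -trmx_mul mulmxA top !mulmxA.
have [Y hY] : exists Y, S - 1%:M = M *m Y.
  apply: surj_right_inverse => x; apply: fr.
  have : M ^+ r.-1 *m (S - 1%:M) = 0.
    by rewrite mulmxBr mulmx1 -cSM -top1 mulmxBl mul1mx.
  by move=> h; rewrite mulmxA h mul0mx.
have nil k : (S - 1%:M) ^+ k = M ^+ k *m Y ^+ k.
  elim: k => [|k IHk]; first by rewrite !expr0 mulmx1.
  rewrite exprS IHk -mulmxE mulmxA.
  have -> : (S - 1%:M) *m M ^+ k = M ^+ k *m (S - 1%:M).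
    by rewrite mulmxBl mulmxBr cSM mul1mx mulmx1.
  by rewrite hY [M ^+ k.+1]exprSr [Y ^+ k.+1]exprS -!mulmxE !mulmxA.
have [j ej] : exists j, S ^+ j *m S ^+ j = S.
  by apply: (@unipotent_sqrt F oddF _ S r); rewrite nil Mr mul0mx.
apply: (transfer h1 h2 h3 (T := S ^+ j)); first exact: pm_inj_exp.
  by apply/esym/intertwine_exp.
rewrite -e1 -{1}ej mulmxA; congr (_ *m _).
have -> : (S ^+ j)^T = S^T ^+ j by rewrite -pmXn pm_tr pmXn.
exact: intertwine_exp.
Qed.

End Unipotent.

Definition label (F : finFieldType) : Type := ({poly F} * nat * bool)%type.
Notation lf l := (l.1.1).
Notation lr l := (l.1.2).
Notation ls l := (l.2).

Section Blocks.
Variable F : finFieldType.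
Hypothesis oddF : odd #|F|.
Implicit Types (A B : smod F) (l : label F) (f p q : {poly F}).

Definition pmone f := (f == 'X - 1) || (f == 'X + 1).
Definition oddl l := pmone (lf l) && odd (lr l).

Definition Q A (x y : 'cV_(dm A)) : F := (x^T *m frm A *m y) 0 0.

Lemma pmoneP f : reflect (exists2 e, e ^+ 2 = 1 & f = 'X - e%:P) (pmone f).
Proof.
have eN : 'X + 1 = 'X - (-1)%:P :> {poly F} by rewrite rmorphN opprK.
apply: (iffP orP) => [[/eqP ->|/eqP ->]|[e /sqr1_cases [->|->] ->]].
- by exists 1; rewrite ?expr1n.
- by exists (-1); rewrite ?sqrrN ?expr1n.
- by left.
- by right; rewrite eN.
Qed.

Lemma pmoneN f : ~~ pmone f -> forall e, e ^+ 2 = 1 -> f != 'X - e%:P.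
Proof. by move=> n e e2; apply: contra n => /eqP ->; apply/pmoneP; exists e. Qed.

Definition cyclic_block A f r (v : 'cV_(dm A)) :=
  ann (act A) v (f ^+ r) /\ gen (act A) v.

Definition double_block A f r (v w : 'cV_(dm A)) :=
  (forall x, exists p q, x = pm (act A) p *m v + pm (act A) q *m w) /\
  (forall p q, pm (act A) p *m v + pm (act A) q *m w = 0 <->
     (f ^+ r %| p) /\ (f ^+ r %| q)).

Definition isblk l B : Prop :=
  [/\ good B, in_Phis (lf l), (0 < lr l)%N &
    if oddl l then ls l /\ exists v w : 'cV_(dm B), double_block (lf l) (lr l) v w
    else exists2 v : 'cV_(dm B), cyclic_block (lf l) (lr l) v &
      ls l = if pmone (lf l)
             then issq (Q ((act B - invmx (act B)) ^+ (lr l).-1 *m v) v) else true].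

Lemma Q_eq A (x y : 'cV_(dm A)) : x^T *m frm A *m y = (Q x y)%:M.
Proof. exact: mx11_scalar. Qed.

Lemma QDl A (x x' y : 'cV_(dm A)) : Q (x + x') y = Q x y + Q x' y.
Proof. by rewrite /Q linearD /= !mulmxDl mxE. Qed.
Lemma QDr A (x y y' : 'cV_(dm A)) : Q x (y + y') = Q x y + Q x y'.
Proof. by rewrite /Q !mulmxDr mxE. Qed.
Lemma QZl A c (x y : 'cV_(dm A)) : Q (c *: x) y = c * Q x y.
Proof. by rewrite /Q linearZ /= -!scalemxAl mxE. Qed.
Lemma QZr A c (x y : 'cV_(dm A)) : Q x (c *: y) = c * Q x y.
Proof. by rewrite /Q -!scalemxAr mxE. Qed.
Lemma Q0r A (x : 'cV_(dm A)) : Q x 0 = 0.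
Proof. by rewrite /Q mulmx0 mxE. Qed.
Lemma Q0l A (x : 'cV_(dm A)) : Q 0 x = 0.
Proof. by rewrite /Q trmx0 !mul0mx mxE. Qed.
Lemma Qsym A (x y : 'cV_(dm A)) : good A -> Q x y = - Q y x.
Proof. by move=> gA; rewrite /Q frm_sym. Qed.

Lemma Q_nondeg A (y : 'cV_(dm A)) : good A -> (forall x, Q x y = 0) -> y = 0.
Proof.
case=> _ _ uJ h; apply: (inverse_mulmx_eq0 (mulVmx uJ)).
apply/colP => i; have := h (delta_mx i 0).
by rewrite /Q trmx_delta -mulmxA -rowE mxE => ->; rewrite mxE.
Qed.

Lemma Q_pm A p (x y : 'cV_(dm A)) : good A ->
  Q (pm (act A) p *m x) y = Q x (pm (invmx (act A)) p *m y).
Proof. by move=> gA; rewrite /Q frm_pm. Qed.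

Lemma pm_inv_XsubC N (U : 'M[F]_N) e k : U \in unitmx -> e ^+ 2 = 1 ->
  pm (invmx U) (('X - e%:P) ^+ k) = (- e *: invmx U) ^+ k *m (U - e%:M) ^+ k.
Proof.
move=> uU e2; rewrite pm_exp mulmxE -exprMn_comm -?mulmxE.
  congr (_ ^+ _); rewrite pmB pmX pmC -scalemxAl mulmxBr mulVmx // mul_mx_scalar.
  by rewrite scalerBr scaleNr scaleNr opprK scalerA -expr2 e2 scale1r scalemx1 addrC.
rewrite /GRing.comm -!mulmxE -scalemxAl -scalemxAr; congr (_ *: _).
by rewrite mulmxBl mulmxBr mulVmx // mulmxV // scalar_mxC.
Qed.

(** The form x, y |-> Q (x, (U - e)^(r - 1) y) on the top of a module killed by
   (t - e)^r; it is alternating or symmetric according to the parity of r. *)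
Section Top.
Variables (A : smod F) (e : F) (r : nat).
Hypotheses (gA : good A) (e2 : e ^+ 2 = 1) (r_gt0 : (0 < r)%N).
Let M := act A - e%:M.
Definition top (x y : 'cV_(dm A)) := Q x ((act A - e%:M) ^+ r.-1 *m y).

Lemma top_pmr p (x y : 'cV_(dm A)) : M ^+ r *m y = 0 ->
  top x (pm (act A) p *m y) = p.[e] * top x y.
Proof.
move=> h; rewrite /top -pm_XsubC mulmxA pmCC -mulmxA pm_XsubC (@pm_eigen _ _ _ e) ?QZr //.
exact: top_eigen.
Qed.

Lemma top_pml p (x y : 'cV_(dm A)) : M ^+ r *m y = 0 ->
  top (pm (act A) p *m x) y = p.[e] * top x y.
Proof. by move=> h; rewrite /top /Q frm_top // mxE. Qed.

Lemma topC (x y : 'cV_(dm A)) : M ^+ r *m x = 0 -> M ^+ r *m y = 0 ->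
  top y x = (-1) ^+ r * top x y.
Proof.
move=> hx hy; rewrite /top Qsym // -[_ *m x]/(_ *m x) -pm_XsubC Q_pm //.
have uU := good_act_unit gA.
have -> : pm (invmx (act A)) (('X - e%:P) ^+ r.-1) *m y = (-1) ^+ r.-1 *: (M ^+ r.-1 *m y).
  rewrite pm_inv_XsubC //.
  rewrite -mulmxA; apply: exp_eigen; rewrite -scalemxAl.
  rewrite (inv_eigen e2 uU (top_eigen r_gt0 hy)) scalerA mulNr -expr2 e2 //.
rewrite QZr -mulNr pm_XsubC; congr (_ * _); rewrite -[in RHS](prednK r_gt0) exprS mulN1r //.
Qed.

Lemma top_skew (x : 'cV_(dm A)) : odd r -> M ^+ r *m x = 0 -> top x x = 0.
Proof.
move=> or h; have := topC h h; rewrite -signr_odd or expr1 mulN1r => /eqP.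
by rewrite -addr_eq0 -mulr2n -mulr_natl mulf_eq0 (negPf (two_neq0 oddF)) => /eqP.
Qed.

Lemma skew_top (v : 'cV_(dm A)) : M ^+ r *m v = 0 ->
  Q ((act A - invmx (act A)) ^+ r.-1 *m v) v = - 2%:R ^+ r.-1 * top v v.
Proof.
move=> h; rewrite (@skew_pow _ _ _ e) //; last exact: good_act_unit.
by rewrite QZl /top [in LHS]Qsym // mulrN mulNr.
Qed.

End Top.

Section CyclicBlocks.
Variables (f : {poly F}) (r : nat).
Hypotheses (Pf : in_Phis f) (r_gt0 : (0 < r)%N).

Let fr0 : f ^+ r != 0. Proof. by rewrite expf_neq0 // Phis_neq0. Qed.

Lemma cyclic_kill A (v : 'cV_(dm A)) : cyclic_block f r v -> pm (act A) (f ^+ r) = 0.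
Proof.
case=> hv gv; apply: mulmx_cV_eq => x; have [p ->] := gv x.
by rewrite mul0mx mulmxA pmCC -mulmxA (ann0 hv) mulmx0.
Qed.

Lemma double_kill A (v w : 'cV_(dm A)) : double_block f r v w -> pm (act A) (f ^+ r) = 0.
Proof.
case=> g hv; apply: mulmx_cV_eq => x; have [p [q ->]] := g x.
have e1 : pm (act A) (f ^+ r * p) *m v + pm (act A) (f ^+ r * q) *m w = 0.
  by apply/hv; split; apply: dvdp_mulr; apply: dvdpp.
by rewrite mul0mx mulmxDr !mulmxA -!pmM e1.
Qed.

Lemma cyclic_hom A B (v : 'cV_(dm A)) (v' : 'cV_(dm B)) :
  cyclic_block f r v -> cyclic_block f r v' ->
  exists P Pi, [/\ Pi *m P = 1%:M, P *m Pi = 1%:M, P *m act A = act B *m P & P *m v = v'].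
Proof.
case=> hv gv [hv' gv'].
have [Ki [k1 k2]] := kry_inverse fr0 hv gv.
have [Li [m1 m2]] := kry_inverse fr0 hv' gv'.
have ekU := kry_cmp fr0 (ann0 hv); have ekU' := kry_cmp fr0 (ann0 hv').
exists (kry (act B) v' _ *m Ki), (kry (act A) v _ *m Li); split.
- by rewrite mulmxA -(mulmxA _ Li) m1 mulmx1.
- by rewrite mulmxA -(mulmxA _ Ki) k1 mulmx1.
- rewrite mulmxA ekU' -!mulmxA; congr (_ *m _).
  by rewrite -[LHS]mulmx1 -k2 !mulmxA -(mulmxA Ki) ekU !mulmxA k1 mul1mx.
- have := @kry_surj _ _ (act A) v _ 1 fr0 (ann0 hv); rewrite pm1 mul1mx => ev.
  rewrite {1}ev -mulmxA (mulmxA Ki) k1 mul1mx.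
  by rewrite -(kry_surj 1 fr0 (ann0 hv')) pm1 mul1mx.
Qed.

Lemma double_hom A B (v w : 'cV_(dm A)) (v' w' : 'cV_(dm B)) :
  double_block f r v w -> double_block f r v' w' ->
  exists P Pi, [/\ Pi *m P = 1%:M, P *m Pi = 1%:M, P *m act A = act B *m P
    & P *m v = v' /\ P *m w = w'].
Proof.
pose d := (size (f ^+ r)).-1.
pose Z (C : smod F) (x y : 'cV_(dm C)) := row_mx (kry (act C) x d) (kry (act C) y d).
have double_inv (C : smod F) (x y : 'cV_(dm C)) : double_block f r x y ->
    [/\ exists Ki, Ki *m Z C x y = 1%:M /\ Z C x y *m Ki = 1%:M,
        act C *m Z C x y = Z C x y *m bdiag (cmp (f ^+ r)) (cmp (f ^+ r)),
        x = Z C x y *m col_mx (cv _ (1 %% f ^+ r)) 0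
      & y = Z C x y *m col_mx 0 (cv _ (1 %% f ^+ r))].
  case=> g h.
  have kx : pm (act C) (f ^+ r) *m x = 0.
    by have /h := conj (dvdpp (f ^+ r)) (dvdp0 (f ^+ r)); rewrite pm0 mul0mx addr0.
  have ky : pm (act C) (f ^+ r) *m y = 0.
    by have /h := conj (dvdp0 (f ^+ r)) (dvdpp (f ^+ r)); rewrite pm0 mul0mx add0r.
  split.
  - apply: two_sided_inverse => c.
      rewrite -[c]vsubmxK mul_row_col !kryE => /h [h1 h2].
      have z (b : 'cV[F]_d) : f ^+ r %| cp b -> b = 0.
        move=> hb; rewrite -[b]cpK; suff -> : cp b = 0 by rewrite /cv linear0 trmx0.
        have sb : (size (cp b) < size (f ^+ r))%N.
          by apply: leq_ltn_trans (size_cp b) _; rewrite ltn_predL size_poly_gt0.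
        by apply/eqP; apply: contraT => /dvdp_leq/(_ hb); rewrite leqNgt sb.
      by rewrite (z _ h1) (z _ h2) col_mx0.
    have [p [q ->]] := g c; exists (col_mx (cv _ (p %% f ^+ r)) (cv _ (q %% f ^+ r))).
    by rewrite mul_row_col -!kry_surj.
  - by rewrite mul_mx_row !kry_cmp // /bdiag mul_row_block !mulmx0 addr0 add0r.
  - by rewrite mul_row_col mulmx0 addr0 -kry_surj // pm1 mul1mx.
  - by rewrite mul_row_col mulmx0 add0r -kry_surj // pm1 mul1mx.
move=> /double_inv [[Ki [k1 k2]] ekU ev ew] /double_inv [[Li [m1 m2]] ekU' ev' ew'].
exists (Z B v' w' *m Ki), (Z A v w *m Li); split.
- by rewrite mulmxA -(mulmxA _ Li) m1 mulmx1.
- by rewrite mulmxA -(mulmxA _ Ki) k1 mulmx1.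
- rewrite mulmxA ekU' -!mulmxA; congr (_ *m _).
  by rewrite -[LHS]mulmx1 -k2 !mulmxA -(mulmxA Ki) ekU !mulmxA k1 mul1mx.
- split; first by rewrite {1}ev -mulmxA (mulmxA Ki) k1 mul1mx -ev'.
  by rewrite {1}ew -mulmxA (mulmxA Ki) k1 mul1mx -ew'.
Qed.

Lemma cyclic_iso_generic A B (v : 'cV_(dm A)) (v' : 'cV_(dm B)) : ~~ pmone f ->
  good A -> good B -> cyclic_block f r v -> cyclic_block f r v' -> iso A B.
Proof.
move=> npm gA gB hv hv'.
have [P [Pi [h1 h2 h3 h4]]] := cyclic_hom hv hv'.
have [e1 e2 e3 uS] := transferS gA gB h1 h2 h3.
set S := invmx _ *m _ in e1 e2 e3 uS; case: (hv) => av gv.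
have [s hs] := gv (S *m v).
have eS : S = pm (act A) s.
  apply: mulmx_cV_eq => x; have [p ->] := gv x.
  by rewrite mulmxA (pm_intertwine p e3) -mulmxA hs !mulmxA pmCC.
have [|| T [uT cT eT]] := @cyclic_norm F A f r oddF gA Pf (pmoneN npm) (cyclic_kill hv) s.
- by rewrite -eS.
- by rewrite -eS.
by apply: (transfer h1 h2 h3 uT cT); rewrite -e1 -eT eS.
Qed.

End CyclicBlocks.

Section PM1Blocks.
Variables (e : F) (r : nat).
Hypotheses (e2 : e ^+ 2 = 1) (r_gt0 : (0 < r)%N).
Let f : {poly F} := 'X - e%:P.

Let f0 : f != 0. Proof. exact: polyXsubC_eq0 || by rewrite polyXsubC_eq0. Qed.
Let rE : r = r.-1.+1. Proof. by rewrite prednK. Qed.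

Let kill_exp A : pm (act A) (f ^+ r) = 0 -> (act A - e%:M) ^+ r = 0.
Proof. by rewrite pm_XsubC. Qed.

Lemma dvd_top p : f ^+ r %| f ^+ r.-1 * p -> exists q, p = f * q.
Proof.
rewrite {1}rE exprSr dvdp_mul2l ?expf_neq0 // => /dvdpP [q ->].
by exists q; rewrite mulrC.
Qed.

Lemma cyclic_free A (v : 'cV_(dm A)) : cyclic_block f r v ->
  forall x : 'cV_(dm A), (act A - e%:M) ^+ r.-1 *m x = 0 ->
    exists y, x = (act A - e%:M) *m y.
Proof.
case=> hv gv x; have [p ->] := gv x; rewrite -pm_XsubC mulmxA -pmM => /hv /dvd_top [q ->].
by exists (pm (act A) q *m v); rewrite pmM -mulmxA pmB pmX pmC.
Qed.

Lemma double_free A (v w : 'cV_(dm A)) : double_block f r v w ->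
  forall x : 'cV_(dm A), (act A - e%:M) ^+ r.-1 *m x = 0 ->
    exists y, x = (act A - e%:M) *m y.
Proof.
case=> g h x; have [p [q ->]] := g x.
rewrite -pm_XsubC mulmxDr !mulmxA -!pmM => /h [/dvd_top [p' ->] /dvd_top [q' ->]].
exists (pm (act A) p' *m v + pm (act A) q' *m w).
by rewrite mulmxDr !pmM !mulmxA pmB pmX pmC.
Qed.

Lemma cyclic_top_neq0 A (v : 'cV_(dm A)) : good A -> cyclic_block f r v ->
  top e r v v != 0.
Proof.
move=> gA hv; have Mr := kill_exp (cyclic_kill hv); case: hv => hv gv.
apply/eqP => t0; have : (act A - e%:M) ^+ r.-1 *m v = 0.
  apply: Q_nondeg => // x; have [p ->] := gv x.
  by rewrite -/(top e r _ _) top_pml ?Mr ?mul0mx // t0 mulr0.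
rewrite -pm_XsubC => /hv; rewrite -[f ^+ r.-1]mulr1 => /dvd_top [q e1].
have : f %| 1 by rewrite e1 dvdp_mulr.
by rewrite dvdp1 size_XsubC.
Qed.

Lemma double_top_neq0 A (v w : 'cV_(dm A)) : odd r -> good A -> double_block f r v w ->
  top e r v w != 0.
Proof.
move=> or gA hv; have Mr := kill_exp (double_kill hv); case: hv => g h.
have Mz (x : 'cV_(dm A)) : (act A - e%:M) ^+ r *m x = 0 by rewrite Mr mul0mx.
apply/eqP => t0; have : (act A - e%:M) ^+ r.-1 *m w = 0.
  apply: Q_nondeg => // x; have [p [q ->]] := g x.
  rewrite -/(top e r _ _) /top QDl -/(top e r _ _) -/(top e r _ w).
  by rewrite !top_pml // t0 (top_skew gA) // !mulr0 addr0.
rewrite -pm_XsubC => e1; have [|_] := (h 0 (f ^+ r.-1)).1.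
  by rewrite pm0 mul0mx add0r.
rewrite -[f ^+ r.-1]mulr1 => /dvd_top [q e3].
have : f %| 1 by rewrite e3 dvdp_mulr.
by rewrite dvdp1 size_XsubC.
Qed.

Lemma cyclic_block_scale A c (v : 'cV_(dm A)) : c != 0 -> cyclic_block f r v ->
  cyclic_block f r (c *: v).
Proof.
move=> c0 [hv gv]; split=> [p|x].
  rewrite -scalemxAr; split=> [/eqP|/hv ->]; last by rewrite scaler0.
  by rewrite scaler_eq0 (negPf c0) => /eqP /hv.
have [p ->] := gv x; exists (c^-1 *: p).
by rewrite pmZ -scalemxAl -scalemxAr scalerA mulVf // scale1r.
Qed.

Lemma double_block_scale A c (v w : 'cV_(dm A)) : c != 0 -> double_block f r v w ->
  double_block f r (c *: v) w.
Proof.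
move=> c0 [g h]; split=> [x|p q].
  have [p [q ->]] := g x; exists (c^-1 *: p), q.
  by rewrite pmZ -scalemxAl -scalemxAr scalerA mulVf // scale1r.
have -> : pm (act A) p *m (c *: v) = pm (act A) (c *: p) *m v.
  by rewrite pmZ -scalemxAl scalemxAr.
by rewrite h dvdpZr.
Qed.

Lemma cyclic_iso_pm1 A B (v : 'cV_(dm A)) (v' : 'cV_(dm B)) :
  good A -> good B -> cyclic_block f r v -> cyclic_block f r v' ->
  issq (Q ((act A - invmx (act A)) ^+ r.-1 *m v) v) =
  issq (Q ((act B - invmx (act B)) ^+ r.-1 *m v') v') -> iso A B.
Proof.
move=> gA gB hv hv'.
have MA := kill_exp (cyclic_kill hv); have MB := kill_exp (cyclic_kill hv').
have MAz (x : 'cV_(dm A)) : (act A - e%:M) ^+ r *m x = 0 by rewrite MA mul0mx.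
have MBz (x : 'cV_(dm B)) : (act B - e%:M) ^+ r *m x = 0 by rewrite MB mul0mx.
have tA := cyclic_top_neq0 gA hv; have tB := cyclic_top_neq0 gB hv'.
have two0 : - (2%:R : F) ^+ r.-1 != 0 by rewrite oppr_eq0 expf_neq0 // two_neq0.
rewrite (skew_top gA e2) // (skew_top gB e2) // => sq.
have [c c0 ec] := issq_ratio oddF (mulf_neq0 two0 tA) (mulf_neq0 two0 tB) sq.
have {}ec : top e r v' v' = top e r v v * c ^+ 2.
  by apply: (mulfI two0); rewrite ec -mulrA.
have [P [Pi [h1 h2 h3 h4]]] := cyclic_hom (Phis_XsubC e2) (cyclic_block_scale c0 hv) hv'.
apply: (free_iso oddF gA gB h1 h2 h3 MA); first exact: cyclic_free hv.
move=> x y; have [_ gv] := cyclic_block_scale c0 hv.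
have [p ->] := gv x; have [q ->] := gv y.
rewrite !(Q_eq (A := A)) -/(top e r _ _) top_pml // top_pmr //.
have hM : P *m (act A - e%:M) = (act B - e%:M) *m P.
  by rewrite mulmxBr mulmxBl h3 scalar_mxC.
rewrite (mulmxA P (_ ^+ _)) (intertwine_exp _ hM) -(mulmxA _ P) !(mulmxA P (pm _ _)).
rewrite !(pm_intertwine _ h3).
rewrite -!(mulmxA _ P) h4 Q_eq -/(top e r _ _) top_pml // top_pmr //.
rewrite ec /top QZl -scalemxAr QZr; congr (_ * (_ * _))%:M.
by rewrite mulrA mulrC expr2.
Qed.

Lemma double_iso_pm1 A B (v w : 'cV_(dm A)) (v' w' : 'cV_(dm B)) : odd r ->
  good A -> good B -> double_block f r v w -> double_block f r v' w' -> iso A B.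
Proof.
move=> or gA gB hv hv'.
have MA := kill_exp (double_kill hv); have MB := kill_exp (double_kill hv').
have MAz (x : 'cV_(dm A)) : (act A - e%:M) ^+ r *m x = 0 by rewrite MA mul0mx.
have MBz (x : 'cV_(dm B)) : (act B - e%:M) ^+ r *m x = 0 by rewrite MB mul0mx.
have tA := double_top_neq0 or gA hv; have tB := double_top_neq0 or gB hv'.
pose c := top e r v' w' / top e r v w.
have c0 : c != 0 by rewrite mulf_neq0 ?invr_eq0.
have hcv := double_block_scale c0 hv.
have [P [Pi [h1 h2 h3 [h4 h5]]]] := double_hom (Phis_XsubC e2) hcv hv'.
apply: (free_iso oddF gA gB h1 h2 h3 MA); first exact: double_free hv.
have hM : P *m (act A - e%:M) = (act B - e%:M) *m P.
  by rewrite mulmxBr mulmxBl h3 scalar_mxC.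
set u := c *: v in h4 hcv; have [g _] := hcv.
have euw : top e r u w = top e r v' w'.
  by rewrite /top /u QZl -/(top e r v w) /c divfK.
have topD (C : smod F) (a b c' d : 'cV_(dm C)) :
  top e r (a + b) (c' + d) = top e r a c' + top e r a d + (top e r b c' + top e r b d).
  by rewrite /top mulmxDr QDl !QDr.
move=> x y; have [p [p' ->]] := g x; have [q [q' ->]] := g y.
rewrite (mulmxA P (_ ^+ _)) (intertwine_exp _ hM) -(mulmxA _ P) !(mulmxDr P) !(mulmxA P (pm _ _)).
rewrite !(pm_intertwine _ h3) -!(mulmxA _ P) h4 h5 !Q_eq -!/(top e r _ _) !topD.
rewrite !top_pml // !top_pmr // !top_skew // (topC gB e2 r_gt0 (MBz v') (MBz w')).
by rewrite (topC gA e2 r_gt0 (MAz u) (MAz w)) euw.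
Qed.

End PM1Blocks.

Lemma isblk_unique l A B : isblk l A -> isblk l B -> iso A B.
Proof.
case=> gA Pf r0; rewrite /isblk => hA [gB _ _]; move: hA; rewrite /oddl.
case: (boolP (pmone (lf l))) => [/pmoneP [e e2 ef]|npm] /=; last first.
  move=> [v hv _] [v' hv' _]; exact: cyclic_iso_generic hv hv'.
case: (boolP (odd _)) => ol.
  move=> [_ [v [w hv]]] [_ [v' [w' hv']]]; rewrite ef in hv hv'.
  exact: double_iso_pm1 hv hv'.
move=> [v hv ->] [v' hv' e']; rewrite ef in hv hv'.
exact: cyclic_iso_pm1 hv hv' e'.
Qed.

End Blocks.

Section Split.
Variable F : finFieldType.
Hypothesis oddF : odd #|F|.
Implicit Types (A B : smod F) (l : label F) (f p q : {poly F}).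

Lemma cyclic_splits A f r (v : 'cV_(dm A)) a : good A -> in_Phis f ->
  pm (act A) (f ^+ r.+1) *m v = 0 -> Q v (pm (act A) (f ^+ r * a) *m v) != 0 ->
  exists s B A', [/\ isblk (f, r.+1, s) B, good A' & iso A (dsum B A')].
Proof.
move=> gA Pf kv nz; have [k [ek ek']] := inv_pm2 gA.
have uU := good_act_unit gA.
pose I p := forall b, Q v (pm (act A) (p * b) *m v) = 0.
have ID p q : I p -> I q -> I (p + q).
  by move=> hp hq b; rewrite mulrDl pmD mulmxDl QDr hp hq addr0.
have IM p q : I q -> I (p * q) by move=> hq b; rewrite mulrAC mulrC.
have Istar p : I p -> forall b, Q v (pm (invmx (act A)) p *m (pm (act A) b *m v)) = 0.
  by move=> hp b; rewrite -Q_pm // Qsym // Q_pm // ek mulmxA -pmM mulrC hp oppr0.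
have Irv p : I p -> I (rv p).
  move=> hp b; rewrite pmM pm_inv_rv // ek -pmXn [X in X *m _ *m _]pmCC -ek -!mulmxA.
  by rewrite [X in _ *m X]mulmxA -pmM Istar.
have If : I (f ^+ r.+1) by move=> b; rewrite mulrC pmM -mulmxA kv mulmx0 Q0r.
have Idvd j p : (j <= r.+1)%N -> I p -> f ^+ j %| p.
  elim: j p => [|j IHj] p hj Ip; first by rewrite expr0 dvd1p.
  have /dvdpP [q eq] := IHj _ (ltnW hj) Ip.
  rewrite exprSr eq mulrC dvdp_mul2r ?expf_neq0 ?Phis_neq0 //.
  apply: contraT => nf; case/negP: nz.
  have I1 : I (f ^+ j * 1).
    apply: (@Phis_prime F f Pf (fun q => I (f ^+ j * q)) (r.+1 - j) q) => //.
    - by move=> x y hx hy; rewrite mulrDr; apply: ID.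
    - by move=> x y hy; rewrite mulrCA; apply: IM.
    - move=> x hx; have := Irv _ hx; rewrite rvM.
      have [c c0 ->] := Phis_exp_rv Pf j; rewrite -scalerAl => /(IM (c^-1)%:P).
      by rewrite mul_polyC scalerA mulVf // scale1r.
    - by rewrite -exprD subnKC // ltnW.
    - by rewrite mulrC -eq.
  have := I1 (f ^+ (r - j) * a); rewrite mulr1 mulrA -exprD subnKC // => ->.
  by rewrite eqxx.
have Iann p : pm (act A) p *m v = 0 -> f ^+ r.+1 %| p.
  move=> hp; apply: Idvd => // b; by rewrite mulrC pmM -mulmxA hp mulmx0 Q0r.
have av : ann (act A) v (f ^+ r.+1).
  move=> p; split; first exact: Iann.
  by case/dvdpP => q ->; rewrite pmM -mulmxA kv mulmx0.
have fr0 : f ^+ r.+1 != 0 by rewrite expf_neq0 // Phis_neq0.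
have sf : (1 < size (f ^+ r.+1))%N.
  by rewrite -subn_gt0 subn1 size_exp muln_gt0 andbT -subn1 subn_gt0 Phis_size.
pose Z := kry (act A) v (size (f ^+ r.+1)).-1.
have ekU := kry_cmp fr0 kv.
have [|A' gBA iA] := splitting gA ekU.
  move=> c hc; apply: (kry_inj fr0 av); rewrite kryE; apply/av; apply: Idvd => // b.
  have [c' ec'] : exists c', pm (act A) (b \Po 'X^k) *m v = Z *m c'.
    by exists (cv _ ((b \Po 'X^k) %% f ^+ r.+1)); rewrite -kry_surj.
  have : Q (Z *m c') (Z *m c) = 0.
    by rewrite /Q trmx_mul -!mulmxA (mulmxA (frm A)) 2!(mulmxA Z^T) hc mulmx0 mxE.
  by rewrite -ec' Q_pm // -ek' kryE mulmxA -pmM mulrC.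
have [gB gA'] := (good_dsum _ _).1 gBA.
pose B := SMod (cmp (f ^+ r.+1)) (Z^T *m frm A *m Z).
have [cB1 cB2] := cmp_ann sf.
pose v0 : 'cV[F]_(dm B) := cv _ 1.
pose s := if pmone f then issq (@Q F B ((act B - invmx (act B)) ^+ r *m v0) v0) else true.
exists s, B, A'; split=> //; split=> //=.
rewrite ifN; first by exists v0.
rewrite /oddl /=; apply/negP => /andP [/pmoneP [e e2 ef] /= or].
case/negP: nz; move: kv; rewrite ef pm_XsubC => kv.
have : top e r.+1 v v = 0 by apply: (top_skew oddF gA).
rewrite /top /= -pm_XsubC -ef => t0.
have := top_pmr (isT : (0 < r.+1)%N) a v kv.
rewrite {1}/top /= -pm_XsubC -ef pmM -mulmxA => ->.
by rewrite /top /= -pm_XsubC -ef t0 mulr0.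
Qed.

Lemma double_splits A e r (v w : 'cV_(dm A)) (f := 'X - e%:P) :
  good A -> e ^+ 2 = 1 -> odd r.+1 ->
  (act A - e%:M) ^+ r.+1 *m v = 0 -> (act A - e%:M) ^+ r.+1 *m w = 0 ->
  top e r.+1 v w != 0 ->
  exists B A', [/\ isblk (f, r.+1, true) B, good A' & iso A (dsum B A')].
Proof.
move=> gA e2 or kv kw nz; have [k [ek ek']] := inv_pm2 gA.
have r0 : (0 < r.+1)%N by [].
have nz' : top e r.+1 w v != 0.
  by rewrite (topC gA e2 r0 kv kw) mulf_neq0 // signr_eq0.
have tv : top e r.+1 v v = 0 by apply: (top_skew oddF gA).
have tw : top e r.+1 w w = 0 by apply: (top_skew oddF gA).
have Pf : in_Phis f := Phis_XsubC e2.
have fv : pm (act A) (f ^+ r.+1) *m v = 0 by rewrite pm_XsubC.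
have fw : pm (act A) (f ^+ r.+1) *m w = 0 by rewrite pm_XsubC.
have fr0 : f ^+ r.+1 != 0 by rewrite expf_neq0 // Phis_neq0.
have sf : (1 < size (f ^+ r.+1))%N.
  by rewrite -subn_gt0 subn1 size_exp muln_gt0 andbT -subn1 subn_gt0 Phis_size.
have indep p q j : (j <= r.+1)%N ->
    (forall b, Q (pm (act A) b *m v) (pm (act A) p *m v + pm (act A) q *m w) = 0) ->
    (forall b, Q (pm (act A) b *m w) (pm (act A) p *m v + pm (act A) q *m w) = 0) ->
    f ^+ j %| p /\ f ^+ j %| q.
  move=> hj hv hw; elim: j hj => [|j IHj] hj; first by rewrite expr0 !dvd1p.
  have [/dvdpP [p1 ep] /dvdpP [q1 eq]] := IHj (ltnW hj).
  have aux (u : 'cV_(dm A)) :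
      (forall b, Q (pm (act A) b *m u) (pm (act A) p *m v + pm (act A) q *m w) = 0) ->
      p1.[e] * top e r.+1 u v + q1.[e] * top e r.+1 u w = 0.
    move=> /(_ ((f ^+ (r - j)) \Po 'X^k)); rewrite Q_pm // -ek' mulmxDr !mulmxA -!pmM.
    have -> : f ^+ (r - j) * p = f ^+ r * p1 by rewrite ep mulrCA -exprD subnK // mulrC.
    have -> : f ^+ (r - j) * q = f ^+ r * q1 by rewrite eq mulrCA -exprD subnK // mulrC.
    rewrite !pmM -!mulmxA pm_XsubC QDr => <-.
    by rewrite -(top_pmr r0 p1 u kv) -(top_pmr r0 q1 u kw).
  have := aux _ hv; rewrite tv mulr0 add0r => /eqP; rewrite mulf_eq0 (negPf nz) orbF => q1e.
  have := aux _ hw; rewrite tw mulr0 addr0 => /eqP; rewrite mulf_eq0 (negPf nz') orbF => p1e.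
  rewrite ep eq exprS !dvdp_mul2r ?expf_neq0 ?Phis_neq0 //.
  by rewrite !dvdp_XsubCl.
pose d := (size (f ^+ r.+1)).-1.
pose Z := row_mx (kry (act A) v d) (kry (act A) w d).
pose D := bdiag (cmp (f ^+ r.+1)) (cmp (f ^+ r.+1)).
have ekU : act A *m Z = Z *m D.
  by rewrite /Z mul_mx_row !kry_cmp // /D /bdiag mul_row_block !mulmx0 addr0 add0r.
have [|A' gBA iA] := splitting gA ekU.
  move=> c hc; rewrite -[c]vsubmxK.
  have ZE (c1 c2 : 'cV_d) : Z *m col_mx c1 c2 =
      pm (act A) (cp c1) *m v + pm (act A) (cp c2) *m w.
    by rewrite /Z mul_row_col !kryE.
  have ort c' : Q (Z *m c') (Z *m c) = 0.
    by rewrite /Q trmx_mul -!mulmxA (mulmxA (frm A)) 2!(mulmxA Z^T) hc mulmx0 mxE.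
  have [|b|b|h1 h2] := indep (cp (usubmx c)) (cp (dsubmx c)) r.+1 => //.
  - rewrite -ZE vsubmxK (kry_surj b fr0 fv).
    have := ort (col_mx (cv d (b %% f ^+ r.+1)) 0).
    by rewrite /Z mul_row_col mulmx0 addr0.
  - rewrite -ZE vsubmxK (kry_surj b fr0 fw).
    have := ort (col_mx 0 (cv d (b %% f ^+ r.+1))).
    by rewrite /Z mul_row_col mulmx0 add0r.
  have z (b : 'cV[F]_d) : f ^+ r.+1 %| cp b -> b = 0.
    move=> hb; rewrite -[b]cpK; suff -> : cp b = 0 by rewrite /cv linear0 trmx0.
    have sb : (size (cp b) < size (f ^+ r.+1))%N.
      by apply: leq_ltn_trans (size_cp b) _; rewrite ltn_predL size_poly_gt0.
    by apply/eqP; apply: contraT => /dvdp_leq/(_ hb); rewrite leqNgt sb.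
  by rewrite (z _ h1) (z _ h2) col_mx0.
have [gB gA'] := (good_dsum _ _).1 gBA.
pose B := SMod D (Z^T *m frm A *m Z).
have [cB1 cB2] := cmp_ann sf.
exists B, A'; split=> //; split=> //=.
have -> : oddl (f, r.+1, true) = true by apply/andP; split=> //; apply/pmoneP; exists e.
have DE p (c1 c2 : 'cV_d) : pm D p *m col_mx c1 c2 =
    col_mx (pm (cmp (f ^+ r.+1)) p *m c1) (pm (cmp (f ^+ r.+1)) p *m c2).
  by rewrite bdiag_pm /bdiag mul_block_col !mul0mx addr0 add0r.
split=> //; exists (col_mx (cv d 1) 0), (col_mx 0 (cv d 1)); split=> /= [x|p q].
  have [p ep] := cB2 (usubmx x); have [q eq] := cB2 (dsubmx x).
  exists p, q; rewrite !DE !mulmx0 add_col_mx addr0 add0r -ep -eq.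
  exact: esym (vsubmxK x).
rewrite !DE !mulmx0 add_col_mx addr0 add0r; split.
  by rewrite -col_mx0 => /eq_col_mx [/cB1 ? /cB1 ?].
by case=> /cB1 -> /cB1 ->; rewrite col_mx0.
Qed.

Lemma skew_of_isotropic N (H : 'M[F]_N) :
  (forall x : 'cV_N, x^T *m H *m x = 0) -> H^T = - H.
Proof.
move=> h; apply/matrixP => i j.
have := h (delta_mx i 0 + delta_mx j 0).
rewrite [(_ + _)^T]linearD /= !mulmxDl !mulmxDr !h add0r addr0 => /matrixP/(_ 0 0).
have e a b : (delta_mx a 0)^T *m H *m (delta_mx b 0 : 'cV_N) = (H a b)%:M.
  by rewrite trmx_delta -rowE -colE [LHS]mx11_scalar !mxE.
by rewrite !e !mxE eqxx !mulr1n => /eqP; rewrite addr_eq0 => /eqP ->; rewrite opprK.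
Qed.

(** A block of label f, r splits off as soon as f ^ r is the exact f-part of an
   annihilating polynomial.  If no vector of the f-primary part generates a
   non-degenerate cyclic submodule, then all forms x, y |-> Q (x, a y), with a in
   the socle, are alternating, which only happens for f = t - e and r odd; two
   vectors are then needed. *)
Lemma split_block A f r m : good A -> in_Phis f -> coprimep f m -> m`_0 != 0 ->
  pm (act A) (f ^+ r.+1 * m) = 0 -> pm (act A) (f ^+ r * m) != 0 ->
  exists s B A', [/\ isblk (f, r.+1, s) B, good A' & iso A (dsum B A')].
Proof.
move=> gA Pf cop m0 k1 k0.
have uU := good_act_unit gA; have [_ gJ uJ] := gA.
set U := act A in k1 k0 uU *; set J := frm A in gJ uJ *.
have kill x : pm U (f ^+ r.+1) *m (pm U m *m x) = 0 by rewrite mulmxA -pmM k1 mul0mx.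
case: (pselect (exists x a, Q (pm U m *m x) (pm U (f ^+ r * a) *m (pm U m *m x)) != 0)).
  by case=> x [a nz]; apply: cyclic_splits nz => //; apply: kill.
move=> none.
have coprv : coprimep f (rv m) by apply: Phis_coprime_rv.
(* z = m* f^r m *)
pose z := pm (invmx U) m *m pm U (f ^+ r * m).
have skew a : (J *m z *m pm U a)^T = - (J *m z *m pm U a).
  apply: skew_of_isotropic => x.
  have : Q (pm U m *m x) (pm U (f ^+ r * a) *m (pm U m *m x)) = 0.
    by apply/eqP; apply: contraT => h; case: none; exists x, a.
  rewrite Q_pm // => e0; rewrite [LHS]mx11_scalar.
  suff -> : (x^T *m (J *m z *m pm U a) *m x) 0 0 = 0 by rewrite rmorph0.
  rewrite -[RHS]e0 /Q /z -!mulmxA; congr ((_ *m (_ *m (_ *m _))) 0 0).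
  by rewrite !mulmxA -!pmM; congr (pm _ _ *m _); rewrite mulrAC.
have zU : z *m U = U *m z.
  have [k ek] := inv_pm gA.
  by rewrite /z ek -pmM pmCU.
have nz0 q : coprimep f q -> pm U q *m pm U (f ^+ r * m) = 0 -> False.
  case/Bezout_eq1_coprimepP => [[u v] /= euv] e0; case/eqP: k0.
  rewrite -[pm U (f ^+ r * m)]mul1mx -(pm1 U) -euv pmD mulmxDl (pmM _ v) -[X in _ + X]mulmxA e0.
  by rewrite mulmx0 addr0 -pmM -mulrA [f * _]mulrA -exprS pmM k1 mulmx0.
have zrv : z = 0 -> False.
  move=> z0; apply: (nz0 (rv m)) => //.
  by rewrite pm_inv_rv // -mulmxA -/z z0 mulmx0.
have zT : z^T *m J = J *m z.
  have := skew 1; rewrite pm1 mulmx1 trmx_mul gJ mulmxN => /oppr_inj //.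
have pmf : pmone f.
  apply: contraT => npm; exfalso.
  have := skew 'X; rewrite pmX trmx_mul trmx_mul gJ mulmxN mulmxN => /oppr_inj.
  rewrite zT mulmxA good_adj // -[J *m z *m U]mulmxA -mulmxA => /(can_inj (mulKmx uJ)).
  move/(congr1 (mulmx U)); rewrite mulKVmx // zU mulmxA => ez.
  apply: (nz0 (('X^2 - 1) * rv m)).
    by rewrite coprimepMr coprv andbT Phis_coprime_sqr1 //; apply: pmoneN.
  have cz : pm U ('X^2 - 1) *m z = 0.
    by rewrite pmB pm1 -['X^2]/('X * 'X) pmM pmX mulmxBl mul1mx -ez subrr.
  by rewrite pmM pm_inv_rv // -!mulmxA -/z mulmxA -pmXn pmCC -mulmxA cz mulmx0.
case/pmoneP: pmf => e e2 ef.
have Uz : U *m z = e *: z.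
  apply/eqP; rewrite -subr_eq0 -mul_scalar_mx -mulmxBl; apply/eqP.
  have -> : U - e%:M = pm U f by rewrite ef pmB pmX pmC.
  have [k ek] := inv_pm gA.
  by rewrite /z ek mulmxA pmCC -mulmxA -pmM mulrA -exprS k1 mulmx0.
case: (boolP (odd r.+1)) => [or|/= nor]; last first.
  exfalso; apply: zrv; apply: (scale2_eq0 oddF).
  have : J *m z = - (J *m z); last first.
    move/eqP; rewrite -addr_eq0 -mulmxDr => /eqP h; apply: (inverse_mulmx_eq0 (mulVmx uJ) h).
  rewrite negbK in nor; have [k [ek ek']] := inv_pm2 gA.
  have ez : z = pm U ((m \Po 'X^k) * (f ^+ r * m)) by rewrite /z ek -pmM.
  have [v ev] : exists v, (- e *: invmx U) ^+ r = pm U v.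
    by exists ((- e *: ('X \Po 'X^k)) ^+ r); rewrite pm_exp pmZ -ek pmX.
  have ez2 : pm (invmx U) ((m \Po 'X^k) * (f ^+ r * m)) = (- e *: invmx U) ^+ r *m z.
    rewrite !pmM -ek' (ek m) {1}ef pm_inv_XsubC // ev ez -pm_XsubC -ef -!pmM.
    by congr (pm _ _); ring.
  rewrite -[in LHS]zT {1}ez star_pm // ez2 -mulmxN; congr (_ *m _).
  apply: mulmx_cV_eq => x; rewrite -mulmxA.
  have zx : U *m (z *m x) = e *: (z *m x) by rewrite mulmxA Uz -scalemxAl.
  rewrite (@exp_eigen _ _ _ (-1)); last first.
    by rewrite -scalemxAl (inv_eigen e2 uU zx) scalerA mulNr -expr2 e2.
  by rewrite -signr_odd nor expr1 scaleN1r mulNmx.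
have [x [y nz]] : exists x y, Q x (z *m y) != 0.
  apply: contrapT => h; apply: zrv; apply: mulmx_cV_eq => y; rewrite mul0mx.
  apply: (Q_nondeg gA) => x; apply/eqP; apply: contraT => hh; case: h.
  by exists x, y.
have [||| B [A' hB]] := @double_splits A e r (pm U m *m x) (pm U m *m y) gA e2 or.
- by rewrite -pm_XsubC -ef kill.
- by rewrite -pm_XsubC -ef kill.
- rewrite /top /= -pm_XsubC -ef Q_pm //; move: nz; rewrite /z.
  by rewrite -!mulmxA pmM -!mulmxA.
by exists true, B, A'; rewrite ef.
Qed.

End Split.

(** * Normal forms *)

Section NormalForm.
Variable F : finFieldType.
Hypothesis oddF : odd #|F|.
Implicit Types (A B : smod F) (l : label F) (f g p q : {poly F}) (L : seq (label F)).

Definition mul l : nat := if oddl l then 2 else 1.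
Definition wt l : nat := ((size (lf l)).-1 * lr l * mul l)%N.

Lemma isblk_dim l B : isblk l B -> dm B = wt l.
Proof.
case=> gB Pf r0; rewrite /wt /mul -size_exp.
have fr0 : lf l ^+ lr l != 0 by rewrite expf_neq0 // Phis_neq0.
case: ifP => _.
  case=> _ [v [w [g h]]].
  have kv : pm (act B) (lf l ^+ lr l) *m v = 0.
    by have /h := conj (dvdpp (lf l ^+ lr l)) (dvdp0 (lf l ^+ lr l)); rewrite pm0 mul0mx addr0.
  have kw : pm (act B) (lf l ^+ lr l) *m w = 0.
    by have /h := conj (dvdp0 (lf l ^+ lr l)) (dvdpp (lf l ^+ lr l)); rewrite pm0 mul0mx add0r.
  pose d := (size (lf l ^+ lr l)).-1.
  have [||K [K1 K2]] := @two_sided_inverse F _ _ (row_mx (kry (act B) v d) (kry (act B) w d)).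
  - move=> c; rewrite -[c]vsubmxK mul_row_col !kryE => /h [h1 h2].
    have z (b : 'cV[F]_d) : lf l ^+ lr l %| cp b -> b = 0.
      move=> hb; rewrite -[b]cpK; suff -> : cp b = 0 by rewrite /cv linear0 trmx0.
      have sb : (size (cp b) < size (lf l ^+ lr l))%N.
        by apply: leq_ltn_trans (size_cp b) _; rewrite ltn_predL size_poly_gt0.
      by apply/eqP; apply: contraT => /dvdp_leq/(_ hb); rewrite leqNgt sb.
    by rewrite (z _ h1) (z _ h2) col_mx0.
  - move=> x; have [p [q ->]] := g x.
    exists (col_mx (cv d (p %% lf l ^+ lr l)) (cv d (q %% lf l ^+ lr l))).
    by rewrite mul_row_col -!kry_surj.
  by rewrite (inverse_dim K1 K2) addnn muln2.
case=> v [av gv] _; have [K [K1 K2]] := kry_inverse fr0 av gv.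
by rewrite muln1; apply: inverse_dim K1 K2.
Qed.

Lemma wt_gt0 l : in_Phis (lf l) -> (0 < lr l)%N -> (0 < wt l)%N.
Proof.
move=> Pf r0; rewrite /wt !muln_gt0 r0 /mul -subn1 subn_gt0 Phis_size //=.
by case: ifP.
Qed.

Definition rescale c B := SMod (act B) (c *: frm B).

Lemma good_rescale c B : c != 0 -> good B -> good (rescale c B).
Proof.
move=> c0 [g1 g2 g3]; split => /=.
- by rewrite -scalemxAr -scalemxAl g1.
- by rewrite linearZ /= g2 scalerN.
- by rewrite unitmxZ // unitfE.
Qed.

Definition flip l : label F := (lf l, lr l, ~~ ls l).

Lemma isblk_rescale c l B : c != 0 -> ~~ issq c -> pmone (lf l) -> ~~ odd (lr l) ->
  isblk l B -> isblk (flip l) (rescale c B).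
Proof.
move=> c0 nc pf nr [gB Pf r0]; rewrite /isblk /oddl /= (negPf nr) andbF.
case=> v hv hs; split => //; first exact: good_rescale.
exists v => //; rewrite pf in hs *; rewrite hs.
have -> : @Q F (rescale c B) ((act B - invmx (act B)) ^+ (lr l).-1 *m v) v =
    c * @Q F B ((act B - invmx (act B)) ^+ (lr l).-1 *m v) v.
  by rewrite /Q /= -scalemxAr -scalemxAl mxE.
rewrite issqM // ?(negPf nc); first by case: issq.
case/pmoneP: pf => e e2 ef; rewrite ef in hv Pf.
have Mr : (act B - e%:M) ^+ lr l = 0 by rewrite -pm_XsubC (cyclic_kill hv).
rewrite (skew_top gB e2) ?Mr ?mul0mx //.
by rewrite mulf_neq0 ?oppr_eq0 ?expf_neq0 ?two_neq0 // cyclic_top_neq0.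
Qed.

Definition wfl l : Prop := [/\ in_Phis (lf l), (0 < lr l)%N &
  ls l || (pmone (lf l) && ~~ odd (lr l))].

Lemma isblk_wfl l B : isblk l B -> wfl l.
Proof.
case=> _ Pf r0 h; split=> //; move: h; rewrite /oddl.
case: (pmone _); case: (odd _) => /=; rewrite ?orbT ?orbF //.
- by case.
- by case=> v _ ->.
- by case=> v _ ->.
Qed.

Lemma isblk_exists l : wfl l -> exists B, isblk l B.
Proof.
case: l => [[f [|r]] s] [/= Pf // _ hs].
have fr0 : f ^+ r.+1 != 0 by rewrite expf_neq0 // Phis_neq0.
have sf : (1 < size (f ^+ r.+1))%N.
  by rewrite -subn_gt0 subn1 size_exp muln_gt0 andbT -subn1 subn_gt0 Phis_size.
have [aC gC] := cmp_ann sf; set C := cmp _ in aC gC.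
have fC : pm C (f ^+ r.+1) = 0.
  by apply: mulmx_cV_eq => x; have [p ->] := gC x; rewrite mul0mx mulmxA pmCC -mulmxA (ann0 aC) mulmx0.
have uC : C \in unitmx.
  have : coprimep (f ^+ r.+1) 'X.
    by apply: coprimep_expl; rewrite coprimepX /root horner_coef0 Phis_coef0.
  case/Bezout_eq1_coprimepP => [[u v] /= /(congr1 (pm C))].
  by rewrite pmD !pmM fC mulmx0 add0r pm1 pmX => /mulmx1_unit [].
pose H := SMod (bdiag C (invmx C)^T) (block_mx 0 1%:M (- 1%:M) 0).
have gH : good H.
  split=> /=.
  - rewrite bdiag_tr /bdiag !mulmx_block !(mulmx0, mul0mx, addr0, add0r, mulmx1, mulmxN, mulNmx).
    by rewrite trmxK -trmx_mul mulVmx // trmx1.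
  - by rewrite tr_block_mx !(trmx0, linearN, trmx1) /= opp_block_mx !oppr0 trmx1 opprK.
  - apply: unit_inj => x; rewrite -[x]vsubmxK mul_block_col !mul0mx mul1mx mulNmx mul1mx.
    rewrite addr0 add0r -col_mx0 => /eq_col_mx [-> /eqP]; rewrite oppr_eq0 => /eqP ->.
    by rewrite col_mx0.
have [|||| s0 [B [A' [hB _ _]]]] := @split_block F oddF H f r 1 gH Pf.
- exact: coprimep1.
- by rewrite coefC eqxx oner_neq0.
- rewrite mulr1 bdiag_pm fC -pm_tr.
  have : pm C (rv (f ^+ r.+1)) = 0.
    by have [c _ ->] := Phis_exp_rv Pf r.+1; rewrite pmZ fC scaler0.
  rewrite pm_inv_rv // => /(inverse_mulmx_eq0 (mulVmx (pm_inj_exp _ uC))) ->.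
  by rewrite trmx0 /bdiag block_mx0.
- rewrite mulr1 bdiag_pm; apply/eqP; rewrite -[0](block_mx0) => /eq_block_mx [h _ _ _].
  have : pm C (f ^+ r) *m cv _ 1 = 0 by rewrite h mul0mx.
  move/aC; rewrite exprS -[X in _ %| X]mul1r dvdp_mul2r ?expf_neq0 ?Phis_neq0 //.
  by rewrite dvdp1 => /eqP e; have := Phis_size Pf; rewrite e.
have [_ _ /= hs0] := isblk_wfl hB.
have [e|ne] := eqVneq s s0; first by exists B; rewrite e.
have [c c0 nc] := exists_nonsq oddF.
have /andP [pf nr] : pmone f && ~~ odd r.+1.
  by move: ne hs hs0; case: (s); case: (s0).
exists (rescale c B); have := @isblk_rescale c (f, r.+1, s0) B c0 nc pf nr hB.
by rewrite /flip /=; move: ne; case: (s); case: (s0).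
Qed.

Definition blk l : smod F :=
  if pselect (exists B, isblk l B) is left h then projT1 (cid h) else smod0 F.

Lemma blkP l : wfl l -> isblk l (blk l).
Proof.
move=> /isblk_exists h; rewrite /blk; case: pselect => [h'|//].
by case: (cid h').
Qed.

Definition model L : smod F := foldr (fun l A => dsum (blk l) A) (smod0 F) L.
Definition wfL L := forall l, l \in L -> wfl l.

Lemma wfL_cons l L : wfL (l :: L) <-> wfl l /\ wfL L.
Proof.
split=> [h|[h1 h2] x]; last by rewrite inE => /orP [/eqP ->|/h2].
by split=> [|x hx]; apply: h; rewrite inE ?eqxx ?hx ?orbT.
Qed.

Lemma good_smod0 : good (smod0 F).
Proof.
split=> /=.
- by apply/matrixP => -[].
- by apply/matrixP => -[].
- by rewrite unitmxE det_mx00 unitr1.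
Qed.

Lemma good_model L : wfL L -> good (model L).
Proof.
elim: L => [_|l L IHL /wfL_cons [h1 h2]]; first exact: good_smod0.
by apply/good_dsum; split; [case: (blkP h1) | apply: IHL].
Qed.

Lemma dm_model L : wfL L -> dm (model L) = (\sum_(l <- L) wt l)%N.
Proof.
elim: L => [_|l L IHL /wfL_cons [h1 h2]]; first by rewrite big_nil.
by rewrite big_cons /= (isblk_dim (blkP h1)) IHL.
Qed.

Lemma iso0 A : dm A = 0%N -> iso A (smod0 F).
Proof.
case: A => d U J /= e; subst d; exists 1%:M, 1%:M => /=.
by split; apply/matrixP => -[].
Qed.

Lemma irreducible_factor p : (1 < size p)%N -> exists2 g, irreducible_poly g & g %| p.
Proof.
have [n hn] := ubnP (size p); elim: n p hn => // n IHn p hn sp.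
case: (pselect (irreducible_poly p)) => [|nirr]; first by exists p.
have [q [sq qp nq]] : exists q, [/\ size q != 1, q %| p & ~~ (q %= p)].
  apply: contrapT => h; apply: nirr; split=> // q sq qp; apply: contraT => nq.
  by case: h; exists q.
have p0 : p != 0 by rewrite -size_poly_gt0 ltnW.
have q0 : q != 0 by apply: contraNneq p0 => e; move: qp; rewrite e dvd0p.
have sqp : (size q < size p)%N by rewrite ltn_neqAle dvdp_size_eqp ?nq ?dvdp_leq.
have [||g ig gq] := IHn q; first by apply: leq_trans sqp _.
  by move: sq q0; rewrite -size_poly_gt0; case: (size q) => [|[]].
by exists g => //; apply: dvdp_trans qp.
Qed.

Lemma coprime_part f p : p != 0 -> exists R m,
  [/\ p %| f ^+ R * m, coprimep f m & m %| p].
Proof.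
have [n hn] := ubnP (size p); elim: n p hn => // n IHn p hn p0.
case: (boolP (coprimep f p)) => cop; first by exists 0%N, p; rewrite expr0 mul1r.
pose d := gcdp f p; have dp : d %| p := dvdp_gcdr _ _.
have d0 : d != 0 by rewrite gcdp_eq0 negb_and p0 orbT.
have sd : (1 < size d)%N.
  move: cop; rewrite coprimep_def -/d; move: d0; rewrite -size_poly_gt0.
  by case: (size d) => [|[]].
have ep : p = p %/ d * d by rewrite divpK.
have q0 : p %/ d != 0 by apply: contraNneq p0 => e; rewrite ep e mul0r.
have [||R [m [h1 h2 h3]]] := IHn (p %/ d) => //.
  have sz : size p = size ((p %/ d) * d)%R by rewrite -ep.
  move: hn; rewrite ltnS; apply: leq_trans; rewrite sz size_mul //.
  move: sd q0; rewrite -size_poly_gt0; case: (size d) => [|[|k]] // _.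
  by case: (size (p %/ d)) => //= j _; rewrite addnS /= ltnS addnS ltnS leq_addr.
exists R.+1, m; split=> //; last by rewrite ep dvdp_mulr.
by rewrite ep mulrC exprS -mulrA dvdp_mul // dvdp_gcdl.
Qed.

Lemma exact_part A : good A -> (0 < dm A)%N -> exists f r m,
  [/\ in_Phis f, coprimep f m, m`_0 != 0, pm (act A) (f ^+ r.+1 * m) = 0
    & pm (act A) (f ^+ r * m) != 0].
Proof.
move=> gA dA; set U := act A; have uU : U \in unitmx := good_act_unit gA.
have [k ek] := unitmx_finite_order uU.
pose P0 : {poly F} := 'X^(k.+1) - 1.
have kP0 : pm U P0 = 0 by rewrite /P0 pmB pmXn pm1 ek subrr.
have P00 : P0`_0 != 0 by rewrite coefB coefXn coefC /= sub0r oppr_eq0 oner_neq0.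
have P0n : P0 != 0 by apply: contraNneq P00 => ->; rewrite coef0.
have one0 : (1%:M : 'M[F]_(dm A)) != 0.
  apply/eqP => /matrixP/(_ (Ordinal dA) (Ordinal dA))/eqP.
  by rewrite !mxE eqxx oner_eq0.
have exn : exists n, `[< exists p, [/\ p != 0, pm U p = 0 & size p = n] >].
  by exists (size P0); apply/asboolP; exists P0.
case: (ex_minnP exn) => n /asboolP [p [p0 kp sp]] minp.
have divp q : pm U q = 0 -> p %| q.
  move=> kq; apply: contraT; rewrite /dvdp => nz.
  have : (n <= size (q %% p)%R)%N.
    apply: minp; apply/asboolP; exists (q %% p); split=> //.
    have := kq; rewrite {1}(divp_eq q p) pmD pmM kp mulmx0 add0r //.
  by rewrite -sp leqNgt ltn_modp p0.
have sp1 : (1 < size p)%N.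
  rewrite ltnNge; apply/negP => /size1_polyC ep; move: kp p0; rewrite ep pmC.
  rewrite -scalemx1 => /eqP; rewrite scaler_eq0 (negPf one0) orbF => /eqP ->.
  by rewrite eqxx.
have [g0 ig g0p] := irreducible_factor sp1.
pose g := (lead_coef g0)^-1 *: g0.
have l0 : (lead_coef g0)^-1 != 0 by rewrite invr_eq0 lead_coef_eq0 irredp_neq0.
have gp : g %| p by rewrite dvdpZl.
have Pg : in_Phi g.
  split.
  - by rewrite monicE lead_coefZ mulVf // lead_coef_eq0 irredp_neq0.
  - split; first by rewrite size_scale //; case: ig.
    move=> q sq; rewrite dvdpZr // => /(ig.2 q sq) h.
    by rewrite (eqp_trans h) // eqp_sym eqp_scale.
  - apply/eqP => eX; have : 'X %| P0 by rewrite -eX (dvdp_trans gp) // divp.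
    rewrite -['X]subr0 -polyC0 dvdp_XsubCl /root horner_coef0.
    by rewrite (negPf P00).
pose f := self_dual_of g; have Pf : in_Phis f by exists g.
have gf : g %| f by rewrite self_dual_dvd // eqxx.
have exr : exists r, `[< exists m, [/\ coprimep f m, m`_0 != 0 & pm U (f ^+ r * m) = 0] >].
  have [R [m [h1 h2 h3]]] := coprime_part f P0n; exists R; apply/asboolP; exists m.
  split=> //; first by apply: contraNneq P00 => m0; case/dvdpP: h3 => q ->; rewrite coef0M m0 mulr0.
  by case/dvdpP: h1 => q ->; rewrite pmM kP0 mulmx0.
case: (ex_minnP exr) => -[|r] /asboolP [m [cm m0 km]] minr.
  exfalso; move: km; rewrite expr0 mul1r => /divp pm'.
  have : g %| 1.
    by case/Bezout_eq1_coprimepP: cm => [[u v] /= <-]; rewrite dvdp_add ?dvdp_mull //;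
      apply: dvdp_trans pm'.
  by rewrite dvdp1 => /eqP e; have := Phi_size Pg; rewrite e.
exists f, r, m; split=> //; apply/eqP => h.
have : (r < r)%N by apply: minr; apply/asboolP; exists m.
by rewrite ltnn.
Qed.

(** Every isometry group element is an orthogonal sum of blocks. *)
Lemma normal_form A : good A -> exists2 L, wfL L & iso A (model L).
Proof.
have [n hn] := ubnP (dm A); elim: n A hn => // n IHn A hn gA.
case: (posnP (dm A)) => [d0|dA]; first by exists [::] => //; apply: iso0.
have [f [r [m [Pf cm m0 k1 k0]]]] := exact_part gA dA.
have [s [B [A' [hB gA' iA]]]] := split_block oddF gA Pf cm m0 k1 k0.
have wB := isblk_wfl hB.
have dAB := iso_dim iA; rewrite /= (isblk_dim hB) in dAB.
have [|//|L wL iL] := IHn A'.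
  have := wt_gt0 (l := (f, r.+1, s)) Pf isT; move: hn; rewrite dAB; lia.
exists ((f, r.+1, s) :: L); first by apply/wfL_cons.
apply: iso_trans iA _; apply: iso_dsum iL.
have hB' := blkP wB; exact: (isblk_unique oddF hB hB').
Qed.

End NormalForm.

Section Invariants.
Variable F : finFieldType.
Hypothesis oddF : odd #|F|.
Implicit Types (A B : smod F) (l : label F) (f g p q : {poly F}) (L : seq (label F)).

Lemma model_mem l L : l \in L -> iso (model L) (dsum (blk l) (model (rem l L))).
Proof.
elim: L => //= l' L IHL; rewrite inE; case: eqVneq => [-> _|ne /= lL].
  exact: iso_refl.
apply: iso_trans (dsum_swap _ _ _); apply: iso_dsum; first exact: iso_refl.
exact: IHL.
Qed.

(** B + B is isometric to c B + c B, because c is a sum of two squares. *)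
Lemma rescale2 c B C : c != 0 ->
  iso (dsum B (dsum B C)) (dsum (rescale c B) (dsum (rescale c B) C)).
Proof.
move=> c0; have [x [y ec]] := sum_two_squares oddF c0.
pose R (a b : F) : 'M[F]_(dm B + (dm B + dm C)) :=
  block_mx a%:M (row_mx (- b)%:M 0) (col_mx b%:M 0) (block_mx a%:M 0 0 1%:M).
pose D (Y : 'M[F]_(dm B)) (Z : 'M[F]_(dm C)) : 'M[F]_(dm B + (dm B + dm C)) :=
  block_mx Y 0 0 (block_mx Y 0 0 Z).
have RDR a b a' b' t Y Z : a * a' - b * b' = t -> a * b' + b * a' = 0 ->
    R a b *m D Y Z *m R a' b' = D (t *: Y) Z.
  move=> h1 h2; rewrite /R /D; do ![rewrite !(mulmx_block, mul_row_block, mul_row_col,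
    mul_col_row, mul_block_col, mul_col_mx, mul_mx_row, mulmx0, mul0mx, addr0, add0r,
    mulmx1, mul1mx, row_mx0, col_mx0, mul_mx_scalar, mul_scalar_mx, scalerA)].
  have -> : col_mx (row_mx ((- b' * b) *: Y) 0) 0 =
      block_mx ((- b' * b) *: Y) 0 0 0 :> 'M_(dm B + dm C) by rewrite block_mxEv row_mx0.
  rewrite add_row_mx add_block_mx scale_col_mx add_col_mx !scaler0 !(addr0, add0r).
  rewrite scalerA -!scalerDl.
  have -> : a' * a + b' * - b = t by rewrite -h1; ring.
  have -> : - b' * a + a' * - b = 0 by rewrite -[RHS]oppr0 -h2; ring.
  have -> : a' * b + b' * a = 0 by rewrite -h2; ring.
  have -> : - b' * b + a' * a = t by rewrite -h1; ring.
  by rewrite scale0r row_mx0 col_mx0.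
have D1 : D 1%:M 1%:M = 1%:M by rewrite /D -!scalar_mx_block.
have xy : x * x + y * y = c by rewrite ec; ring.
have cc : c * c^-1 = 1 by rewrite divff.
have e1 : x / c * x - y / c * - y = 1.
  by transitivity ((x * x + y * y) / c); [ring | rewrite xy].
have e2 : x / c * - y + y / c * x = 0 by ring.
have e3 : x * (x / c) - (- y) * (y / c) = 1 by rewrite -e1; ring.
have e4 : x * (y / c) + - y * (x / c) = 0 by ring.
have e5 : x / c * (x / c) - (- (y / c)) * (y / c) = c^-1.
  by transitivity ((x * x + y * y) / c / c); [ring | rewrite xy cc mul1r].
have e6 : x / c * (y / c) + - (y / c) * (x / c) = 0 by ring.
have P1 : R x (- y) *m R (x / c) (y / c) = 1%:M.
  by rewrite -D1 -[R x _]mulmx1 -D1 (RDR _ _ _ _ _ _ _ e3 e4) scale1r.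
have P2 : R (x / c) (y / c) *m R x (- y) = 1%:M.
  by rewrite -D1 -[R (x / c) _]mulmx1 -D1 (RDR _ _ _ _ _ _ _ e1 e2) scale1r.
have RT a b : (R a b)^T = R a (- b).
  rewrite /R !(tr_block_mx, tr_row_mx, tr_col_mx, trmx0, tr_scalar_mx) opprK //.
exists (R (x / c) (y / c)), (R x (- y)); split=> //.
- have := RDR _ _ _ _ _ (act B) (act C) e1 e2; rewrite scale1r => h.
  by rewrite -[LHS]mulmx1 -P1 mulmxA /= -/(D _ _) h.
- rewrite RT /= -!/(D _ _) (RDR _ _ _ _ _ _ _ e5 e6) scalerA mulrC cc scale1r //.
Qed.

Definition atl f r : pred (label F) := fun l => (lf l == f) && (lr l == r).
Definition cnt L f r : nat := \sum_(l <- L | atl f r l) mul l.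
Definition sgn L f r : bool := \big[addb/false]_(l <- L | atl f r l) ~~ ls l.

Lemma cnt_cons l L f r : cnt (l :: L) f r = ((if atl f r l then mul l else 0) + cnt L f r)%N.
Proof. by rewrite /cnt big_cons; case: ifP. Qed.

Lemma sgn_cons l L f r : sgn (l :: L) f r = (if atl f r l then ~~ ls l else false) (+) sgn L f r.
Proof. by rewrite /sgn big_cons; case: ifP. Qed.

Lemma cnt_rem l L f r : l \in L -> cnt L f r = cnt (l :: rem l L) f r.
Proof. by move=> /perm_to_rem h; apply: perm_big. Qed.

Lemma sgn_rem l L f r : l \in L -> sgn L f r = sgn (l :: rem l L) f r.
Proof. by move=> /perm_to_rem h; apply: perm_big. Qed.

Lemma mul_gt0 l : (0 < mul l)%N. Proof. by rewrite /mul; case: ifP. Qed.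

Lemma cnt_gt0 L f r : (0 < cnt L f r)%N = has (atl f r) L.
Proof.
elim: L => [|l L IHL]; first by rewrite /cnt big_nil.
by rewrite cnt_cons addn_gt0 IHL /=; case: ifP => //; rewrite mul_gt0.
Qed.

Lemma sgn_no L f r : ~~ has (atl f r) L -> sgn L f r = false.
Proof.
move=> h; rewrite /sgn big_seq_cond big1 // => l /andP [lL at_l].
by case/hasP: h; exists l.
Qed.

Lemma wfL_rem l L : wfL L -> wfL (rem l L).
Proof. by move=> h x /mem_rem; apply: h. Qed.

Lemma same_invariants_iso L L' : wfL L -> wfL L' ->
  (forall f r, cnt L f r = cnt L' f r) -> (forall f r, sgn L f r = sgn L' f r) ->
  iso (model L) (model L').
Proof.
elim: L L' => [|l L IHL] L' wL wL' hc hs.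
  case: L' wL' hc {hs} => [|l' L'] _ hc; first exact: iso_refl.
  have := hc (lf l') (lr l'); rewrite /cnt big_nil big_cons /atl !eqxx /=.
  by have := mul_gt0 l'; lia.
have [wl wL1] := (wfL_cons l L).1 wL.
have main L2 : wfL L2 -> (forall f r, cnt (l :: L) f r = cnt L2 f r) ->
    (forall f r, sgn (l :: L) f r = sgn L2 f r) -> l \in L2 -> iso (model (l :: L)) (model L2).
  move=> wL2 c2 s2 lL2; apply: iso_trans (iso_sym (model_mem lL2)).
  apply: iso_dsum; first exact: iso_refl.
  apply: IHL => // [|f r|f r]; first exact: wfL_rem.
    by have := c2 f r; rewrite (cnt_rem _ _ lL2) !cnt_cons => /addnI.
  by have := s2 f r; rewrite (sgn_rem _ _ lL2) !sgn_cons => /addbI.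
case: (boolP (l \in L')) => lL'; first exact: main.
have : has (atl (lf l) (lr l)) L'.
  rewrite -cnt_gt0 -hc cnt_cons /atl !eqxx /=.
  by rewrite addn_gt0 mul_gt0.
case/hasP => l' l'L' /andP [/eqP ef /eqP er].
have nl : l' != l by apply: contraNneq lL' => <-.
have wl' := wL' _ l'L'.
have eflip : l' = flip l.
  move: nl ef er; case: (l) => -[f r] s; case: l' {wl' l'L'} => -[f' r'] s' /= nl ef er.
  by subst; move: nl; rewrite /flip /= xpair_eqE eqxx /=; case: (s); case: (s').
have [pf nr] : pmone (lf l) /\ ~~ odd (lr l).
  apply/andP; move: wl wl'; rewrite eflip => -[_ _ /= h1] [_ _ /= h2].
  by move: h1 h2; case: (ls l) => /= [_|]; rewrite ?orbF.
have [c c0 nc] := exists_nonsq oddF.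
have Bflip : iso (rescale c (blk l')) (blk l).
  have := isblk_rescale oddF c0 nc _ _ (blkP oddF wl').
  rewrite ef er => /(_ pf nr) h; apply: (isblk_unique oddF h).
  have -> : flip l' = l by rewrite eflip /flip /= negbK; case: (l) => -[].
  exact: blkP.
case: (boolP (l' \in rem l' L')) => l'R.
  pose R := rem l' (rem l' L').
  have wR : wfL R by do 2!apply: wfL_rem.
  apply: (@iso_trans _ (model [:: l, l & R])).
    apply: main; rewrite ?inE ?eqxx //; first by apply/wfL_cons; split=> //; apply/wfL_cons.
      move=> f r; rewrite hc (cnt_rem _ _ l'L') cnt_cons (cnt_rem _ _ l'R) !cnt_cons.
      by rewrite /atl /mul /oddl ef er.
    move=> f r; rewrite hs (sgn_rem _ _ l'L') sgn_cons (sgn_rem _ _ l'R) !sgn_cons.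
    have -> : ls l' = ~~ ls l by rewrite eflip.
    by rewrite /atl ef er -/R; case: ifP => // _; case: (ls l); case: (sgn _ _ _).
  apply: iso_sym; apply: iso_trans (model_mem l'L') _.
  apply: (@iso_trans _ (dsum (blk l') (dsum (blk l') (model R)))).
    by apply: iso_dsum; [exact: iso_refl | exact: model_mem].
  apply: iso_trans (rescale2 (blk l') (model R) c0) _.
  by do 2!apply: iso_dsum => //; exact: iso_refl.
have noR : ~~ has (atl (lf l) (lr l)) (rem l' L').
  apply/hasPn => x xR; apply/negP => /andP [/eqP xf /eqP xr].
  have : (x == l) || (x == l').
    rewrite eflip; move: xf xr; case: (x) => -[fx rx] sx; case: (l) => -[f r] s /= -> ->.
    by rewrite /flip /= !xpair_eqE !eqxx /=; case: (sx); case: (s).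
  case/orP => /eqP ex; subst x; last by rewrite xR in l'R.
  by rewrite (mem_rem xR) in lL'.
have c0' : cnt (rem l' L') (lf l) (lr l) = 0%N.
  by apply/eqP; rewrite -leqn0 leqNgt cnt_gt0.
have noL : ~~ has (atl (lf l) (lr l)) L.
  rewrite -cnt_gt0 -leqNgt leqn0; apply/eqP.
  have := hc (lf l) (lr l); rewrite (cnt_rem _ _ l'L') !cnt_cons c0' /atl ef er !eqxx /=.
  have -> : mul l' = mul l by rewrite /mul /oddl ef er.
  by move/addnI.
have := hs (lf l) (lr l); rewrite (sgn_rem _ _ l'L') !sgn_cons !sgn_no // /atl ef er !eqxx /=.
by rewrite eflip /=; case: (ls l).
Qed.

End Invariants.

(** * Labels and symplectic functions *)

Section Partitions.
Implicit Types (s t : seq nat).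

Lemma perm_count s t : (forall r, count_mem r s = count_mem r t) -> perm_eq s t.
Proof. by move=> h; rewrite /perm_eq; apply/allP => r _ /=; rewrite h. Qed.

Lemma geq_trans : transitive geq.
Proof. by move=> a b c /= h1 h2; apply: leq_trans h2 h1. Qed.

Lemma geq_anti : antisymmetric geq.
Proof. by move=> a b /= h; apply/eqP; rewrite eqn_leq andbC. Qed.

Lemma partition_ext s t : is_partition s -> is_partition t ->
  (forall r, count_mem r s = count_mem r t) -> s = t.
Proof.
move=> /andP [hs _] /andP [ht _] h.
by apply: (sorted_eq geq_trans geq_anti hs ht); apply: perm_count.
Qed.

End Partitions.

Section Labels.
Variable F : finFieldType.
Hypothesis oddF : odd #|F|.
Implicit Types (l : label F) (f : {poly F}) (L : seq (label F)) (x y : sfun F).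

Lemma Xm1_neq_Xp1 : 'X - 1 != 'X + 1 :> {poly F}.
Proof.
rewrite -subr_eq0 opprD addrACA subrr add0r -opprD oppr_eq0 -[1]/(1%:P) -polyCD polyC_eq0.
exact: two_neq0.
Qed.

Lemma symp_ext x y : is_symplectic_function x -> is_symplectic_function y ->
  (forall f r, count_mem r (sf_part x f) = count_mem r (sf_part y f)) ->
  (forall i, ~~ odd i -> i \in sf_part x ('X - 1) -> sf_minus x i = sf_minus y i) ->
  (forall i, ~~ odd i -> i \in sf_part x ('X + 1) -> sf_plus x i = sf_plus y i) ->
  x = y.
Proof.
case: x y => [px hpx hmx] [py hpy hmy]
  [_ /= p1 [[_ /= m1] /= m2] [[_ /= k1] /= k2]]
  [_ /= p1' [[_ /= m1'] /= m2'] [[_ /= k1'] /= k2']] /= hc hm hp.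
have epart : px = py by apply/fsfunP => f; apply: partition_ext.
subst py; congr SFun; apply/fsfunP => i.
  have := k1 i; have := k1' i; case: (boolP (i \in _)) => [hi _ _|_ -> -> //].
  case: (boolP (odd i)) => oi; last exact: hp.
  by rewrite (k2 i oi hi).2 (k2' i oi hi).2.
have := m1 i; have := m1' i; case: (boolP (i \in _)) => [hi _ _|_ -> -> //].
case: (boolP (odd i)) => oi; last exact: hm.
by rewrite (m2 i oi hi).2 (m2' i oi hi).2.
Qed.

Definition sg (b : bool) : int := if b then -1 else 1.

Definition typ L x : Prop :=
  [/\ is_symplectic_function x,
    forall f r, count_mem r (sf_part x f) = cnt L f r,
    forall i, ~~ odd i -> i \in sf_part x ('X - 1) -> sf_minus x i = sg (sgn L ('X - 1) i)
  & forall i, ~~ odd i -> i \in sf_part x ('X + 1) -> sf_plus x i = sg (sgn L ('X + 1) i)].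

Lemma typ_unique L x y : typ L x -> typ L y -> x = y.
Proof.
case=> sx cx mx px [sy cy my py]; apply: symp_ext => // [f r|i oi hi|i oi hi].
- by rewrite cx cy.
- by rewrite mx // my // -has_pred1 has_count cy -cx -has_count has_pred1.
- by rewrite px // py // -has_pred1 has_count cy -cx -has_count has_pred1.
Qed.

Lemma sg_inj : injective sg. Proof. by move=> [] []. Qed.

Lemma sgn_trivial L f r : wfL L -> ~~ (pmone f && ~~ odd r) -> sgn L f r = false.
Proof.
move=> wL h; rewrite /sgn big_seq_cond big1 // => l /andP [lL /andP [/eqP ef /eqP er]].
have [_ _] := wL _ lL; rewrite ef er (negPf h) orbF => -> //.
Qed.

Lemma mem_part L x f r : typ L x -> (r \in sf_part x f) = has (atl f r) L.
Proof. by case=> _ c _ _; rewrite -has_pred1 has_count c cnt_gt0. Qed.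

Lemma typ_sgn L L' x : wfL L -> wfL L' -> typ L x -> typ L' x ->
  forall f r, sgn L f r = sgn L' f r.
Proof.
move=> wL wL' tL tL' f r.
case: (boolP (pmone f && ~~ odd r)) => [/andP [pf nr]|h]; last by rewrite !sgn_trivial.
case: (boolP (r \in sf_part x f)) => hr; last first.
  by rewrite !sgn_no // -?(mem_part _ _ tL) -?(mem_part _ _ tL').
apply: sg_inj; case: tL => _ _ m p; case: tL' => _ _ m' p'.
by case/orP: pf hr => /eqP -> hr; rewrite -?m -?m' -?p -?p'.
Qed.

Lemma typ_iso L L' x : wfL L -> wfL L' -> typ L x -> typ L' x ->
  iso (model L) (model L').
Proof.
move=> wL wL' tL tL'; apply: same_invariants_iso => //; last exact: typ_sgn tL tL'.
by move=> f r; case: tL => _ <- _ _; case: tL'.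
Qed.

Definition exps L f : seq nat := flatten [seq nseq (mul l) (lr l) | l <- L & lf l == f].

Lemma count_exps L f r : count_mem r (exps L f) = cnt L f r.
Proof.
rewrite /exps; elim: L => [|l L IHL]; first by rewrite /cnt big_nil.
rewrite /= cnt_cons /atl; case: eqP => _ //=; rewrite count_cat IHL count_nseq /=.
by case: eqP => _; rewrite ?mul1n ?mul0n.
Qed.

Lemma odd_cnt L f r : wfL L -> pmone f -> odd r -> ~~ odd (cnt L f r).
Proof.
move=> wL pf or; rewrite /cnt; apply: (big_ind (fun n => ~~ odd n)) => //.
  by move=> a b ha hb; rewrite oddD (negPf ha) (negPf hb).
by move=> l /andP [/eqP ef /eqP er]; rewrite /mul /oddl ef er pf or.
Qed.

Lemma typ_exists L : wfL L -> exists x, typ L x.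
Proof.
move=> wL.
pose part := [fsfun f in [fset lf l | l in L]%fset => sort geq (exps L f) | [::]].
have partE f : part f = sort geq (exps L f).
  rewrite fsfun_fun; case: ifP => // /negP h; apply/esym.
  suff -> : exps L f = [::] by [].
  rewrite /exps (_ : [seq l <- L | lf l == f] = [::]) //.
  apply/eqP; rewrite -[_ == _]negbK -has_filter; apply/negP => /hasP [l lL /eqP e].
  by apply: h; rewrite -e; apply/imfsetP; exists l.
have cpart f r : count_mem r (part f) = cnt L f r.
  rewrite partE -count_exps; have /seq.permP := permEl (perm_sort geq (exps L f)).
  by apply.
have mpart f r : (r \in part f) = has (atl f r) L.
  by rewrite -has_pred1 has_count cpart cnt_gt0.
pose h e : {fsfun nat -> int with 0} :=
  [fsfun i in [fset i | i in part e]%fset => if odd i then -1 else sg (sgn L e i) | 0].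
have hE e i : h e i = if i \in part e then if odd i then -1 else sg (sgn L e i) else 0.
  by rewrite fsfun_fun; congr (if _ then _ else _); rewrite !inE.
have ppart f : is_partition (part f).
  apply/andP; split; first by rewrite partE; apply: sort_sorted => a b; apply: leq_total.
  rewrite mpart; apply/hasPn => l lL; apply/negP => /andP [_ /eqP e].
  by have [_] := wL _ lL; rewrite e.
have hsp e : pmone e -> is_symplectic_partition (part e) (h e).
  move=> pe; split; first split=> // i.
    rewrite !hE; case: (i \in part e) => //; case: (odd i); first by right.
    by case: (sgn _ _ _); [right | left].
  move=> i oi hi; rewrite hE hi oi cpart odd_cnt //.
exists (SFun part (h ('X + 1)) (h ('X - 1))); split => //=.
- split=> //=.
  + move=> f; rewrite -size_eq0 -lt0n; case E : (part f) => [|r s] // _.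
    have : r \in part f by rewrite E inE eqxx.
    rewrite mpart => /hasP [l lL /andP [/eqP <- _]]; by have [] := wL _ lL.
  + by apply: hsp; rewrite /pmone eqxx.
  + by apply: hsp; rewrite /pmone eqxx orbT.
- by move=> i ni hi; rewrite hE hi (negPf ni).
- by move=> i ni hi; rewrite hE hi (negPf ni).
Qed.

Definition lab x f r : seq (label F) :=
  let m := count_mem r (sf_part x f) in
  let h := if f == 'X - 1 then sf_minus x else sf_plus x in
  if pmone f && odd r then nseq m./2 (f, r, true)
  else (f, r, ~~ (pmone f && (h r == -1))) :: nseq m.-1 (f, r, true).

Lemma cnt_cat L L' f r : cnt (L ++ L') f r = (cnt L f r + cnt L' f r)%N.
Proof. by rewrite /cnt big_cat. Qed.

Lemma sgn_cat L L' f r : sgn (L ++ L') f r = sgn L f r (+) sgn L' f r.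
Proof. by rewrite /sgn big_cat. Qed.

Lemma cnt_nseq n l f r : cnt (nseq n l) f r = (if atl f r l then n * mul l else 0)%N.
Proof.
elim: n => [|n IHn]; first by rewrite /cnt big_nil; case: ifP.
by rewrite /= cnt_cons IHn; case: ifP.
Qed.

Lemma sgn_nseq n f r f' r' : sgn (nseq n (f', r', true)) f r = false.
Proof.
elim: n => [|n IHn]; first by rewrite /sgn big_nil.
by rewrite /= sgn_cons IHn; case: ifP.
Qed.

Lemma cnt_lab x f r f' r' : is_symplectic_function x -> r \in sf_part x f ->
  cnt (lab x f r) f' r' =
  if (f == f') && (r == r') then count_mem r (sf_part x f) else 0%N.
Proof.
move=> [_ _ [_ sm] [_ sp]] hr; rewrite /lab.
have c0 : (0 < count_mem r (sf_part x f))%N by rewrite -has_count has_pred1.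
case: ifP => hp.
  rewrite cnt_nseq /atl /= /mul /oddl /= hp muln2.
  case: ifP => // _; apply: etrans (odd_double_half _).
  rewrite (_ : odd _ = false) //; apply/negbTE.
  by case/andP: hp => /orP [/eqP ef|/eqP ef] or; rewrite ef in hr *; [case: (sm r)|case: (sp r)].
rewrite cnt_cons cnt_nseq /atl /= /mul /oddl /= hp muln1.
by case: ifP => // _; rewrite add1n prednK.
Qed.

Lemma sgn_lab x f r f' r' : sgn (lab x f r) f' r' =
  [&& f == f', r == r', pmone f, ~~ odd r &
     (if f == 'X - 1 then sf_minus x else sf_plus x) r == -1].
Proof.
rewrite /lab; case: ifP => hp.
  rewrite sgn_nseq; case: (_ == f'); case: (_ == r') => //=.
  by case/andP: hp => -> ->.
rewrite sgn_cons sgn_nseq addbF /atl /= negbK; move: hp.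
by case: (f == f'); case: (r == r') => //=; case: (pmone f) => //=; case: (odd r).
Qed.

Definition labels x : seq (label F) :=
  flatten [seq flatten [seq lab x f r | r <- undup (sf_part x f)] | f <- finsupp (sf_part x)].

Lemma cnt_flatten (T : Type) (s : seq T) (G : T -> seq (label F)) f r :
  cnt (flatten [seq G t | t <- s]) f r = (\sum_(t <- s) cnt (G t) f r)%N.
Proof.
elim: s => [|t s IHs]; first by rewrite big_nil /cnt big_nil.
by rewrite big_cons /= cnt_cat IHs.
Qed.

Lemma sgn_flatten (T : Type) (s : seq T) (G : T -> seq (label F)) f r :
  sgn (flatten [seq G t | t <- s]) f r = \big[addb/false]_(t <- s) sgn (G t) f r.
Proof.
elim: s => [|t s IHs]; first by rewrite big_nil /sgn big_nil.
by rewrite big_cons /= sgn_cat IHs.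
Qed.

Lemma big_pick (R : Type) (idx : R) (op : Monoid.com_law idx) (T : eqType) (s : seq T)
    (t0 : T) (G : T -> R) : uniq s ->
  \big[op/idx]_(t <- s) (if t == t0 then G t else idx) = if t0 \in s then G t0 else idx.
Proof.
move=> us; case: (boolP (t0 \in s)) => h.
  rewrite (big_rem t0) //= eqxx big_seq big1 ?Monoid.mulm1 // => t.
  by rewrite mem_rem_uniq // !inE => /andP [/negPf -> _].
rewrite big_seq big1 // => t ts; case: eqP => // e; by rewrite -e ts in h.
Qed.

Lemma cnt_labels x f r : is_symplectic_function x ->
  cnt (labels x) f r = count_mem r (sf_part x f).
Proof.
move=> sx; rewrite /labels cnt_flatten.
have inner f0 : cnt (flatten [seq lab x f0 r0 | r0 <- undup (sf_part x f0)]) f r =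
    if f0 == f then count_mem r (sf_part x f0) else 0%N.
  rewrite cnt_flatten big_seq.
  rewrite (eq_bigr (fun r0 => if r0 == r then if f0 == f then count_mem r0 (sf_part x f0) else 0 else 0))%N; last first.
    move=> r0; rewrite mem_undup => h; rewrite cnt_lab //.
    by case: (_ == f); case: (_ == r).
  rewrite -big_seq big_pick ?undup_uniq // mem_undup.
  case: ifP => //; case: ifP => // _ /negbT h; apply/esym/eqP; rewrite -leqn0 leqNgt.
  by rewrite -has_count has_pred1.
rewrite (eq_bigr (fun f0 => if f0 == f then count_mem r (sf_part x f0) else 0)%N) //.
rewrite big_pick ?fset_uniq //; case: ifP => // /negbT h.
by rewrite fsfun_dflt.
Qed.

Lemma sgn_labels x f r : pmone f -> ~~ odd r -> r \in sf_part x f ->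
  sgn (labels x) f r = ((if f == 'X - 1 then sf_minus x else sf_plus x) r == -1).
Proof.
move=> pf nr hr; rewrite /labels sgn_flatten.
have inner f0 : sgn (flatten [seq lab x f0 r0 | r0 <- undup (sf_part x f0)]) f r =
    if f0 == f then ((if f0 == 'X - 1 then sf_minus x else sf_plus x) r == -1) && (r \in sf_part x f0) else false.
  rewrite sgn_flatten.
  rewrite (eq_bigr (fun r0 => if r0 == r then (f0 == f) && ((if f0 == 'X - 1 then sf_minus x else sf_plus x) r0 == -1) else false)).
    rewrite big_pick ?undup_uniq // mem_undup.
    by case: (r \in _); rewrite ?andbT ?andbF; case: (f0 == f).
  move=> r0 _; rewrite sgn_lab; case: (eqVneq r0 r) => [->|_]; last by rewrite !andbF.
  by case: (eqVneq f0 f) => [->|_] //=; rewrite pf nr.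
rewrite (eq_bigr _ (fun f0 _ => inner f0)) big_pick ?fset_uniq // hr andbT.
by rewrite (_ : f \in finsupp _) // mem_finsupp; apply: contraTneq hr => ->.
Qed.

Lemma labels_wf x : is_symplectic_function x -> wfL (labels x).
Proof.
move=> [sf sp _ _] l /flatten_mapP [f _ /flatten_mapP [r]]; rewrite mem_undup => hr hl.
have Pf : in_Phis f by apply: sf; apply: contraTneq hr => ->; rewrite in_nil.
have r0 : (0 < r)%N.
  by case: r hr {hl} => // h; have /andP [_] := sp f; rewrite h.
move: hl; rewrite /lab; case: ifP => hp.
  by rewrite mem_nseq => /andP [_ /eqP ->].
rewrite inE => /orP [/eqP -> | ]; last by rewrite mem_nseq => /andP [_ /eqP ->].
split=> //=; move: hp; case: (pmone f) => //=; case: (odd r) => //=.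
by rewrite orbT.
Qed.

Lemma typ_labels x : is_symplectic_function x -> typ (labels x) x.
Proof.
move=> sx; split=> // [f r|i ni hi|i ni hi]; first by rewrite cnt_labels.
  rewrite sgn_labels // /pmone ?eqxx //; case: sx => _ _ [[_ /(_ i)]]; rewrite hi.
  by case=> ->.
rewrite sgn_labels // /pmone ?eqxx ?orbT //; case: sx => _ _ _ [[_ /(_ i)]]; rewrite hi.
have -> : ('X + 1 == 'X - 1 :> {poly F}) = false by rewrite eq_sym (negPf Xm1_neq_Xp1).
by case=> ->.
Qed.

(** ** Weights and modifications *)

Lemma weight_supp x (S : seq {poly F}) : uniq S -> {subset finsupp (sf_part x) <= S} ->
  sf_weight x = (\sum_(f <- S) (size f).-1 * sumn (sf_part x f))%N.
Proof.
move=> uS sub; rewrite /sf_weight [RHS](bigID (mem (finsupp (sf_part x)))) /=.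
rewrite [X in (_ + X)%N]big1 ?addn0; last first.
  by move=> f h; rewrite fsfun_dflt // muln0.
rewrite -[RHS]big_filter; apply: perm_big; apply: uniq_perm; rewrite ?filter_uniq ?fset_uniq //.
by move=> f; rewrite mem_filter andbC; case: (boolP (f \in S)) => //= h; apply/negP => /sub; rewrite (negPf h).
Qed.

Lemma typ_weight L x : typ L x -> sf_weight x = (\sum_(l <- L) wt l)%N.
Proof.
move=> tL; have [_ c _ _] := tL.
have sp f : sumn (sf_part x f) = (\sum_(l <- L | lf l == f) mul l * lr l)%N.
  rewrite (@perm_sumn _ (exps L f)); last by apply: perm_count => r; rewrite c count_exps.
  rewrite /exps sumn_flatten -map_comp sumnE big_map big_filter.
  by apply: eq_bigr => l _; rewrite /= sumn_nseq mulnC.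
rewrite /sf_weight.
transitivity (\sum_(f <- finsupp (sf_part x)) \sum_(l <- L)
    if f == lf l then wt l else 0)%N.
  apply: eq_bigr => f _; rewrite sp big_distrr /= [LHS]big_mkcond.
  by apply: eq_bigr => l _; rewrite [f == _]eq_sym; case: eqP => // <-; rewrite /wt -mulnA [(lr l * _)%N]mulnC.
rewrite exchange_big /= big_seq [RHS]big_seq; apply: eq_bigr => l lL.
rewrite (eq_bigr (fun f => if f == lf l then wt l else 0)%N) // big_pick ?fset_uniq //.
rewrite mem_finsupp; case: eqP => // e; exfalso.
have : has (atl (lf l) (lr l)) L by apply/hasP; exists l; rewrite /atl ?eqxx.
by rewrite -(mem_part _ _ tL) e in_nil.
Qed.

Lemma mod_part x f : sf_part (modification x) f =
  if f == 'X - 1 then [seq i.-1 | i <- sf_part x ('X - 1) & (1 < i)%N] else sf_part x f.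
Proof. by rewrite /= fsfun_withE. Qed.

Lemma comp_part x f : sf_part (completion x) f =
  if f == 'X - 1 then [seq i.+1 | i <- sf_part x ('X - 1)] else sf_part x f.
Proof. by rewrite /= fsfun_withE. Qed.

Lemma lower_signsE h i : lower_signs h i = if i == 0%N then 0 else h i.+1.
Proof.
rewrite /lower_signs fsfun_fun; case: ifP => // /negP hi; case: eqP => // i0.
apply/esym/fsfun_dflt; apply/negP => hs; apply: hi.
by apply/imfsetP; exists i.+1.
Qed.

Lemma raise_signsE h i : raise_signs h i = if i == 0%N then 0 else h i.-1.
Proof.
rewrite /raise_signs fsfun_fun; case: i => [|i] /=.
  by case: ifP => // /imfsetP [j _].
case: ifP => // /negP hi; apply/esym/fsfun_dflt; apply/negP => hs; apply: hi.
by apply/imfsetP; exists i.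
Qed.

Lemma modification_weight x : is_symplectic_function x ->
  sf_weight x = (sf_weight (modification x) + size (sf_part x ('X - 1)%R))%N.
Proof.
move=> [_ sp _ _].
pose S : seq {poly F} := undup (('X - 1 : {poly F})%R :: finsupp (sf_part x) ++ finsupp (sf_part (modification x))).
have uS : uniq S by rewrite undup_uniq.
rewrite (@weight_supp x S) //; last by move=> f; rewrite mem_undup inE mem_cat => ->; rewrite orbT.
rewrite (@weight_supp (modification x) S) //; last first.
  by move=> f; rewrite mem_undup inE mem_cat => ->; rewrite !orbT.
have XS : 'X - 1 \in S by rewrite mem_undup inE eqxx.
have sX : size ('X - 1 : {poly F})%R = 2%N by rewrite -[1]/(1%:P) size_XsubC.
rewrite !(big_rem _ XS) /= sX !mul1n addnAC; congr (_ + _)%N.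
  rewrite fsfun_with; have /andP [_] := sp ('X - 1).
  elim: (sf_part x _) => //= i s IHs; rewrite inE negb_or => /andP [i0 /IHs ->].
  by case: i i0 => // -[|i] _ //=; lia.
rewrite big_seq [RHS]big_seq; apply: eq_bigr => f.
by rewrite mem_rem_uniq // !inE => /andP [/negPf nf _]; rewrite fsfun_withE nf.
Qed.

Lemma modification_inj x y : is_symplectic_function x -> is_symplectic_function y ->
  modification x = modification y -> sf_weight x = sf_weight y -> x = y.
Proof.
move=> sx sy e ew.
have es : size (sf_part x ('X - 1)%R) = size (sf_part y ('X - 1)%R).
  move: ew; rewrite (modification_weight sx) (modification_weight sy) e => /addnI //.
have [_ px [[_ _] mx] _] := sx; have [_ py [[_ _] my] _] := sy.
have pe f : f != 'X - 1 -> sf_part x f = sf_part y f.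
  by move=> nf; have := mod_part x f; rewrite e mod_part (negPf nf).
have c2 i : (1 < i)%N -> count_mem i (sf_part x ('X - 1)) = count_mem i (sf_part y ('X - 1)).
  move=> hi; have := mod_part x ('X - 1); rewrite e mod_part eqxx.
  move/(congr1 (count_mem i.-1)); rewrite !count_map !count_filter.
  have aux s : count (predI (preim predn (pred1 i.-1)) (fun j => (1 < j)%N)) s = count_mem i s.
    by apply: eq_count => j /=; lia.
  by rewrite !aux.
have c0 (z : sfun F) : is_symplectic_function z -> count_mem 0%N (sf_part z ('X - 1)) = 0%N.
  case=> _ pz _ _; have /andP [_] := pz ('X - 1).
  by rewrite -has_pred1 has_count -leqNgt leqn0 => /eqP.
have c f r : count_mem r (sf_part x f) = count_mem r (sf_part y f).
  have [->|nf] := eqVneq f ('X - 1); last by rewrite pe.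
  case: r => [|[|r]]; [by rewrite !c0 | | exact: c2].
  have dec (z : sfun F) : is_symplectic_function z -> size (sf_part z ('X - 1)%R) =
      (count_mem 1%N (sf_part z ('X - 1)%R) + size (sf_part (modification z) ('X - 1)%R))%N.
    move=> sz; have [_ pz _ _] := sz; have /andP [_] := pz ('X - 1).
    have := mod_part z ('X - 1); rewrite eqxx => ->; rewrite size_map size_filter.
    elim: (sf_part z _) => //= i s IHs; rewrite inE negb_or => /andP [i0 /IHs ->].
    by case: i i0 => // -[|i] _ /=; lia.
  by move: es; rewrite (dec x) // (dec y) // e => /addIn.
apply: symp_ext => // i ni hi.
  have i1 : (1 < i)%N.
    have /andP [_] := px ('X - 1); case: (i) ni hi => [|[|//]] // _ h; by rewrite h.
  have := congr1 (fun z => sf_minus z i.-1) e; rewrite /= !lower_signsE.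
  by case: i i1 {ni hi} => // -[].
by have := congr1 (fun z => sf_plus z) e => /= ->.
Qed.

Definition l1 : label F := ('X - 1, 1%N, true).

Lemma l1_wf : wfl l1.
Proof.
split=> //=; have := @Phis_XsubC F 1; rewrite polyC1; apply; exact: expr1n.
Qed.

Lemma modification_eq L L' x y : wfL L -> wfL L' -> typ L x -> typ L' y ->
  (forall f r, (f, r) != ('X - 1, 1%N) -> cnt L f r = cnt L' f r) ->
  (forall f r, (f, r) != ('X - 1, 1%N) -> sgn L f r = sgn L' f r) ->
  modification x = modification y.
Proof.
move=> wL wL' tL tL' hc hs.
have [sx cx mx ppx] := tL; have [sy cy my ppy] := tL'.
have [_ px [[_ gx] ox] [[_ gx'] ox']] := sx; have [_ py [[_ gy] oy] [[_ gy'] oy']] := sy.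
have mm f r : (f, r) != ('X - 1, 1%N) -> (r \in sf_part x f) = (r \in sf_part y f).
  by move=> h; rewrite (mem_part _ _ tL) (mem_part _ _ tL') -!cnt_gt0 hc.
have nX r : ('X + 1 : {poly F}, r) != ('X - 1, 1%N).
  by rewrite xpair_eqE eq_sym (negPf Xm1_neq_Xp1).
congr SFun; apply/fsfunP.
- move=> f; rewrite !fsfun_withE; case: eqP => [_|/eqP nf].
    congr (map predn _); apply: (sorted_eq geq_trans geq_anti).
    + by apply: sorted_filter; [exact: geq_trans | case/andP: (px ('X - 1))].
    + by apply: sorted_filter; [exact: geq_trans | case/andP: (py ('X - 1))].
    apply: perm_count => r; rewrite !count_filter.
    have aux s : count (predI (pred1 r) (fun j => 1 < j)%N) s = if (1 < r)%N then count_mem r s else 0%N.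
      case: ifP => h; first by apply: eq_count => j /=; lia.
      by rewrite -(count_pred0 s); apply: eq_count => j /=; lia.
    rewrite !aux; case: ifP => // r1; rewrite cx cy hc // xpair_eqE eqxx /=; by lia.
  by apply: partition_ext => // r; rewrite cx cy hc // xpair_eqE (negPf nf).
- move=> i; have := gx' i; have := gy' i; rewrite -(mm _ _ (nX i)).
  case: ifP => [hi _ _|_ -> -> //].
  have hi' : i \in sf_part y ('X + 1) by rewrite -mm.
  case: (boolP (odd i)) => oi; first by rewrite (ox' i oi hi).2 (oy' i oi hi').2.
  by rewrite ppx // ppy // hs.
- move=> i; rewrite !lower_signsE; case: eqP => // /eqP i0.
  have n1 : ('X - 1 : {poly F}, i.+1) != ('X - 1, 1%N) by rewrite xpair_eqE eqxx; case: (i) i0.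
  have := gx i.+1; have := gy i.+1; rewrite -(mm _ _ n1).
  case: ifP => [hi _ _|_ -> -> //].
  have hi' : i.+1 \in sf_part y ('X - 1) by rewrite -mm.
  case: (boolP (odd i.+1)) => oi; first by rewrite (ox _ oi hi).2 (oy _ oi hi').2.
  by rewrite mx // my // hs.
Qed.

Definition core L := [seq l <- L | (lf l, lr l) != ('X - 1, 1%N)].

Lemma cnt_core L f r : cnt (core L) f r = if (f, r) == ('X - 1, 1%N) then 0%N else cnt L f r.
Proof.
rewrite /cnt /core big_filter_cond; case: eqP => [[-> ->]|/eqP n].
  by rewrite big_pred0 // => l; rewrite /atl xpair_eqE; case: (_ == _); case: (_ == _).
apply: eq_bigl => l; rewrite /atl; case: (eqVneq (lf l) f) => [->|_] /=; last by rewrite andbF.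
by case: (eqVneq (lr l) r) => [->|_] /=; rewrite ?andbF // n.
Qed.

Lemma sgn_core L f r : (f, r) != ('X - 1, 1%N) -> sgn (core L) f r = sgn L f r.
Proof.
move=> n; rewrite /sgn /core big_filter_cond.
apply: eq_bigl => l; rewrite /atl; case: (eqVneq (lf l) f) => [->|_] /=; last by rewrite andbF.
by case: (eqVneq (lr l) r) => [->|_] /=; rewrite ?andbF // n.
Qed.

Lemma core_wf L : wfL L -> wfL (core L).
Proof. by move=> wL l; rewrite mem_filter => /andP [_ /wL]. Qed.

Lemma completion_typ L x : wfL L -> typ L x -> typ (core L) (completion (modification x)).
Proof.
move=> wL tL; have [sx cx mx ppx] := tL; have [sf px [[_ gx] ox] [[_ gx'] ox']] := sx.
have part f : sf_part (completion (modification x)) f =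
    if f == 'X - 1 then [seq i <- sf_part x ('X - 1) | (1 < i)%N] else sf_part x f.
  rewrite comp_part; case: ifP => nf; last by rewrite mod_part nf.
  rewrite mod_part eqxx -map_comp.
  rewrite -[RHS]map_id; apply/eq_in_map => i; rewrite mem_filter => /andP [i1 _] /=; lia.
have mns i : sf_minus (completion (modification x)) i = if (1 < i)%N then sf_minus x i else 0.
  rewrite [sf_minus _]/= raise_signsE; case: i => [|[|i]] //=; rewrite lower_signsE //.
have pls : sf_plus (completion (modification x)) = sf_plus x by [].
have pp : is_partition (sf_part (completion (modification x)) ('X - 1)).
  rewrite part eqxx; have /andP [s0 z] := px ('X - 1); apply/andP; split.
    by apply: sorted_filter => //; exact: geq_trans.
  by rewrite mem_filter.
have nX : 'X + 1 == 'X - 1 :> {poly F} = false by rewrite eq_sym (negPf Xm1_neq_Xp1).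
split.
- split.
  + move=> f; have [->|nf] := eqVneq f ('X - 1); last by rewrite part (negPf nf); apply: sf.
    move=> _.
    have := @Phis_XsubC F 1; rewrite polyC1; apply; exact: expr1n.
  + move=> f; have [->|nf] := eqVneq f ('X - 1); first exact: pp.
    by rewrite part (negPf nf).
  + split; first split=> // i.
      rewrite part eqxx mem_filter mns; case: ifP => /= [/andP [-> hi]|].
        by have := gx i; rewrite hi.
      by case: ifP => //= _ hi; have := gx i; rewrite hi.
    move=> i oi; rewrite part eqxx mem_filter mns => /andP [i1 hi]; rewrite i1 count_filter.
    have [h1 h2] := ox i oi hi; split=> //.
    rewrite (eq_count (a2 := pred1 i)) // => j /=; by case: eqP => // ->; rewrite i1.
  + by rewrite part nX pls.
- move=> f r; rewrite cnt_core part xpair_eqE -cx.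
  case: (eqVneq f) => //= ->; rewrite count_filter; case: eqP => [->|r1].
    by rewrite -(count_pred0 (sf_part x ('X - 1))); apply: eq_count => j /=; lia.
  case: r r1 => [|r] r1.
    have /andP [_ z] := px ('X - 1); rewrite -has_pred1 has_count -leqNgt leqn0 in z.
    rewrite (eqP z) -(count_pred0 (sf_part x ('X - 1))); apply: eq_count => j /=; lia.
  by apply: eq_count => j /=; lia.
- move=> i ni; rewrite part eqxx mem_filter mns => /andP [i1 hi]; rewrite i1 mx //.
  by rewrite sgn_core // xpair_eqE eqxx; case: (i) i1 => [|[]].
- move=> i ni; rewrite part nX pls => hi; rewrite ppx // sgn_core //.
  by rewrite xpair_eqE nX.
Qed.

End Labels.

(** * Generators of the primary cyclic summands *)

Section GramDet.
Variable F : fieldType.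

Definition gdet (T : nmodType) (h : T -> T -> F) (X : seq T) : F :=
  \det (\matrix_(a < size X, b < size X) h X`_a X`_b).

Lemma gdet_cat (T : nmodType) (h : T -> T -> F) (X Y : seq T) :
  (forall x y, x \in X -> y \in Y -> h x y = 0 /\ h y x = 0) ->
  gdet h (X ++ Y) = gdet h X * gdet h Y.
Proof.
move=> h0; rewrite /gdet size_cat.
have -> : \matrix_(a < size X + size Y, b < size X + size Y) h (X ++ Y)`_a (X ++ Y)`_b =
    block_mx (\matrix_(a, b) h X`_a X`_b) 0 0 (\matrix_(a, b) h Y`_a Y`_b).
  apply/matrixP => a b; rewrite mxE.
  case: (split_ordP a) => a' ->; case: (split_ordP b) => b' ->;
    rewrite ?(block_mxEul, block_mxEur, block_mxEdl, block_mxEdr) !mxE /= !nth_cat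
      ?ltn_ord ?ltnNge ?leq_addr /= ?addKn //.
  - by have [||->] := h0 X`_a' Y`_b'; rewrite ?mem_nth.
  - by have [||_ ->] := h0 X`_b' Y`_a'; rewrite ?mem_nth.
by rewrite det_ublock.
Qed.

Lemma gdet_nil (T : nmodType) (h : T -> T -> F) : gdet h [::] = 1.
Proof. by rewrite /gdet det_mx00. Qed.

Lemma gdet_seq1 (T : nmodType) (h : T -> T -> F) x : gdet h [:: x] = h x x.
Proof. by rewrite /gdet [X in \det X]mx11_scalar det_scalar1 mxE. Qed.

Lemma gdet_map (T T' : nmodType) (h : T -> T -> F) (h' : T' -> T' -> F) (g : T -> T') X :
  (forall x y, h' (g x) (g y) = h x y) -> gdet h' (map g X) = gdet h X.
Proof.
move=> e; rewrite /gdet size_map; congr (\det _); apply/matrixP => a b.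
by rewrite !mxE !(nth_map 0) ?e.
Qed.

End GramDet.

Section Generators.
Variable F : finFieldType.
Hypothesis oddF : odd #|F|.
Implicit Types (A B : smod F) (l : label F) (f g p q : {poly F}) (L : seq (label F)).

Definition skewQ A i (x y : 'cV[F]_(dm A)) : F :=
  Q ((act A - invmx (act A)) ^+ i.-1 *m x) y.

Definition gens A L (D : seq ({poly F} * nat * 'cV[F]_(dm A))) : Prop :=
  [/\ forall d, d \in D ->
        [/\ in_Phi d.1.1, (0 < d.1.2)%N & ann (act A) d.2 (d.1.1 ^+ d.1.2)],
      forall S : 'cV[F]_(dm A) -> Prop, S 0 -> (forall x y, S x -> S y -> S (x + y)) ->
        (forall d p, d \in D -> S (pm (act A) p *m d.2)) -> forall x, S x,
      (\sum_(d <- D) (size d.1.1).-1 * d.1.2)%N = dm A,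
      forall g r, in_Phi g -> count (fun d => d.1 == (g, r)) D = cnt L (self_dual_of g) r
    & forall e, e ^+ 2 = 1 ->
       (forall d d' p q, d \in D -> d' \in D -> d.1.1 = 'X - e%:P -> d'.1.1 = 'X - e%:P ->
          d.1.2 != d'.1.2 -> Q (pm (act A) p *m d.2) (pm (act A) q *m d'.2) = 0) /\
       (forall i, ~~ odd i -> (0 < i)%N ->
          let X := [seq d.2 | d <- D & d.1 == ('X - e%:P, i)] in
          gdet (@skewQ A i) X != 0 /\ issq (gdet (@skewQ A i) X) = ~~ sgn L ('X - e%:P) i)].

Arguments gens : clear implicits.

Section Embedding.
Variables (A B : smod F) (E : 'M[F]_(dm B, dm A)).
Hypotheses (gA : good A) (gB : good B) (EU : E *m act A = act B *m E).
Hypothesis (EQ : E^T *m frm B *m E = frm A).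

Lemma emb_inj k (x : 'M_(dm A, k)) : E *m x = 0 -> x = 0.
Proof.
move=> e; have [_ _ uJ] := gA; apply: (inverse_mulmx_eq0 (mulVmx uJ)).
by rewrite -EQ -(mulmxA _ E x) e mulmx0.
Qed.

Lemma emb_pm p (x : 'cV_(dm A)) : E *m (pm (act A) p *m x) = pm (act B) p *m (E *m x).
Proof. by rewrite mulmxA (pm_intertwine _ EU) mulmxA. Qed.

Lemma emb_ann v f : ann (act A) v f -> ann (act B) (E *m v) f.
Proof.
move=> h p; rewrite -emb_pm -h; split=> [|->]; last by rewrite mulmx0.
exact: emb_inj.
Qed.

Lemma emb_Q (x y : 'cV_(dm A)) : Q (E *m x) (E *m y) = Q x y.
Proof. by rewrite /Q trmx_mul -!mulmxA (mulmxA (frm B)) (mulmxA E^T) (mulmxA E^T) EQ !mulmxA. Qed.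

Lemma emb_skew i (x y : 'cV_(dm A)) : skewQ i (E *m x) (E *m y) = skewQ i x y.
Proof.
have eN : E *m (act A - invmx (act A)) = (act B - invmx (act B)) *m E.
  rewrite mulmxBr mulmxBl EU; congr (_ - _).
  apply: (can_inj (mulKmx (good_act_unit gB))).
  by rewrite mulKVmx ?good_act_unit // mulmxA -EU -mulmxA mulmxV ?good_act_unit // mulmx1.
by rewrite /skewQ mulmxA -(intertwine_exp _ eN) -mulmxA emb_Q.
Qed.

End Embedding.

Definition emb_gen A B (E : 'M[F]_(dm B, dm A)) (d : {poly F} * nat * 'cV[F]_(dm A)) :
  {poly F} * nat * 'cV[F]_(dm B) := (d.1, E *m d.2).

Lemma emb_gens_X A B (E : 'M[F]_(dm B, dm A)) (D : seq ({poly F} * nat * 'cV[F]_(dm A))) k :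
  [seq d.2 | d <- map (emb_gen E) D & d.1 == k] =
  map (mulmx E) [seq d.2 | d <- D & d.1 == k].
Proof.
rewrite filter_map -!map_comp; congr map.
Qed.

Lemma gens_iso A B L D : good A -> good B -> iso A B -> gens A L D -> exists D', gens B L D'.
Proof.
move=> gA gB [P [Pi [h1 h2 h3 h4]]] [d1 d2 d3 d4 d5].
exists (map (emb_gen P) D); split.
- move=> d /mapP [c cD ->] /=; have [p1 p2 p3] := d1 _ cD; split=> //.
  exact: (emb_ann gA h3 h4).
- move=> S S0 SD Sp x; rewrite -[x]mul1mx -h2 -mulmxA.
  apply: (d2 (fun y => S (P *m y))) => [|y z hy hz|d p dD].
  + by rewrite mulmx0.
  + by rewrite mulmxDr; apply: SD.
  + by rewrite (emb_pm h3); apply: (Sp (emb_gen P d)); apply: map_f.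
- by rewrite big_map d3 (inverse_dim h1 h2).
- by move=> g r Pg; rewrite count_map -d4.
- move=> e e2; have [o s] := d5 e e2; split.
    move=> _ _ p q /mapP [d dD ->] /mapP [d' d'D ->] /= e1 e1' nr.
    by rewrite -!(emb_pm h3) (emb_Q h4) o.
  move=> i ni i0 X; rewrite /X emb_gens_X.
  rewrite (gdet_map (h := @skewQ A i)); first exact: s.
  by move=> x y; apply: emb_skew.
Qed.

Lemma gens_dsum A B L L' D D' : good A -> good B -> gens A L D -> gens B L' D' ->
  exists E, gens (dsum A B) (L ++ L') E.
Proof.
move=> gA gB [d1 d2 d3 d4 d5] [c1 c2 c3 c4 c5].
have gAB : good (dsum A B) by apply/good_dsum.
pose I1 : 'M[F]_(dm (dsum A B), dm A) := col_mx 1%:M 0.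
pose I2 : 'M[F]_(dm (dsum A B), dm B) := col_mx 0 1%:M.
have U1 : I1 *m act A = act (dsum A B) *m I1.
  by rewrite /I1 /= /bdiag mul_col_mx mul_block_col !(mulmx0, mul0mx, mul1mx, mulmx1, addr0).
have U2 : I2 *m act B = act (dsum A B) *m I2.
  by rewrite /I2 /= /bdiag mul_col_mx mul_block_col !(mulmx0, mul0mx, mul1mx, mulmx1, add0r).
have Q1 : I1^T *m frm (dsum A B) *m I1 = frm A.
  rewrite /I1 /= /bdiag tr_col_mx mul_row_block mul_row_col.
  by rewrite !(mulmx0, mul0mx, trmx1, trmx0, mul1mx, mulmx1, addr0).
have Q2 : I2^T *m frm (dsum A B) *m I2 = frm B.
  rewrite /I2 /= /bdiag tr_col_mx mul_row_block mul_row_col.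
  by rewrite !(mulmx0, mul0mx, trmx1, trmx0, mul1mx, mulmx1, add0r).
have Q12 (x : 'cV_(dm A)) (y : 'cV_(dm B)) : @Q F (dsum A B) (I1 *m x) (I2 *m y) = 0.
  rewrite /Q trmx_mul -!mulmxA (mulmxA (frm _)) (mulmxA I1^T).
  suff -> : I1^T *m (frm (dsum A B) *m I2) = 0 by rewrite mul0mx mulmx0 mxE.
  rewrite /I1 /I2 /= /bdiag tr_col_mx mul_block_col mul_row_col.
  by rewrite !(mulmx0, mul0mx, trmx1, trmx0, addr0).
have Q21 (x : 'cV_(dm A)) (y : 'cV_(dm B)) : @Q F (dsum A B) (I2 *m y) (I1 *m x) = 0.
  by rewrite Qsym // Q12 oppr0.
have skew1 i (x : 'cV_(dm A)) (y : 'cV_(dm B)) :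
    @skewQ (dsum A B) i (I1 *m x) (I2 *m y) = 0 /\ @skewQ (dsum A B) i (I2 *m y) (I1 *m x) = 0.
  have [k ek] := inv_pm gAB.
  have eN : exists t, (act (dsum A B) - invmx (act (dsum A B))) ^+ i.-1 = pm (act (dsum A B)) t.
    exists (('X - ('X \Po 'X^k)) ^+ i.-1); rewrite pm_exp pmB -ek !pmX //.
  have [t et] := eN.
  by rewrite /skewQ et -(emb_pm U1) -(emb_pm U2) Q12 Q21.
exists (map (@emb_gen A (dsum A B) I1) D ++ map (@emb_gen B (dsum A B) I2) D'); split.
- move=> d; rewrite mem_cat => /orP [] /mapP [c cD ->] /=.
    by have [p1 p2 p3] := d1 _ cD; split=> //; apply: (emb_ann gA U1 Q1).
  by have [p1 p2 p3] := c1 _ cD; split=> //; apply: (emb_ann gB U2 Q2).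
- move=> S S0 SD Sp x.
  have -> : x = I1 *m usubmx (x : 'cV_(dm A + dm B)) + I2 *m dsubmx (x : 'cV_(dm A + dm B)).
    rewrite /I1 /I2 !mul_col_mx !mul0mx !mul1mx add_col_mx addr0 add0r.
    exact: esym (vsubmxK _).
  apply: (SD).
    apply: (d2 (fun y => S (I1 *m y))) => [|y z hy hz|d p dD].
    + by rewrite mulmx0.
    + by rewrite mulmxDr; apply: SD.
    + rewrite (emb_pm U1); apply: (Sp (@emb_gen A (dsum A B) I1 d)).
      by rewrite mem_cat map_f.
  apply: (c2 (fun y => S (I2 *m y))) => [|y z hy hz|d p dD].
  + by rewrite mulmx0.
  + by rewrite mulmxDr; apply: SD.
  + rewrite (emb_pm U2); apply: (Sp (@emb_gen B (dsum A B) I2 d)).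
    by rewrite mem_cat map_f ?orbT.
- by rewrite big_cat !big_map /= d3 c3.
- by move=> g r Pg; rewrite count_cat !count_map cnt_cat -d4 // -c4.
- move=> e e2; have [o s] := d5 e e2; have [o' s'] := c5 e e2; split.
    move=> d d' p q; rewrite !mem_cat => /orP [] /mapP [a aD ->] /orP [] /mapP [b bD ->] /= ea eb nr.
    + by rewrite -!(emb_pm U1) (emb_Q Q1) o.
    + by rewrite -(emb_pm U1) -(emb_pm U2) Q12.
    + by rewrite -(emb_pm U1) -(emb_pm U2) Q21.
    + by rewrite -!(emb_pm U2) (emb_Q Q2) o'.
  move=> i ni i0 X.
  have [n1 s1] := s i ni i0; have [n2 s2] := s' i ni i0.
  have -> : gdet (@skewQ (dsum A B) i) X =
     gdet (@skewQ A i) [seq d.2 | d <- D & d.1 == ('X - e%:P, i)] *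
     gdet (@skewQ B i) [seq d.2 | d <- D' & d.1 == ('X - e%:P, i)].
    rewrite /X filter_cat map_cat !emb_gens_X gdet_cat.
      rewrite (gdet_map (h := @skewQ A i)); last by move=> x y; apply: (emb_skew gA gAB U1 Q1).
      by rewrite (gdet_map (h := @skewQ B i)) // => x y; apply: (emb_skew gB gAB U2 Q2).
    by move=> _ _ /mapP [x _ ->] /mapP [y _ ->]; apply: skew1.
  rewrite mulf_neq0 // issqM // s1 s2 sgn_cat; split=> //.
  by case: (sgn L _ _); case: (sgn L' _ _).
Qed.

Lemma cnt1 l f r : cnt [:: l] f r = (if atl f r l then mul l else 0)%N.
Proof. by rewrite cnt_cons /cnt big_nil addn0. Qed.

Lemma sgn1 l f r : sgn [:: l] f r = (if atl f r l then ~~ ls l else false).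
Proof. by rewrite sgn_cons /sgn big_nil addbF. Qed.

Lemma issq1 : issq (1 : F).
Proof. by apply/issqP; exists 1; rewrite ?oner_neq0 ?expr1n. Qed.

Lemma gens_block l B : isblk l B -> exists D, gens B [:: l] D.
Proof.
move=> hB; have dB := isblk_dim hB; case: hB => gB Pf r0 hB.
have [g Pg cases] := PhisP Pf.
case: ifP hB => ol.
  case=> _ [v [w [gv hv]]].
  have /pmoneP [e0 e02 ef] : pmone (lf l) by case/andP: ol.
  have or : odd (lr l) by case/andP: ol.
  have efg : lf l = 'X - e0%:P := ef.
  have Pl : in_Phi (lf l) by rewrite efg; apply/Phi_XsubC/sqr1_neq0.
  have sl : self_dual_of (lf l) = lf l by rewrite efg self_dual_XsubC.
  exists [:: (l.1, v); (l.1, w)]; split.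
  - move=> d; rewrite !inE => /orP [] /eqP -> /=; split=> // p.
      have := hv p 0; rewrite pm0 mul0mx addr0 dvdp0 => ->; split=> [[]|] //.
    by have := hv 0 p; rewrite pm0 mul0mx add0r dvdp0 => ->; split=> [[]|] //.
  - move=> S S0 SD Sp x; have [p [q ->]] := gv x; apply: SD.
      by apply: (Sp (l.1, v)); rewrite inE eqxx.
    by apply: (Sp (l.1, w)); rewrite !inE eqxx orbT.
  - by rewrite !big_cons big_nil /= addn0 [RHS]dB /wt /mul ol muln2 addnn.
  - move=> g' r Pg' /=; rewrite cnt1 /atl /mul ol addn0 -sl self_dual_eq //.
    have -> : (lf l == dual_poly g') = (lf l == g').
      apply/eqP/eqP => [e1|<-]; last by rewrite efg dual_XsubC.
      by rewrite -(dualK Pg') -e1 efg dual_XsubC.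
    rewrite orbb; case: (l) => -[f' r'] s' /=; rewrite xpair_eqE.
    by case: (_ == _); case: (_ == _).
  - move=> e e2; split.
      by move=> d d' p q; rewrite !inE => /orP [] /eqP -> /orP [] /eqP -> /= _ _; rewrite eqxx.
    move=> i ni i0 X; have -> : X = [::].
      rewrite /X /=; have -> : (l.1 == ('X - e%:P, i)) = false; last by [].
      by apply/eqP => e1; move: or; rewrite e1 (negPf ni).
    rewrite gdet_nil oner_neq0 issq1 sgn1; split=> //; case: ifP => //.
    by case/andP => _ /eqP er; move: or; rewrite er (negPf ni).
case=> v [av gv] hs.
case: cases => [[ef sd]|[ef nsd cop]].
  have sdo : self_dual_of (lf l) = lf l by rewrite /self_dual_of ef sd eqxx.
  exists [:: (l.1, v)]; rewrite -ef in Pg sd; split.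
  - by move=> d; rewrite inE => /eqP ->.
  - move=> S S0 SD Sp x; have [p ->] := gv x.
    by apply: (Sp (l.1, v)); rewrite inE eqxx.
  - by rewrite big_cons big_nil addn0 [RHS]dB /wt /mul ol muln1.
  - move=> g' r Pg' /=; rewrite cnt1 /atl /mul ol addn0 -sdo self_dual_eq //.
    have -> : (lf l == dual_poly g') = (lf l == g').
      apply/eqP/eqP => [e1|<-]; last by rewrite sd.
      by rewrite -(dualK Pg') -e1 sd.
    rewrite orbb; case: (l) => -[f' r'] s' /=; rewrite xpair_eqE.
    by case: (_ == _); case: (_ == _).
  - move=> e e2; split.
      by move=> d d' p q; rewrite !inE => /eqP -> /eqP -> /= _ _; rewrite eqxx.
    move=> i ni i0 X; rewrite sgn1 /X /=.
    have -> : (l.1 == ('X - e%:P, i)) = atl ('X - e%:P) i l.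
      by case: (l) => -[f' r'] s'; rewrite /atl /= xpair_eqE.
    case: ifP => /= [/andP [/eqP efe /eqP er]|_]; last by rewrite gdet_nil oner_neq0 issq1.
    have pm_l : pmone (lf l) by rewrite efe; apply/pmoneP; exists e.
    rewrite gdet_seq1 negbK hs pm_l /skewQ er; split=> //.
    rewrite er efe in av r0.
    have hv : cyclic_block ('X - e%:P) i v by [].
    have Mr : (act B - e%:M) ^+ i = 0 by rewrite -pm_XsubC (cyclic_kill hv).
    rewrite (skew_top gB e2) ?Mr ?mul0mx //.
    by rewrite mulf_neq0 ?oppr_eq0 ?expf_neq0 ?two_neq0 // cyclic_top_neq0.
have Pd := dual_Phi Pg; set h := dual_poly g in ef nsd cop Pd.
have gh r : coprimep (g ^+ r) (h ^+ r) by apply: coprimep_expl; apply: coprimep_expr.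
have hn : h ^+ lr l != 0 by rewrite expf_neq0 // Phi_neq0.
have gn : g ^+ lr l != 0 by rewrite expf_neq0 // Phi_neq0.
have nX e : e ^+ 2 = 1 -> (g == 'X - e%:P) = false /\ (h == 'X - e%:P) = false.
  move=> e2; split; apply/eqP => e1; case/eqP: nsd.
    by rewrite /h e1 dual_XsubC.
  by rewrite -[g in RHS](dualK Pg) -/h e1 dual_XsubC.
have el : lf l ^+ lr l = g ^+ lr l * h ^+ lr l by rewrite ef exprMn.
exists [:: ((g, lr l), pm (act B) (h ^+ lr l) *m v); ((h, lr l), pm (act B) (g ^+ lr l) *m v)].
split.
- move=> d; rewrite !inE => /orP [] /eqP -> /=; split=> // p; rewrite mulmxA -pmM av el.
    by rewrite dvdp_mul2r.
  by rewrite [g ^+ _ * _]mulrC dvdp_mul2r.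
- move=> S S0 SD Sp x; have [p ->] := gv x.
  case/Bezout_eq1_coprimepP: (gh (lr l)) => [[a b] /= eab].
  rewrite -[p]mulr1 -eab mulrDr pmD mulmxDl; apply: SD; rewrite mulrA pmM -mulmxA.
    by apply: (Sp ((h, lr l), _)); rewrite !inE eqxx orbT.
  by apply: (Sp ((g, lr l), _)); rewrite !inE eqxx.
- rewrite !big_cons big_nil addn0 [RHS]dB /wt /mul ol muln1 /= -mulnDl; congr (_ * _)%N.
  rewrite ef size_mul ?Phi_neq0 // /h size_dual //.
  by move: (size g) (Phi_size Pg) => n; lia.
- move=> g' r Pg' /=; rewrite cnt1 /atl /mul ol addn0 !xpair_eqE.
  have -> : lf l = self_dual_of g by rewrite /self_dual_of -/h (negPf nsd).
  rewrite self_dual_eq //.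
  have -> : (g == dual_poly g') = (h == g').
    by apply/eqP/eqP => [e1|e1]; [rewrite /h e1 dualK | rewrite -e1 /h dualK].
  case: (eqVneq g g') => [<-|_]; first by rewrite (negPf nsd) /= addn0; case: (lr l == r).
  by rewrite /=; case: (h == g'); case: (lr l == r).
- move=> e e2; have [ng nh] := nX e e2; split.
    move=> d d' p q; rewrite !inE => /orP [] /eqP -> _ /= /eqP; rewrite ?ng ?nh //.
  move=> i ni i0 X; have -> : X = [::] by rewrite /X /= !xpair_eqE ng nh.
  rewrite gdet_nil oner_neq0 issq1 sgn1; split=> //; case: ifP => //.
  case/andP => /eqP e1; exfalso; have := Phis_XsubC e2 => _.
  have : g %| 'X - e%:P by rewrite -e1 ef dvdp_mulr.
  rewrite Phi_dvd ?ng //; exact/Phi_XsubC/sqr1_neq0.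
Qed.

Lemma gens_model L : wfL L -> exists D, gens (model L) L D.
Proof.
elim: L => [_|l L IHL /wfL_cons [wl wL]].
  exists [::]; split=> //.
  - by move=> S S0 _ _ x; rewrite [x]flatmx0.
  - by rewrite big_nil.
  - by move=> g r _; rewrite /cnt big_nil.
  - move=> e e2; split=> // i ni i0 X; rewrite gdet_nil oner_neq0 issq1 /sgn big_nil //.
have [D hD] := IHL wL; have [D' hD'] := gens_block (blkP oddF wl).
have [gl _ _ _] := blkP oddF wl.
by have [E hE] := gens_dsum gl (good_model oddF wL) hD' hD; exists E.
Qed.

End Generators.

(** * Direct sums of cyclic subspaces *)

Section VectorSums.
Variables (F : fieldType) (vT : vectType F).

Lemma sumv_ind (I : eqType) (s : seq I) (P : pred I) (V : I -> {vspace vT}) (S : vT -> Prop) :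
  S 0 -> (forall x y, S x -> S y -> S (x + y)) ->
  (forall i x, i \in s -> P i -> x \in V i -> S x) ->
  forall x, x \in (\sum_(i <- s | P i) V i)%VS -> S x.
Proof.
move=> S0 SD; elim: s => [_ x|i s IHs SV x].
  by rewrite big_nil memv0 => /eqP ->.
have {}IHs := IHs (fun j y js => SV j y (mem_behead (s := i :: s) js)).
rewrite big_cons; case: ifP => Pi; last exact: IHs.
case/memv_addP => a aV [b bV ->]; apply: SD; last exact: IHs.
by apply: SV aV; rewrite ?inE ?eqxx.
Qed.

Lemma sumv_seq_sup (I : eqType) (s : seq I) (P : pred I) (V : I -> {vspace vT}) i :
  i \in s -> P i -> (V i <= \sum_(j <- s | P j) V j)%VS.
Proof. by move=> is_ Pi; rewrite (big_rem i is_) /= Pi addvSl. Qed.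

Lemma dim_sum_sub (I : eqType) (s : seq I) (V W : I -> {vspace vT}) :
  (forall i, i \in s -> (W i <= V i)%VS) ->
  \dim (\sum_(i <- s) V i)%VS = (\sum_(i <- s) \dim (V i))%N ->
  \dim (\sum_(i <- s) W i)%VS = (\sum_(i <- s) \dim (W i))%N.
Proof.
elim: s => [|i s IHs] sub; first by rewrite !big_nil ?dimv0.
have {}IHs := IHs (fun j js => sub j (mem_behead (s := i :: s) js)).
have subi := sub i (mem_head i s).
have subs j : j \in s -> (W j <= V j)%VS by move=> js; apply: sub; rewrite inE js orbT.
rewrite !big_cons => e.
have le1 : (\dim (\sum_(j <- s) V j) <= \sum_(j <- s) \dim (V j))%N by apply: dimv_leq_sum.
have e1 := dimv_sum_cap (V i) (\sum_(j <- s) V j)%VS.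
have capV : (V i :&: \sum_(j <- s) V j = 0)%VS.
  by apply/eqP; rewrite -dimv_eq0; apply/eqP; lia.
rewrite dimv_disjoint_sum ?IHs //; first by lia.
have le2 : (\sum_(j <- s) W j <= \sum_(j <- s) V j)%VS.
  rewrite big_seq [X in (_ <= X)%VS]big_seq.
  by elim/big_ind2: _ => [|? ? ? ?|j /subs //]; [exact: subvv | exact: addvS].
by apply/eqP; rewrite -subv0 -[X in (_ <= X)%VS]capV capvS.
Qed.

Lemma dim_sum_filter (I : eqType) (s : seq I) (P : pred I) (V : I -> {vspace vT}) :
  \dim (\sum_(i <- s) V i)%VS = (\sum_(i <- s) \dim (V i))%N ->
  \dim (\sum_(i <- s | P i) V i)%VS = (\sum_(i <- s | P i) \dim (V i))%N.
Proof.
move=> e; rewrite (big_mkcond P) /= (dim_sum_sub (V := V)) //.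
  by rewrite [RHS]big_mkcond; apply: eq_bigr => i _; case: (P i); rewrite ?dimv0.
by move=> i _; case: (P i); rewrite ?sub0v.
Qed.

End VectorSums.

Arguments sumv_seq_sup {F vT I s P} V {i}.

Section Cyclic.
Variables (F : fieldType) (N : nat) (U : 'M[F]_N).
Implicit Types (v w : 'cV[F]_N) (f p q : {poly F}).

Definition cs v : {vspace 'cV[F]_N} := <<[seq U ^+ k *m v | k <- iota 0 N]>>%VS.
Definition mxe (A : 'M[F]_N) : 'End('cV[F]_N) := linfun (mulmx A).

Lemma mxeE A v : mxe A v = A *m v. Proof. by rewrite lfunE. Qed.

Lemma ann_size v f : f != 0 -> ann U v f -> ((size f).-1 <= N)%N.
Proof.
move=> f0 hv; have [|B] := @inj_left_inverse F _ _ (kry U v (size f).-1).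
  by move=> c; apply: kry_inj.
exact: mulmx1_min.
Qed.

Lemma csP v f w : f != 0 -> ann U v f ->
  w \in cs v <-> exists p, w = pm U p *m v.
Proof.
move=> f0 hv; split.
  rewrite /cs span_def big_map; move: w.
  apply: sumv_ind => [|x y [p ->] [q ->]|k x _ _ /vlineP [c ->]].
  - by exists 0; rewrite pm0 mul0mx.
  - by exists (p + q); rewrite pmD mulmxDl.
  - by exists (c *: 'X^k); rewrite pmZ pmXn scalemxAl.
case=> p ->; rewrite -(pm_mod p (ann0 hv)).
have sz : (size (p %% f)%R <= N)%N.
  by apply: leq_trans (ann_size f0 hv); rewrite -ltnS prednK ?size_poly_gt0 // ltn_modp.
rewrite (pmE _ sz) mulmx_suml; apply: memv_suml => k _.
rewrite -scalemxAl; apply/memvZ/memv_span/mapP; exists (nat_of_ord k) => //.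
by rewrite mem_iota /= add0n ltn_ord.
Qed.

Lemma cs_pm v f p : f != 0 -> ann U v f -> pm U p *m v \in cs v.
Proof. by move=> f0 hv; apply/(csP _ f0 hv); exists p. Qed.

Lemma dim_cs v f : f != 0 -> ann U v f -> \dim (cs v) = (size f).-1.
Proof.
move=> f0 hv; set d := (size f).-1.
pose phi : 'Hom('cV[F]_d, 'cV[F]_N) := linfun (mulmx (kry U v d)).
have -> : cs v = limg phi.
  apply/eqP; rewrite eqEsubv; apply/andP; split; apply/subvP => x.
    move=> /(csP _ f0 hv) [p ->]; rewrite (kry_surj p f0 (ann0 hv)).
    by rewrite -[X in X \in _](lfunE (mulmx (kry U v d))) memv_img // memvf.
  case/memv_imgP => c _ ->; rewrite lfunE /= kryE; exact: cs_pm hv.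
rewrite limg_dim_eq; first by rewrite dimvf dim_matrix; exact: muln1.
apply/eqP; rewrite -subv0; apply/subvP => c; rewrite memv_cap memv_ker lfunE /= memv0.
by case/andP => _ /eqP /(kry_inj f0 hv) ->.
Qed.

Lemma mxe_cs v f p : f != 0 -> ann U v f -> (mxe (pm U p) @: cs v <= cs v)%VS.
Proof.
move=> f0 hv; apply/subvP => x /memv_imgP [y /(csP _ f0 hv) [q ->] ->].
by rewrite mxeE mulmxA -pmM; apply: cs_pm hv.
Qed.

Lemma mxe_cs_eq v f f' p : f != 0 -> f' != 0 -> ann U v f -> ann U (pm U p *m v) f' ->
  (mxe (pm U p) @: cs v = cs (pm U p *m v))%VS.
Proof.
move=> f0 f0' hv hv'; apply/eqP; rewrite eqEsubv; apply/andP; split; apply/subvP => x.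
  move=> /memv_imgP [y /(csP _ f0 hv) [q ->] ->]; rewrite mxeE mulmxA pmCC -mulmxA.
  exact: cs_pm hv'.
case/(csP _ f0' hv') => q ->; rewrite mulmxA pmCC -mulmxA -mxeE memv_img //.
exact: cs_pm hv.
Qed.

Lemma ann_coprime v f p : ann U v f -> coprimep f p -> ann U (pm U p *m v) f.
Proof. by move=> hv cop q; rewrite mulmxA -pmM hv Gauss_dvdpl. Qed.

Lemma ann_quot v f g : f != 0 -> ann U v (f * g) -> ann U (pm U f *m v) g.
Proof. by move=> f0 hv q; rewrite mulmxA -pmM hv mulrC dvdp_mul2r. Qed.

(** Dimension of the image of g^k(U) on the cyclic module F[t]/(h^r). *)
Lemma dim_img_cs v g h r k : irreducible_poly g -> irreducible_poly h ->
  (g %= h -> g = h) -> ann U v (h ^+ r) ->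
  \dim (mxe (pm U (g ^+ k)) @: cs v) =
  (if h == g then (size g).-1 * (r - k) else (size h).-1 * r)%N.
Proof.
move=> ig ih gh hv; have g0 := irredp_neq0 ig; have h0 := irredp_neq0 ih.
have [e|ne] := eqVneq h g; last first.
  have cop : coprimep (h ^+ r) (g ^+ k).
    apply: coprimep_expl; apply: coprimep_expr; rewrite irreducible_poly_coprime //.
    apply: contra ne => hg; have := ig.2 h _ hg; rewrite neq_ltn orbC ih.1 => /(_ isT).
    by rewrite eqp_sym => /gh ->.
  have hv' := ann_coprime hv cop.
  rewrite (mxe_cs_eq _ _ hv hv') ?expf_neq0 // (dim_cs _ hv') ?expf_neq0 //.
  by rewrite size_exp.
rewrite e in hv *; have [kr|rk] := leqP k r.
  have hv2 : ann U v (g ^+ k * g ^+ (r - k)) by rewrite -exprD subnKC.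
  have hv' := ann_quot (expf_neq0 k g0) hv2.
  by rewrite (mxe_cs_eq _ _ hv hv') ?expf_neq0 // (dim_cs _ hv') ?expf_neq0 // size_exp.
have z : pm U (g ^+ k) *m v = 0 by apply/hv; rewrite dvdp_exp2l // ltnW.
have hv' : ann U (pm U (g ^+ k) *m v) 1.
  by move=> q; rewrite z mulmx0 dvd1p.
rewrite (mxe_cs_eq _ _ hv hv') ?expf_neq0 ?oner_neq0 // (dim_cs _ hv') ?oner_neq0 //.
by rewrite size_poly1 (_ : r - k = 0)%N ?muln0 //; apply/eqP; rewrite subn_eq0 ltnW.
Qed.

Lemma dim_img_sum (I : eqType) (s : seq I) (V : I -> {vspace 'cV[F]_N}) (A : 'End('cV[F]_N)) :
  (forall i, i \in s -> (A @: V i <= V i)%VS) ->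
  \dim (\sum_(i <- s) V i)%VS = (\sum_(i <- s) \dim (V i))%N ->
  \dim (A @: (\sum_(i <- s) V i)) = (\sum_(i <- s) \dim (A @: V i))%N.
Proof. by move=> st e; rewrite limg_sum; apply: dim_sum_sub e. Qed.

End Cyclic.

Section SpModule.
Variables (F : finFieldType) (n : nat).

Lemma sp_form_skew : (sp_form F n)^T = - sp_form F n.
Proof.
apply/matrixP => i j; rewrite !mxE.
case: (boolP (odd i)) => oi; case: (boolP (odd j)) => oj /=; rewrite ?oppr0 //.
- by case: ifP; rewrite ?opprK ?oppr0.
- by case: ifP; rewrite ?oppr0.
- by case: ifP => h1; case: ifP => h2; rewrite ?oppr0 //; lia.
Qed.

Lemma sp_form_unit : sp_form F n \in unitmx.
Proof.
have : sp_form F n *m - sp_form F n = 1%:M by rewrite mulmxN sp_form_sq opprK.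
by case/mulmx1_unit.
Qed.

Definition spm (U : Sp F n) : smod F := @SMod F n.*2 (U : 'M[F]_(n.*2)) (sp_form F n).

Lemma good_spm U : good (spm U).
Proof.
split; [by case: U => U /= /eqP | exact: sp_form_skew | exact: sp_form_unit].
Qed.

End SpModule.

Section TypeExistence.
Variable F : finFieldType.
Hypothesis oddF : odd #|F|.
Variables (n : nat) (U : Sp F n) (L : seq (label F)).
Variable D : seq ({poly F} * nat * 'cV[F]_(n.*2)).
Hypotheses (wL : wfL L) (gD : @gens F (spm U) L D).
Local Notation N := n.*2.
Local Notation mU := (U : 'M[F]_(n.*2)).
Local Notation csU := (@cs F N mU).

Let Dann d : d \in D -> [/\ in_Phi d.1.1, (0 < d.1.2)%N & ann mU d.2 (d.1.1 ^+ d.1.2)].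
Proof. by case: gD => h _ _ _ _; apply: h. Qed.

Let Dann0 d : d \in D -> d.1.1 ^+ d.1.2 != 0.
Proof. by case/Dann => Pg _ _; rewrite expf_neq0 // Phi_neq0. Qed.

Let Ddim d : d \in D -> \dim (csU d.2) = ((size d.1.1).-1 * d.1.2)%N.
Proof. by move=> dD; have [Pg _ hv] := Dann dD; rewrite (dim_cs (Dann0 dD) hv) size_exp. Qed.

Let Dspan : (\sum_(d <- D) csU d.2 = fullv)%VS.
Proof.
apply/eqP; rewrite eqEsubv subvf; apply/subvP => x _.
have [_ h _ _ _] := gD; move: x.
apply: (h (fun x => x \in (\sum_(d <- D) csU d.2)%VS)) => [|x y hx hy|d p dD].
- exact: mem0v.
- exact: memvD.
- apply: (subvP (sumv_seq_sup (fun d => csU d.2) dD isT)).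
  have [_ _ hv] := Dann dD; exact: cs_pm (Dann0 dD) hv.
Qed.

Let Ddirect : \dim (\sum_(d <- D) csU d.2)%VS = (\sum_(d <- D) \dim (csU d.2))%N.
Proof.
rewrite Dspan dimvf dim_matrix [LHS]muln1; have [_ _ h _ _] := gD; rewrite -[LHS]h.
by rewrite big_seq [RHS]big_seq; apply: eq_bigr => d dD; rewrite Ddim.
Qed.

Lemma gens_primary : primary_decomposition U D.
Proof.
split.
- move=> f r v hd; have [Pg r0 hv] := Dann hd; split=> // p.
  by rewrite -hv /pact pact_pm.
- rewrite directvE /=; apply/eqP; exact: Ddirect.
- exact: Dspan.
Qed.

Lemma gens_exponents g : in_Phi g -> forall r,
  count_mem r (exponents D g) = cnt L (self_dual_of g) r.
Proof.
move=> Pg r; have [_ _ _ h _] := gD; rewrite -h // /exponents count_map count_filter.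
by apply: eq_count => -[[f k] v] /=; rewrite xpair_eqE andbC.
Qed.

Section Eigenvalue.
Variable e : F.
Hypothesis e2 : e ^+ 2 = 1.
Let f : {poly F} := 'X - e%:P.
Let f0 : f != 0. Proof. by rewrite /f polyXsubC_eq0. Qed.
Let M := mU - e%:M.

Let Xs i := [seq d.2 | d <- D & d.1 == (f, i)].
Let W i : {vspace 'cV[F]_N} := (\sum_(d <- D | d.1 == (f, i)) csU d.2)%VS.

Let fM k : pm mU (f ^+ k) = M ^+ k. Proof. exact: pm_XsubC. Qed.

Let Dat d i : d \in D -> d.1 == (f, i) -> [/\ (0 < i)%N, (i <= N)%N, ann mU d.2 (f ^+ i)
  & \dim (csU d.2) = i].
Proof.
move=> dD /eqP e1; have := Dann dD; have dd := Ddim dD; rewrite e1 /= in dd *.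
case=> _ i0 hv; split=> //; last by rewrite dd size_XsubC mul1n.
have := ann_size (expf_neq0 i f0) hv; by rewrite size_exp size_XsubC mul1n.
Qed.

Let Wsum i : W i = (\sum_(b <- Xs i) csU b)%VS.
Proof. by rewrite /W /Xs big_map big_filter. Qed.

Let Xann i b : b \in Xs i -> ann mU b (f ^+ i).
Proof.
by case/mapP => d; rewrite mem_filter => /andP [d1 dD] ->; have [] := Dat dD d1.
Qed.

Let Wdim i : \dim (W i) = (size (Xs i) * i)%N.
Proof.
rewrite /W (dim_sum_filter _ Ddirect) /Xs size_map size_filter -sum1_count big_distrl /=.
rewrite big_seq_cond [RHS]big_seq_cond; apply: eq_bigr => d /andP [dD d1].
by have [_ _ _ ->] := Dat dD d1; rewrite mul1n.
Qed.

Let WM i x : x \in W i -> M ^+ i *m x = 0.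
Proof.
move: x; apply: sumv_ind => [|x y hx hy|d x dD d1].
- by rewrite mulmx0.
- by rewrite mulmxDr hx hy addr0.
- have [i0 _ hv _] := Dat dD d1; case/(csP _ (expf_neq0 i f0) hv) => p ->.
  by rewrite -fM mulmxA pmCC -mulmxA (ann0 hv) mulmx0.
Qed.

Let fM1 : pm mU f = M. Proof. by rewrite -[f]expr1 fM expr1. Qed.

Let Mle (x : 'cV[F]_N) i k : (i <= k)%N -> M ^+ i *m x = 0 -> M ^+ k *m x = 0.
Proof. by move=> ik xi; rewrite -(subnK ik) exprD -mulmxE -mulmxA xi mulmx0. Qed.

Let Dregroup (T : Type) (idx : T) (op : Monoid.com_law idx) (G : {poly F} * nat * 'cV[F]_N -> T) :
  \big[op/idx]_(1 <= i < N.+1) \big[op/idx]_(d <- D | d.1 == (f, i)) G d =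
  \big[op/idx]_(d <- D | d.1.1 == f) G d.
Proof.
rewrite (exchange_big_dep (fun d => d.1.1 == f)) /=; last by move=> i d _ /eqP ->; rewrite eqxx.
rewrite big_seq_cond [RHS]big_seq_cond; apply: eq_bigr => d /andP [dD /eqP d1].
have d1' : d.1 == (f, d.1.2) by case: d d1 {dD} => [[? ?] ?] /= ->.
have [i0 iN _ _] := Dat dD d1'.
rewrite (eq_bigl (fun i => i == d.1.2)).
  by rewrite -big_filter filter_pred1_uniq ?big_seq1 ?iota_uniq // mem_index_iota i0.
by move=> i; rewrite (eqP d1') xpair_eqE eqxx eq_sym.
Qed.

Lemma gens_splitting : orthogonal_splitting U e W.
Proof.
split.
- move=> i; split.
    rewrite /W limg_sum big_seq_cond [X in (_ <= X)%VS]big_seq_cond.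
    elim/big_ind2: _ => [|? ? ? ?|d /andP [dD d1]]; [exact: subvv | exact: addvS |].
    have [_ _ hv _] := Dat dD d1.
    by have := mxe_cs 'X (expf_neq0 i f0) hv; rewrite pmX.
  exists (Xs i); split; last by rewrite Wsum.
    by move=> b /Xann hb p; rewrite -hb /pact pact_pm.
  rewrite directvE /= -(Wsum i) Wdim; apply/eqP.
  rewrite big_seq (eq_bigr (fun=> i)); last first.
    move=> b /Xann hb.
    by have := dim_cs (expf_neq0 i f0) hb; rewrite size_exp size_XsubC mul1n.
  by rewrite -big_seq big_const_seq count_predT iter_addn_0 mulnC.
- move=> i j v w nij hv; move: w.
  apply: (@sumv_ind _ _ _ _ _ _ (fun w => Qform v w = 0)) => [|x y hx hy|d x dD d1].
  + exact: (@Q0r F (spm U) v).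
  + by rewrite (@QDr F (spm U) v x y : Qform v (x + y) = Qform v x + Qform v y) hx hy addr0.
  + have [_ _ hd _] := Dat dD d1; case/(csP _ (expf_neq0 j f0) hd) => q -> {x}.
    move: v hv.
    apply: (@sumv_ind _ _ _ _ _ _ (fun v => Qform v (pm mU q *m d.2) = 0)) => [|x y hx hy|d' x d'D d1'].
    * exact: (@Q0l F (spm U)).
    * rewrite (@QDl F (spm U) x y _ : Qform (x + y) _ = Qform x _ + Qform y _).
      by rewrite hx hy addr0.
    * have [_ _ hd' _] := Dat d'D d1'; case/(csP _ (expf_neq0 i f0) hd') => p -> {x}.
      have [_ _ _ _ /(_ e e2) [ort _]] := gD.
      move/eqP: d1 => d1; move/eqP: d1' => d1'.
      by apply: (ort d' d p q d'D dD); rewrite ?d1 ?d1'.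
- rewrite directvE /=; apply/eqP; rewrite Dregroup (dim_sum_filter _ Ddirect) -Dregroup.
  by apply: eq_bigr => i _; rewrite /W (dim_sum_filter _ Ddirect).
- apply/eqP; rewrite eqEsubv; apply/andP; split; apply/subvP => x.
    move: x; apply: sumv_ind => [|x y|i x]; [exact: mem0v | exact: memvD |].
    rewrite mem_index_iota => /andP [_ iN] _ /WM xi.
    by rewrite memv_ker /mxend lfunE /=; apply/eqP; apply: Mle xi.
  rewrite memv_ker /mxend lfunE /= Dregroup => /eqP Mx.
  have: x \in (\sum_(d <- D) csU d.2)%VS by rewrite Dspan memvf.
  rewrite (bigID (fun d => d.1.1 == f)) /= => /memv_addP [a aW [b bW xab]].
  have [c cop cb] : exists2 c, coprimep f c & pm mU c *m b = 0.
    move: b bW {xab}; apply: sumv_ind => [|x1 y1 [c1 k1 e1] [c2 k2 e2']|d y dD nd yd].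
    + by exists 1; rewrite ?coprimep1 ?mulmx0.
    + exists (c1 * c2); first by rewrite coprimepMr k1.
      rewrite mulmxDr {1}[c1 * c2]mulrC !pmM -!mulmxA e1 e2' !mulmx0 addr0 //.
    + have [Pg r0 hd] := Dann dD; exists (d.1.1 ^+ d.1.2).
        apply: coprimep_expr; apply: Phi_coprime_neq; rewrite 1?eq_sym //; apply: Phi_XsubC; exact: sqr1_neq0.
      by case/(csP _ (Dann0 dD) hd): yd => p ->; rewrite mulmxA pmCC -mulmxA (ann0 hd) mulmx0.
  have Ma : M ^+ N *m a = 0.
    move: aW; rewrite -Dregroup; move: a {xab}.
    apply: sumv_ind => [|y z hy hz|i y]; first by rewrite mulmx0.
      by rewrite mulmxDr hy hz addr0.
    rewrite mem_index_iota => /andP [_ iN] _ /WM yi.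
    by apply: Mle yi.
  have Mb : M ^+ N *m b = 0 by move: Mx; rewrite xab mulmxDr Ma add0r.
  suff -> : x = a by [].
  rewrite xab; suff -> : b = 0 by rewrite addr0.
  have /Bezout_eq1_coprimepP [[u w] /= uw] : coprimep (f ^+ N) c by apply: coprimep_expl.
  have := congr1 (fun p => pm mU p *m b) uw.
  by rewrite pmD !pmM mulmxDl -!mulmxA fM Mb cb !mulmx0 addr0 pm1 mul1mx.
Qed.

Lemma gens_quotient i : (0 < i)%N -> quotient_basis U e (W i) (Xs i).
Proof.
move=> i0; rewrite /quotient_basis /mxend -/M -/(mxe M); set W' := (mxe M @: W i)%VS.
have W'W : (W' <= W i)%VS.
  rewrite /W' /W limg_sum big_seq_cond [X in (_ <= X)%VS]big_seq_cond.
  elim/big_ind2: _ => [|? ? ? ?|d /andP [dD d1]]; [exact: subvv | exact: addvS |].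
  have [_ _ hv _] := Dat dD d1.
  by have := mxe_cs f (expf_neq0 i f0) hv; rewrite fM1.
have XW : (<<Xs i>> <= W i)%VS.
  apply/span_subvP => b bX; rewrite Wsum.
  apply: (subvP (sumv_seq_sup (csU) bX isT)).
  by have := cs_pm 1 (expf_neq0 i f0) (Xann bX); rewrite pm1 mul1mx.
have sumW : (<<Xs i>> + W' = W i)%VS.
  apply/eqP; rewrite eqEsubv subv_add XW W'W /=; apply/subvP => x.
  rewrite {1}Wsum; move: x; apply: sumv_ind => [|x y|b x bX _]; [exact: mem0v | exact: memvD |].
  case/(csP _ (expf_neq0 i f0) (Xann bX)) => p ->.
  rewrite (divp_eq p f) modp_XsubC pmD mulmxDl addrC memv_add //.
    by rewrite -alg_polyC pmZ pm1 -scalemxAl mul1mx memvZ // memv_span.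
  rewrite mulrC pmM -mulmxA fM1 -mxeE memv_img // Wsum.
  apply: (subvP (sumv_seq_sup (csU) bX isT)); exact: cs_pm (expf_neq0 i f0) (Xann bX).
have dW' : (\dim W' <= size (Xs i) * i.-1)%N.
  rewrite /W' Wsum limg_sum.
  have le1 : (\dim (\sum_(b <- Xs i) mxe M @: csU b)%VS <= \sum_(b <- Xs i) \dim (mxe M @: csU b))%N.
    by apply: dimv_leq_sum.
  apply: leq_trans le1 _.
  have -> : (size (Xs i) * i.-1 = \sum_(b <- Xs i) i.-1)%N.
    by rewrite big_const_seq count_predT iter_addn_0 mulnC.
  rewrite big_seq [X in (_ <= X)%N]big_seq; apply: leq_sum => b /Xann hb.
  have fi : irreducible_poly f by apply: irredp_XsubC.
  have := dim_img_cs 1 fi fi (fun=> erefl) hb.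
  by rewrite eqxx fM expr1 size_XsubC mul1n => ->; rewrite subn1.
have dX := dim_span (Xs i); have dd := dimv_sum_cap <<Xs i>>%VS W'.
have dW := Wdim i; rewrite sumW dW in dd.
have ei : (size (Xs i) * i = size (Xs i) * i.-1 + size (Xs i))%N.
  by rewrite -[X in _ = (_ + X)%N]muln1 -mulnDr addn1 prednK.
split=> //.
- rewrite /free; apply/eqP; move: dX dd dW' ei; rewrite /dimv.
  move: (size (Xs i) * i)%N (size (Xs i) * i.-1)%N (size (Xs i)) => a b c.
  by move: (\rank _) (\rank _) (\rank _) => u v w; lia.
- apply/eqP; rewrite -dimv_eq0; apply/eqP; move: dX dd dW' ei; rewrite /dimv.
  move: (size (Xs i) * i)%N (size (Xs i) * i.-1)%N (size (Xs i)) => a b c.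
  by move: (\rank _) (\rank _) (\rank _) => u v w; lia.
Qed.

Lemma gens_signs (s : seq nat) (h : nat -> int) : 0%N \notin s ->
  (forall i, ~~ odd i -> i \in s -> h i = sg (sgn L f i)) -> signs_at U e s h.
Proof.
move=> s0 hs; exists W; first exact: gens_splitting.
move=> i ei si.
have i0 : (0 < i)%N by rewrite lt0n; apply: contra s0 => /eqP <-.
exists (Xs i); first exact: gens_quotient.
have [_ _ _ _ /(_ e e2) [_ h5]] := gD; have [g0 gs] := h5 i ei i0.
rewrite hs //; rewrite square_signE.
have -> : issq (gram_det U i (Xs i)) = ~~ sgn L f i by exact: gs.
by case: (sgn L f i).
Qed.


End Eigenvalue.

End TypeExistence.

(** The abstract invariants of a model compute the symplectic type. *)
Lemma symplectic_type_of_model (F : finFieldType) (n : nat) (U : Sp F n) L x :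
  odd #|F| -> wfL L -> typ L x -> iso (model L) (spm U) -> symplectic_type U x.
Proof.
move=> oddF wL tx isoU; have [D0 gD0] := gens_model oddF wL.
have [D gD] := gens_iso (good_model oddF wL) (good_spm U) isoU gD0.
have [sx cx mx px] := tx; have [_ _ [[p1 _] _] [[p2 _] _]] := sx.
split=> //.
- exists D; first exact: gens_primary gD.
  move=> g Pg; apply/allP => r _; rewrite /= cx.
  by rewrite (gens_exponents gD Pg).
- apply: (@gens_signs F oddF n U L D gD 1); rewrite ?expr1n ?polyC1 //.
  by case/andP: p1.
- apply: (@gens_signs F oddF n U L D gD (-1)); rewrite ?sqrrN ?expr1n //.
    by case/andP: p2.
  by rewrite polyCN polyC1 opprK.
Qed.

(** * Uniqueness of the symplectic type *)

Section Rank.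
Variables (F : fieldType) (N : nat).

(** Dimensions of images are ranks. *)
Lemma dim_limg_mxe (A : 'M[F]_N) : \dim (limg (mxe A)) = \rank A.
Proof.
pose phi : 'Hom('cV[F]_(\rank A), 'cV[F]_N) := linfun (mulmx (col_base A)).
have [B BA] : exists B : 'M[F]_(N, \rank A), row_base A *m B = 1%:M.
  by have /row_freeP := row_base_free A.
have [C CA] : exists C : 'M[F]_(\rank A, N), C *m col_base A = 1%:M.
  by have /row_fullP := col_base_full A.
have -> : limg (mxe A) = limg phi.
  apply/eqP; rewrite eqEsubv; apply/andP; split; apply/subvP => x /memv_imgP [y _ ->].
    have -> : mxe A y = col_base A *m (row_base A *m y) by rewrite mxeE mulmxA mulmx_base.
    by rewrite -[X in X \in _](lfunE (mulmx (col_base A))) memv_img ?memvf.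
  rewrite lfunE /=; have -> : col_base A *m y = mxe A (B *m y).
    transitivity (col_base A *m (row_base A *m (B *m y))).
      by rewrite (mulmxA (row_base A)) BA mul1mx.
    by rewrite mxeE mulmxA mulmx_base.
  by rewrite memv_img ?memvf.
rewrite limg_dim_eq; first by rewrite dimvf dim_matrix; exact: muln1.
apply/eqP; rewrite -subv0; apply/subvP => c; rewrite memv_cap memv_ker lfunE /= memv0.
by case/andP => _ /eqP h; rewrite -[c]mul1mx -CA -mulmxA h mulmx0.
Qed.

End Rank.

Section PrimaryDims.
Variables (F : finFieldType) (n : nat) (U : Sp F n).
Local Notation N := n.*2.
Local Notation mU := (U : 'M[F]_(n.*2)).

Section OneDecomposition.
Variable D : seq ({poly F} * nat * 'cV[F]_(n.*2)).
Hypothesis hD : primary_decomposition U D.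

Lemma pd_ann d : d \in D -> [/\ in_Phi d.1.1, (0 < d.1.2)%N & ann mU d.2 (d.1.1 ^+ d.1.2)].
Proof.
case: hD => h _ _; case: d => [[f r] v] /h [Pf r0 hv]; split=> // p.
by rewrite -hv /pact pact_pm.
Qed.

Lemma pd_exponent d : d \in D -> (d.1.2 <= N)%N.
Proof.
move=> /pd_ann [Pf r0 hv]; have := ann_size (expf_neq0 _ (Phi_neq0 Pf)) hv.
rewrite size_exp => /(leq_trans _); apply; rewrite -{1}[d.1.2]mul1n leq_mul2r.
by have := Phi_size Pf; case: (size _) => [|[|k]] //=; rewrite orbT.
Qed.

Lemma pd_dim g k : in_Phi g ->
  \dim (limg (mxe (pm mU (g ^+ k)))) =
  ((size g).-1 * (\sum_(r <- exponents D g) (r - k)) +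
   \sum_(d <- D | d.1.1 != g) (size d.1.1).-1 * d.1.2)%N.
Proof.
move=> Pg; have [_ /directvP /= dD <-] := hD.
rewrite (dim_img_sum _ dD) => [|d dD']; last first.
  have [Pf _ hv] := pd_ann dD'.
  exact: mxe_cs (expf_neq0 _ (Phi_neq0 Pf)) hv.
rewrite (bigID (fun d => d.1.1 == g)) /=.
have H d : d \in D -> \dim (mxe (pm mU (g ^+ k)) @: cs mU d.2)%VS =
    if d.1.1 == g then ((size g).-1 * (d.1.2 - k))%N else ((size d.1.1).-1 * d.1.2)%N.
  case/pd_ann => Pf _ hv; have [_ irg _] := Pg; have [_ irf _] := Pf.
  rewrite (dim_img_cs k irg irf _ hv) // => gf.
  by apply/eqP; rewrite -eqp_monic ?Phi_monic.
congr (_ + _)%N.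
  rewrite /exponents big_map big_filter big_distrr /= big_seq_cond [RHS]big_seq_cond.
  by apply: eq_bigr => d /andP [dD' e1]; rewrite [LHS]H // e1.
rewrite big_seq_cond [RHS]big_seq_cond.
by apply: eq_bigr => d /andP [dD' e1]; rewrite [LHS]H // (negPf e1).
Qed.

Lemma pd_count g k : in_Phi g ->
  \dim (limg (mxe (pm mU (g ^+ k)))) =
  (\dim (limg (mxe (pm mU (g ^+ k.+1)))) +
   (size g).-1 * count (fun r => k < r) (exponents D g))%N.
Proof.
move=> Pg; rewrite !pd_dim // addnAC -mulnDr; congr (_ * _ + _)%N.
elim: (exponents D g) => [|r s IHs]; first by rewrite !big_nil.
by rewrite !big_cons IHs /=; lia.
Qed.

Lemma pd_exponents_gt0 g : 0%N \notin exponents D g.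
Proof.
apply/mapP => -[d]; rewrite mem_filter => /andP [_ dD] e0.
by have [_] := pd_ann dD; rewrite -e0.
Qed.

Lemma pd_exponents_le g r : r \in exponents D g -> (r <= N)%N.
Proof. by case/mapP => d; rewrite mem_filter => /andP [_ dD] ->; apply: pd_exponent. Qed.

End OneDecomposition.

Lemma perm_eq_count_gt (s t : seq nat) : 0%N \notin s -> 0%N \notin t ->
  (forall k, count (fun r => k < r)%N s = count (fun r => k < r)%N t) -> perm_eq s t.
Proof.
move=> s0 t0 h; apply/allP => r _ /=; apply/eqP.
case: r => [|r]; first by rewrite !(count_memPn _).
have aux u : (count (fun x => r < x) u = count_mem r.+1 u + count (fun x => r.+1 < x) u)%N.
  elim: u => //= x u ->; rewrite addnACA; congr (_ + _)%N.
  by case: ltngtP => //; lia.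
by have := h r; rewrite !aux (h r.+1) => /addIn.
Qed.

Lemma exponents_unique D D' g : primary_decomposition U D -> primary_decomposition U D' ->
  in_Phi g -> perm_eq (exponents D g) (exponents D' g).
Proof.
move=> hD hD' Pg; apply: perm_eq_count_gt => [||k]; rewrite ?(pd_exponents_gt0 hD) ?(pd_exponents_gt0 hD') //.
have := pd_count hD k Pg; rewrite (pd_count hD' k Pg) => /addnI /eqP.
rewrite eqn_pmul2l => [/eqP -> //|].
by have := Phi_size Pg; case: (size g) => [|[|]].
Qed.

End PrimaryDims.

Section Splitting.
Variables (F : finFieldType) (n : nat) (U : Sp F n) (e : F).
Hypothesis e2 : e ^+ 2 = 1.
Local Notation N := n.*2.
Local Notation mU := (U : 'M[F]_(n.*2)).
Local Notation V := 'cV[F]_(n.*2).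
Local Notation M := (mU - e%:M).
Local Notation f := ('X - e%:P : {poly F}).
Local Notation Mk k := (mxe (M ^+ k)).

Let gU := good_spm U.
Let uU : mU \in unitmx. Proof. exact: (good_act_unit gU). Qed.
Let fM k : pm mU (f ^+ k) = M ^+ k. Proof. exact: pm_XsubC. Qed.
Let f0 k : f ^+ k != 0. Proof. by rewrite expf_neq0 ?polyXsubC_eq0. Qed.
Let MD j k (x : V) : M ^+ j *m (M ^+ k *m x) = M ^+ (j + k) *m x.
Proof. by rewrite mulmxA mulmxE -exprD. Qed.

Let Qf0l (y : V) : Qform 0 y = 0. Proof. exact: (@Q0l F (spm U)). Qed.
Let Qf0r (y : V) : Qform y 0 = 0. Proof. exact: (@Q0r F (spm U)). Qed.
Let QfDl (x x' y : V) : Qform (x + x') y = Qform x y + Qform x' y.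
Proof. exact: (@QDl F (spm U)). Qed.
Let QfDr (x y y' : V) : Qform x (y + y') = Qform x y + Qform x y'.
Proof. exact: (@QDr F (spm U)). Qed.
Let QfZl a (x y : V) : Qform (a *: x) y = a * Qform x y.
Proof. exact: (@QZl F (spm U)). Qed.
Let QfZr a (x y : V) : Qform x (a *: y) = a * Qform x y.
Proof. exact: (@QZr F (spm U)). Qed.

Lemma free_dims i W : free_mod U e i W ->
  exists m, [/\ \dim W = (m * i)%N, forall k, \dim (Mk k @: W) = (m * (i - k))%N,
    forall k, (Mk k @: W <= W)%VS & forall x, x \in W -> M ^+ i *m x = 0].
Proof.
case=> B [hB /directvP /= dB sB]; exists (size B).
have hB' b : b \in B -> ann mU b (f ^+ i).
  by move=> bB p; rewrite -(hB b bB p) /pact pact_pm.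
have st k b : b \in B -> (Mk k @: cs mU b <= cs mU b)%VS.
  by move=> /hB' hb; rewrite -fM; apply: mxe_cs hb.
have fi : irreducible_poly f by apply: irredp_XsubC.
have cnst a : (size B * a = \sum_(b <- B) a)%N.
  by rewrite big_const_seq count_predT iter_addn_0 mulnC.
rewrite -sB; split.
- rewrite dB cnst big_seq [RHS]big_seq; apply: eq_bigr => b /hB' hb.
  by have := dim_cs (f0 i) hb; rewrite size_exp size_XsubC mul1n.
- move=> k; rewrite (dim_img_sum (st k) dB) cnst big_seq [RHS]big_seq.
  apply: eq_bigr => b /hB' hb.
  by have := dim_img_cs k fi fi (fun=> erefl) hb; rewrite eqxx fM size_XsubC mul1n.
- move=> k; rewrite limg_sum big_seq_cond [X in (_ <= X)%VS]big_seq_cond.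
  elim/big_ind2: _ => [|? ? ? ?|b /andP [bB _]]; [exact: subvv | exact: addvS | exact: st].
- apply: sumv_ind => [|x y hx hy|b x bB _]; rewrite ?mulmx0 ?mulmxDr ?hx ?hy ?addr0 //.
  case/(csP _ (f0 i) (hB' b bB)) => p ->.
  by rewrite -fM mulmxA pmCC -mulmxA (ann0 (hB' b bB)) mulmx0.
Qed.

Let E := gen_eigenspace U e.
Definition eig_dim k := \dim (Mk k @: E).
Definition kerpow i : {vspace V} := (E :&: lker (Mk i))%VS.
Lemma kerpowP i x : reflect (x \in E /\ M ^+ i *m x = 0) (x \in kerpow i).
Proof.
rewrite memv_cap [X in _ && X]memv_ker [X in _ && (X == _)]mxeE.
by apply: (iffP andP) => -[xE /eqP].
Qed.

Definition form_rad i (r : V) : Prop := forall y, y \in kerpow i ->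
  Qform (M ^+ i.-1 *m r) y = 0 /\ Qform (M ^+ i.-1 *m y) r = 0.

Lemma form_rad0 i : form_rad i 0.
Proof.
by move=> y _; rewrite mulmx0 Qf0l Qf0r.
Qed.

Lemma form_radD i x y : form_rad i x -> form_rad i y -> form_rad i (x + y).
Proof.
move=> hx hy z zK; have [a b] := hx z zK; have [c d] := hy z zK.
rewrite mulmxDr QfDl a c.
by rewrite QfDr b d addr0.
Qed.

Section OneSplitting.
Variable W : nat -> {vspace V}.
Hypothesis hW : orthogonal_splitting U e W.

Lemma splitting_mult : exists m : nat -> nat, forall i,
  [/\ \dim (W i) = (m i * i)%N, forall k, \dim (Mk k @: W i) = (m i * (i - k))%N,
    forall k, (Mk k @: W i <= W i)%VS & forall x, x \in W i -> M ^+ i *m x = 0].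
Proof.
case: hW => h _ _ _.
have {}h i : exists m, [/\ \dim (W i) = (m * i)%N, forall k, \dim (Mk k @: W i) = (m * (i - k))%N,
    forall k, (Mk k @: W i <= W i)%VS & forall x, x \in W i -> M ^+ i *m x = 0].
  by have [_ /free_dims] := h i.
by have [m hm] := boolp.choice h; exists m.
Qed.

Section Multiplicities.
Variable m : nat -> nat.
Hypothesis hm : forall i,
  [/\ \dim (W i) = (m i * i)%N, forall k, \dim (Mk k @: W i) = (m i * (i - k))%N,
    forall k, (Mk k @: W i <= W i)%VS & forall x, x \in W i -> M ^+ i *m x = 0].

Let sumE : (\sum_(1 <= j < N.+1) W j = E)%VS. Proof. by case: hW. Qed.
Let dimE : \dim (\sum_(1 <= j < N.+1) W j)%VS = (\sum_(1 <= j < N.+1) \dim (W j))%N.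
Proof. by case: hW => _ _ /directvP. Qed.

Lemma eig_dimE k : eig_dim k = (\sum_(1 <= j < N.+1) m j * (j - k))%N.
Proof.
rewrite /eig_dim -sumE (dim_img_sum _ dimE); last by move=> j _; have [] := hm j.
by apply: eq_bigr => j _; have [] := hm j.
Qed.

(** The multiplicities are the second differences of dimensions depending only
    on U. *)
Lemma eig_dim_mult i : (0 < i <= N)%N -> (eig_dim i.-1 + eig_dim i.+1 = 2 * eig_dim i + m i)%N.
Proof.
move=> /andP [i0 iN]; rewrite !eig_dimE -big_split big_distrr /=.
have -> : m i = (\sum_(1 <= j < N.+1) m j * (j == i))%N.
  rewrite (eq_bigr (fun j => if j == i then m j else 0%N)); last first.
    by move=> j _; case: eqP => _; rewrite ?muln1 ?muln0.
  rewrite -big_mkcond -big_filter filter_pred1_uniq ?big_seq1 ?iota_uniq //.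
  by rewrite mem_index_iota i0.
rewrite -big_split /=; apply: eq_bigr => j _.
by rewrite -mulnDr mulnCA -mulnDr; congr (_ * _)%N; case: eqP => ?; lia.
Qed.

Let Z i j : {vspace V} := (W j :&: lker (Mk i))%VS.

Let dimZ i j : (\dim (Z i j) + m j * (j - i) = m j * j)%N.
Proof. by have [<- <- _ _] := hm j; apply: limg_ker_dim. Qed.

Let ker_sum i : (kerpow i = \sum_(1 <= j < N.+1) Z i j)%VS.
Proof.
have ZW j : (Z i j <= W j)%VS by apply: capvSl.
apply/esym/eqP; rewrite eqEdim; apply/andP; split.
  rewrite subv_cap; apply/andP; split.
    rewrite -sumE; elim/big_ind2: _ => [|? ? ? ?|j _]; [exact: subvv | exact: addvS | exact: ZW].
  elim/big_ind: _ => [|? ? ? ?|j _]; [exact: sub0v | by rewrite subv_add; apply/andP | exact: capvSr].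
have d1 : (\dim (kerpow i) + eig_dim i = \dim E)%N by apply: limg_ker_dim.
have d2 : (\dim (\sum_(1 <= j < N.+1) Z i j)%VS + eig_dim i = \dim E)%N.
  rewrite (dim_sum_sub _ dimE) // eig_dimE -sumE dimE -big_split /=.
  by apply: eq_bigr => j _; rewrite dimZ; have [] := hm j.
by rewrite -(leq_add2r (eig_dim i)) d1 d2.
Qed.

Let Z_img i j : (i <= j)%N -> Z i j = (Mk (j - i) @: W j)%VS.
Proof.
move=> ij; have [dW dM st kW] := hm j; apply/esym/eqP; rewrite eqEdim; apply/andP; split.
  rewrite subv_cap st /=; apply/subvP => x /memv_imgP [y yW ->].
  by rewrite memv_ker mxeE mxeE MD subnKC // kW.
rewrite dM -(leq_add2r (m j * (j - i))) dimZ -mulnDr leq_mul2l; apply/orP; right; lia.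
Qed.

Let Wker i x : x \in W i -> (0 < i <= N)%N -> x \in kerpow i.
Proof.
move=> xW /andP [i0 iN]; have [_ _ _ kW] := hm i.
apply/kerpowP; rewrite kW //; split=> //; rewrite -sumE.
by apply: (subvP (sumv_seq_sup W _ isT)) xW; rewrite mem_index_iota i0.
Qed.

Let adj k (x y : V) :
  Qform (M ^+ k *m x) y = Qform x ((- e *: invmx mU) ^+ k *m (M ^+ k *m y)).
Proof.
have := @Q_pm F (spm U) (f ^+ k) x y gU; rewrite /= fM (pm_inv_XsubC _ uU e2) -mulmxA.
exact.
Qed.

Let rad_low i r : M ^+ i.-1 *m r = 0 -> form_rad i r.
Proof.
move=> hr y _; split; first by rewrite hr Qf0l.
by rewrite adj hr mulmx0 Qf0r.
Qed.

Let rad_img i k (w : V) : (0 < k)%N -> form_rad i (M ^+ k *m w).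
Proof.
move=> k0 y /kerpowP [_ yi].
have yi' l : (i <= l)%N -> M ^+ l *m y = 0.
  by move=> il; rewrite -(subnK il) -MD yi mulmx0.
have sym a b : Qform a b = - Qform b a :> F := @Qsym F (spm U) a b gU.
split.
  rewrite MD adj yi'; last by lia.
  by rewrite mulmx0 Qf0r.
rewrite sym adj MD yi'; last by lia.
by rewrite mulmx0 Qf0r oppr0.
Qed.

(** Modulo the radical of the form (x, y) |-> Q((U - e)^(i-1) x, y) on the kernel
    of (U - e)^i, every vector comes from the quotient W_i / (U - e) W_i: the
    summands with smaller exponent are killed by (U - e)^(i-1), and those with
    larger exponent contribute multiples of U - e. *)
Lemma quotient_decomposition i X x : (0 < i <= N)%N -> quotient_basis U e (W i) X ->
  x \in kerpow i -> exists u r, [/\ u \in <<X>>%VS, form_rad i r & x = u + r].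
Proof.
move=> iN [_ _ XW]; have /andP [i0 _] := iN; rewrite ker_sum; move: x.
apply: sumv_ind => [|x y [u [r [uX hr ->]]] [u' [r' [u'X hr' ->]]]|j x].
- by exists 0, 0; split; rewrite ?addr0 ?mem0v //; apply: form_rad0.
- exists (u + u'), (r + r'); split; [exact: memvD | exact: form_radD | by rewrite addrACA].
rewrite mem_index_iota => /andP [j0 jN] _ xZ.
have [ji|ij|eij] := ltngtP j i.
- exists 0, x; split; rewrite ?add0r ?mem0v //; apply: rad_low.
  move: xZ; rewrite memv_cap => /andP [xW _]; have [_ _ _ /(_ _ xW) xj] := hm j.
  have ji' : (j <= i.-1)%N by lia.
  by rewrite -(subnK ji') -MD xj mulmx0.
- move: xZ; rewrite Z_img ?(ltnW ij) // => /memv_imgP [w _ ->].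
  by exists 0, (Mk (j - i) w); rewrite mxeE; split; rewrite ?add0r ?mem0v //; apply: rad_img; rewrite subn_gt0.
move: xZ; rewrite memv_cap eij -XW => /andP [/memv_addP [u uX [v vW ->]] _].
exists u, v; split=> //; case/memv_imgP: vW => w _ ->.
by rewrite /mxend lfunE /= -[mU - _]expr1; apply: rad_img.
Qed.

Lemma quotient_size i X : (0 < i <= N)%N -> quotient_basis U e (W i) X -> size X = m i.
Proof.
move=> /andP [i0 iN] [fX cap XW]; have [dW dM _ _] := hm i.
have := dimv_disjoint_sum cap; rewrite XW dW (eqP fX).
have := dM 1%N; rewrite expr1 /mxe /mxend => ->.
have ei : (m i * i = m i + m i * i.-1)%N by rewrite -mulnS prednK.
by rewrite subn1 ei => /addIn.
Qed.

Lemma quotient_kerpow i X x : (0 < i <= N)%N -> quotient_basis U e (W i) X ->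
  x \in X -> x \in kerpow i.
Proof.
move=> iN [_ _ XW] xX; apply: Wker => //; rewrite -XW.
by apply: (subvP (addvSl _ _)); apply: memv_span.
Qed.

End Multiplicities.
End OneSplitting.

Lemma skew_kerpow i (x y : V) : (0 < i)%N -> x \in kerpow i ->
  @skewQ F (spm U) i x y = 2%:R ^+ i.-1 * Qform (M ^+ i.-1 *m x) y.
Proof.
move=> i0 /kerpowP [_ xi].
by rewrite /skewQ /= (skew_pow e2 uU i0 xi) -QfZl.
Qed.

Lemma splitting_size W W' i X X' : orthogonal_splitting U e W -> orthogonal_splitting U e W' ->
  (0 < i <= N)%N -> quotient_basis U e (W i) X -> quotient_basis U e (W' i) X' ->
  size X = size X'.
Proof.
move=> hW hW' iN hX hX'; have [m hm] := splitting_mult hW; have [m' hm'] := splitting_mult hW'.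
rewrite (quotient_size hm iN hX) (quotient_size hm' iN hX').
by have := eig_dim_mult hW hm iN; rewrite (eig_dim_mult hW' hm' iN) => /addnI.
Qed.

(** Two quotient bases span the same space modulo the radical, so that their
    Gram matrices are congruent. *)
Lemma gram_congruent W W' i X X' : orthogonal_splitting U e W -> orthogonal_splitting U e W' ->
  (0 < i <= N)%N -> quotient_basis U e (W i) X -> quotient_basis U e (W' i) X' ->
  exists c, gram_det U i X' = c ^+ 2 * gram_det U i X.
Proof.
move=> hW hW' iN hX hX'; have es := splitting_size hW hW' iN hX hX'.
have [m hm] := splitting_mult hW; have [m' hm'] := splitting_mult hW'.
have /andP [i0 _] := iN.
have dec (a : 'I_(size X)) : exists u, u \in <<X>>%VS /\ form_rad i (X'`_a - u).
  have aK : X'`_a \in kerpow i by apply: (quotient_kerpow hW' hm' iN hX'); rewrite mem_nth -?es.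
  have [u [r [uX hr ->]]] := quotient_decomposition hW hm iN hX aK.
  by exists u; rewrite addrC addKr.
have {dec} [u hu] := boolp.choice dec.
pose C := \matrix_(a < size X, b < size X) coord (in_tuple X) b (u a).
pose G Y := \matrix_(a < size X, b < size X) @skewQ F (spm U) i Y`_a Y`_b.
exists (\det C).
have -> : gram_det U i X = \det (G X) by [].
have -> : gram_det U i X' = \det (G X') by rewrite /gram_det /G; case: _ / es.
suff -> : G X' = C *m G X *m C^T by rewrite !det_mulmx det_tr; ring.
have XK x : x \in <<X>>%VS -> x \in kerpow i.
  move: x; apply/subvP/span_subvP => x xX; exact: (quotient_kerpow hW hm iN hX).
have X'K (a : 'I_(size X)) : X'`_a \in kerpow i.
  by apply: (quotient_kerpow hW' hm' iN hX'); rewrite mem_nth -?es.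
have sub (a b : 'I_(size X)) :
    Qform (M ^+ i.-1 *m X'`_a) X'`_b = Qform (M ^+ i.-1 *m u a) (u b).
  have [ua ra] := hu a; have [ub rb] := hu b.
  rewrite -{1}[X'`_a](subrK (u a)) mulmxDr QfDl (ra _ (X'K b)).1 add0r.
  by rewrite -{1}[X'`_b](subrK (u b)) QfDr (rb _ (XK _ ua)).2 add0r.
apply/matrixP => a b; rewrite !mxE (skew_kerpow _ i0 (X'K a)) sub.
have eu (a' : 'I_(size X)) : u a' = \sum_c C a' c *: X`_c.
  have [ua _] := hu a'; rewrite {1}[u a'](coord_span (X := in_tuple X)) //.
  by apply: eq_bigr => c _; rewrite mxE.
rewrite {1}(eu a) (eu b) mulmx_sumr.
rewrite (big_morph (fun x => Qform x _) (fun x y => QfDl x y _) (Qf0l _)) mulr_sumr.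
under [RHS]eq_bigr do rewrite !mxE mulr_suml.
rewrite exchange_big /=; apply: eq_bigr => c _.
rewrite (big_morph (Qform _) (QfDr _) (Qf0r _)) mulr_sumr; apply: eq_bigr => d _.
rewrite -scalemxAr QfZl QfZr [G X c d]mxE skew_kerpow //; last first.
  by apply: (quotient_kerpow hW hm iN hX); rewrite mem_nth.
by rewrite [C b d]mxE; ring.
Qed.

Lemma gram_sign W W' i X X' : orthogonal_splitting U e W -> orthogonal_splitting U e W' ->
  (0 < i <= N)%N -> quotient_basis U e (W i) X -> quotient_basis U e (W' i) X' ->
  square_sign (gram_det U i X) = square_sign (gram_det U i X').
Proof.
move=> hW hW' iN hX hX'.
have [c ec] := gram_congruent hW hW' iN hX hX'; have [c' ec'] := gram_congruent hW' hW iN hX' hX.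
rewrite !square_signE; congr (if _ then _ else _).
have aux (d d' a b : F) : d' = a ^+ 2 * d -> d = b ^+ 2 * d' -> issq d -> issq d'.
  move=> -> ed /issqP [y y0 dy]; apply/issqP; exists (a * y); last by rewrite dy exprMn.
  rewrite mulf_neq0 //; apply: contra_neq y0 => a0.
  by apply/eqP; rewrite -sqrf_eq0 -dy ed a0; apply/eqP; ring.
by apply/idP/idP; [apply: aux ec ec' | apply: aux ec' ec].
Qed.

Lemma signs_unique s h h' : {in s, forall i, 0 < i <= N}%N ->
  signs_at U e s h -> signs_at U e s h' -> forall i, ~~ odd i -> i \in s -> h i = h' i.
Proof.
move=> sN [W hW hX] [W' hW' hX'] i oi si.
have [X qX ->] := hX i oi si; have [X' qX' ->] := hX' i oi si.
exact: gram_sign (sN _ si) qX qX'.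
Qed.

End Splitting.

Lemma signs_at_perm (F : finFieldType) n (U : Sp F n) e s s' h :
  perm_eq s s' -> signs_at U e s h -> signs_at U e s' h.
Proof.
by move=> /perm_mem ss [W hW hX]; exists W => // i oi si; apply: hX; rewrite ?ss.
Qed.

(** The symplectic type is well defined. *)
Lemma symplectic_type_unique (F : finFieldType) n (U : Sp F n) x y :
  symplectic_type U x -> symplectic_type U y -> x = y.
Proof.
case=> sx [D hD xD] mx px [sy [D' hD' yD'] my py].
have sxy g : in_Phi g -> perm_eq (sf_part x (self_dual_of g)) (sf_part y (self_dual_of g)).
  move=> Pg; rewrite (permPl (xD g Pg)) (permPr (yD' g Pg)) perm_sym.
  exact: exponents_unique hD' hD Pg.
have cnt f r : count_mem r (sf_part x f) = count_mem r (sf_part y f).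
  have [p1 _ _ _] := sx; have [p2 _ _ _] := sy.
  have [[g Pg ->]|nf] := pselect (in_Phis f); first by apply/seq.permP/sxy.
  have nil z : (sf_part z f != [::] -> in_Phis f) -> sf_part z f = [::].
    by move=> h; apply/eqP; apply/negPn/negP => /h.
  by rewrite (nil x (p1 f)) (nil y (p2 f)).
have bnd (e : F) : e ^+ 2 = 1 -> {in sf_part x ('X - e%:P), forall i, (0 < i <= n.*2)%N}.
  move=> e2 i; have Pe := Phi_XsubC (sqr1_neq0 e2).
  have := xD _ Pe; rewrite self_dual_XsubC // => /perm_mem -> iD.
  rewrite (pd_exponents_le hD iD) andbT lt0n; apply: contraL iD => /eqP ->.
  exact: pd_exponents_gt0 hD _.
have e1 : 'X + 1 = 'X - (-1)%:P :> {poly F} by rewrite rmorphN opprK.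
have e0 : 'X - 1 = 'X - 1%:P :> {poly F} by rewrite polyC1.
have pxy f : perm_eq (sf_part y f) (sf_part x f).
  by apply/allP => r _; rewrite /= cnt.
apply: symp_ext => // i oi ix.
- apply: (signs_unique (e := 1)) (mx) (signs_at_perm (pxy _) my) _ _ _; rewrite ?expr1n //.
  by rewrite e0; apply: bnd; rewrite expr1n.
- apply: (signs_unique (e := -1)) (px) (signs_at_perm (pxy _) py) _ _ _; rewrite ?sqrrN ?expr1n //.
  by rewrite e1; apply: bnd; rewrite sqrrN expr1n.
Qed.

(** * Symplectic bases and realization of models *)

Section Core.
Variable F : finFieldType.
Hypothesis oddF : odd #|F|.

Lemma block_trivial (l : label F) B : isblk l B -> wfl l -> act B = 1%:M -> l = l1 F.
Proof.
move=> hB [_ r0 ls_]; have [_ Pf _ h] := hB => a1.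
have kill v : pm (act B) ('X - 1) *m v = 0.
  by rewrite pmB pmX -polyC1 pmC a1 subrr mul0mx.
have dv : lf l ^+ lr l %| 'X - 1.
  move: h; case: ifP => _.
    case=> _ [v [w [_ hvw]]]; apply: (proj1 (proj1 (hvw ('X - 1) 0) _)).
    by rewrite kill pm0 mul0mx addr0.
  by case=> v [hv _] _; apply/hv/kill.
have sX : size ('X - 1 : {poly F}) = 2 by rewrite -polyC1 size_XsubC.
have X0 : ('X - 1 : {poly F}) != 0 by rewrite -polyC1 polyXsubC_eq0.
have sz := dvdp_leq X0 dv; have sf := Phis_size Pf.
have r1 : lr l = 1%N.
  have : ((size (lf l ^+ lr l)).-1 <= 1)%N by rewrite sX in sz; move: (size _) sz; lia.
  rewrite size_exp; move: (size (lf l)) sf r0 => k; nia.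
have f1 : lf l = 'X - 1.
  rewrite r1 expr1 in dv sz; apply/eqP.
  have m1 : ('X - 1 : {poly F}) \is monic by rewrite -polyC1 monicXsubC.
  rewrite -eqp_monic ?(Phis_monic Pf) //.
  by rewrite -dvdp_size_eqp // sX; move: sz; rewrite sX; move: (size (lf l)) sf; lia.
move: ls_; rewrite r1 andbF orbF; case: l f1 r1 {hB Pf h dv sz sf r0} => [[f r] s] /= -> -> ->.
by [].
Qed.

Lemma model_trivial L : wfL L -> act (model L) = 1%:M -> L = nseq (size L) (l1 F).
Proof.
elim: L => //= l L IHL /wfL_cons [wl wL] h.
have [h1 h2] : act (blk l) = 1%:M /\ act (model L) = 1%:M.
  by apply: bdiag_inj; rewrite h bdiag1.
by rewrite -IHL // (block_trivial (blkP oddF wl) wl h1).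
Qed.

Lemma trivial_normal_form A : good A -> act A = 1%:M ->
  exists2 k, dm A = k.*2 & iso A (model (nseq k (l1 F))).
Proof.
move=> gA a1; have [L wL iL] := normal_form oddF gA.
have aL : act (model L) = 1%:M.
  have [P [Pi [_ h2 h3 _]]] := iL.
  by rewrite -[LHS]mulmx1 -h2 mulmxA -h3 a1 mulmx1.
have eL := model_trivial wL aL; exists (size L); last by rewrite -eL.
rewrite (iso_dim iL) dm_model // {1}eL big_nseq iter_addn_0.
rewrite /wt /mul /oddl /l1 /pmone /= eqxx -polyC1 size_XsubC /=.
by rewrite -[LHS]/(2 * size L)%N mul2n.
Qed.

(** Darboux: alternating forms of the same dimension are equivalent, because a
    form together with the identity decomposes into trivial blocks. *)
Lemma darboux A : good A -> exists n (U : Sp F n), iso A (spm U).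
Proof.
move=> gA; have [g1 g2 g3] := gA.
pose B := SMod 1%:M (frm A).
have gB : good B by split=> //=; rewrite trmx1 mul1mx mulmx1.
have [k dk ik] := trivial_normal_form gB (erefl _).
have [k' dk' ik'] := trivial_normal_form (good_spm (1%g : Sp F k)) (erefl _).
have ek : k' = k by apply: double_inj; rewrite -dk'.
rewrite ek in ik'; have [P [Pi [h1 h2 _ h4]]] := iso_trans ik (iso_sym ik').
exists k; have sp : is_sp (P *m act A *m Pi).
  rewrite /is_sp /= in P Pi h1 h2 h4 *.
  have h5 : Pi^T *m frm A *m Pi = sp_form F k.
    by rewrite -h4 -!mulmxA h2 mulmx1 mulmxA -trmx_mul h2 trmx1 mul1mx.
  rewrite !trmx_mul -!mulmxA (mulmxA P^T) (mulmxA (P^T *m _)) h4 -h5.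
  by rewrite -{2}g1 !mulmxA.
exists (MkSp sp), P, Pi; split=> //=.
by rewrite -!mulmxA h1 mulmx1.
Qed.

Lemma sp_data n (U : Sp F n) : exists L x,
  [/\ wfL L, typ L x, iso (model L) (spm U) & sf_weight x = n.*2].
Proof.
have [L wL iL] := normal_form oddF (good_spm U); have [x tx] := typ_exists wL.
exists L, x; split=> //; first exact: iso_sym.
by rewrite (typ_weight tx) -dm_model // -(iso_dim iL).
Qed.

Lemma modified_type_model n (U : Sp F n) L x : wfL L -> typ L x -> iso (model L) (spm U) ->
  forall z, modified_type U z <-> z = modification x.
Proof.
move=> wL tx iU z; have tU := symplectic_type_of_model oddF wL tx iU.
split=> [[y ty ->]|->]; last by exists x.
by rewrite (symplectic_type_unique ty tU).
Qed.

Lemma modified_type_unique n (U : Sp F n) x y : modified_type U x -> modified_type U y -> x = y.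
Proof. by case=> x' /symplectic_type_unique h -> [y' /h <- ->]. Qed.

Lemma modified_type_iso n n' (U : Sp F n) (U' : Sp F n') x :
  iso (spm U) (spm U') -> modified_type U x -> modified_type U' x.
Proof.
move=> i; have [L [y [wL tL iL _]]] := sp_data U.
by move/(modified_type_model wL tL iL) => ->; apply/(modified_type_model wL tL (iso_trans iL i)).
Qed.

Lemma modified_type_exists n (U : Sp F n) : exists x, modified_type U x.
Proof.
have [L [y [wL tL iL _]]] := sp_data U; exists (modification y).
exact/(modified_type_model wL tL iL).
Qed.

Lemma modified_type_Pst n (U : Sp F n) x : modified_type U x -> Pst x.
Proof. by case=> y [sy _ _ _] ->; exists y. Qed.

Lemma conjugate_of_iso n (U V : Sp F n) : iso (spm U) (spm V) <-> exists P : Sp F n, V = (P * U * P^-1)%g.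
Proof.
split=> [[P [Pi [/= h1 h2 h3 h4]]]|[P ->]].
  have sp : is_sp P by apply/eqP.
  exists (MkSp sp); apply: (mulIg (MkSp sp)); rewrite mulgKV; apply: val_inj => /=.
  by rewrite h3.
exists (P : 'M[F]_(n.*2)), ((P^-1)%g : 'M[F]_(n.*2)); split=> /=.
- by have := congr1 val (mulVg P).
- by have := congr1 val (mulgV P).
- exact: (esym (congr1 (@Spval F n) (mulgKV P (P * U)%g))).
- by case: P => P /= /eqP.
Qed.

(** The modified type labels the conjugacy classes of Sp_n: in a fixed dimension
    the number of parts 1 at t - 1 is recovered from the weight. *)
Lemma modified_type_conj n (U V : Sp F n) x : modified_type U x -> modified_type V x ->
  exists P : Sp F n, V = (P * U * P^-1)%g.
Proof.
move=> tU tV; apply/conjugate_of_iso.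
have [L [y [wL tL iL ey]]] := sp_data U; have [L' [y' [wL' tL' iL' ey']]] := sp_data V.
have yy : y = y'.
  have [[sy _ _ _] [sy' _ _ _]] := (tL, tL'); apply: modification_inj => //; last by rewrite ey.
  by rewrite -(modified_type_model wL tL iL x).1 // -(modified_type_model wL' tL' iL' x).1.
rewrite -yy in tL'; apply: iso_trans (iso_sym iL) _; apply: iso_trans iL'.
exact: typ_iso tL tL'.
Qed.

(** The weight of the modified type is the rank of U - 1: every primary cyclic
    summand at t - 1 contributes one dimension to the fixed space. *)
Lemma modified_type_rank n (U : Sp F n) x : modified_type U x ->
  \rank ((U : 'M[F]_(n.*2)) - 1%:M) = sf_weight x.
Proof.
move=> tU; have [L [y [wL tL iL ey]]] := sp_data U.
have [y' ty' ex] := tU.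
have ty := symplectic_type_of_model oddF wL tL iL.
rewrite -(symplectic_type_unique ty ty') in ex; rewrite {}ex {y' ty' tU x}.
have [sy [D hD yD] _ _] := ty.
have e2 : 1 ^+ 2 = 1 :> F by rewrite expr1n.
have P1 := Phi_XsubC (sqr1_neq0 e2).
have := modification_weight oddF sy; rewrite ey.
have -> : size (sf_part y ('X - 1)) = size (exponents D ('X - 1%:P)).
  by have := perm_size (yD _ P1); rewrite self_dual_XsubC // polyC1.
have := pd_count hD 0 P1.
rewrite expr0 pm1 pm_XsubC expr1 !dim_limg_mxe mxrank1 size_XsubC mul1n => eN ew.
rewrite eN in ew; move: ew.
have -> : count (fun r => 0 < r)%N (exponents D ('X - 1%:P)) = size (exponents D ('X - 1%:P)).
  apply/eqP; rewrite -all_count; apply/allP => r rD; rewrite lt0n.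
  by apply: contraTneq rD => ->; apply: pd_exponents_gt0 hD _.
by move/addIn.
Qed.

End Core.

(** * Stability of the structure constants *)

Section Embedding.
Variable F : finFieldType.
Variable n : nat.

Lemma sp_form_succ : sp_form F n.+1 = block_mx (sp_form F 1) 0 0 (sp_form F n).
Proof.
suff : sp_form F n.+1 = block_mx (sp_form F 1) 0 0 (sp_form F n) :> 'M_(1.*2 + n.*2) by [].
pose w (a b : nat) : F :=
  if ~~ odd a && (b == a.+1) then 1 else if ~~ odd b && (a == b.+1) then -1 else 0.
have w1 (a : 'I_2) (b : nat) : w a b.+2 = 0.
  by case: a => [[|[|a]] //= _]; rewrite /w /= ?andbF.
have w2 (a : 'I_2) (b : nat) : w b.+2 a = 0.
  by case: a => [[|[|a]] //= _]; rewrite /w /= ?andbF.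
have w3 (a b : nat) : w a.+2 b.+2 = w a b by rewrite /w /= !negbK !eqSS.
apply/matrixP => i j; rewrite -(splitK i) -(splitK j) [LHS]mxE -/(w _ _).
case: (split i) => a; case: (split j) => b; rewrite /unsplit.
- by rewrite block_mxEul [RHS]mxE.
- by rewrite block_mxEur [RHS]mxE; exact: w1.
- by rewrite block_mxEdl [RHS]mxE; exact: w2.
- by rewrite block_mxEdr [RHS]mxE; exact: w3.
Qed.

Fact sp_embed_subproof (U : Sp F n) :
  @is_sp F n.+1 (block_mx (1%:M : 'M[F]_(1.*2)) 0 0 (U : 'M[F]_(n.*2))).
Proof.
have key : (bdiag (1%:M : 'M[F]_(1.*2)) (U : 'M_(n.*2)))^T *m bdiag (sp_form F 1) (sp_form F n)
    *m bdiag 1%:M (U : 'M_(n.*2)) = bdiag (sp_form F 1) (sp_form F n).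
  rewrite bdiag_tr !bdiag_mul trmx1 mul1mx mulmx1.
  by case: U => U /= /eqP ->.
by apply/eqP; rewrite sp_form_succ; exact: key.
Qed.

(** The new symplectic pair is put in front, so that the embedded matrix is a
    block matrix by definition. *)
Definition sp_embed (U : Sp F n) : Sp F n.+1 := MkSp (sp_embed_subproof U).

Lemma sp_embedM U V : sp_embed (U * V)%g = (sp_embed U * sp_embed V)%g.
Proof.
apply: val_inj => /=.
have h : bdiag (1%:M : 'M[F]_(1.*2)) (U : 'M_(n.*2)) *m bdiag 1%:M (V : 'M_(n.*2)) =
    bdiag 1%:M ((U : 'M_(n.*2)) *m V) by rewrite bdiag_mul mul1mx.
exact: esym h.
Qed.

Lemma sp_embed_inj : injective sp_embed.
Proof.
move=> U V /(congr1 (@Spval F n.+1)) /= h.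
have := @bdiag_inj F 1.*2 n.*2 1%:M 1%:M U V h => -[_ e]; exact: val_inj.
Qed.

Lemma sp_embed1 : sp_embed 1%g = 1%g.
Proof. by apply: (mulIg (sp_embed 1%g)); rewrite -sp_embedM !mul1g. Qed.

Lemma sp_embedV U : sp_embed U^-1%g = (sp_embed U)^-1%g.
Proof. by apply: (mulIg (sp_embed U)); rewrite -sp_embedM !mulVg sp_embed1. Qed.

Lemma spm_embed U : iso (dsum (spm (1%g : Sp F 1)) (spm U)) (spm (sp_embed U)).
Proof.
have e : dsum (spm (1%g : Sp F 1)) (spm U) = spm (sp_embed U).
  by rewrite /spm sp_form_succ.
by rewrite e; apply: iso_refl.
Qed.

(** An element fixing the first symplectic pair preserves its orthogonal, hence
    lies in the smaller group. *)
Lemma sp_embed_fix (G : Sp F n.+1) :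
  (G : 'M[F]_(n.+1.*2)) *m (col_mx 1%:M 0 : 'M[F]_(1.*2 + n.*2, 1.*2)) =
    (col_mx 1%:M 0 : 'M[F]_(1.*2 + n.*2, 1.*2)) ->
  exists g, G = sp_embed g.
Proof.
case: G => G hG; rewrite [Spval _]/=.
have [a [b [c [d eG]]]] : exists a b c d, G = block_mx a b c d :> 'M[F]_(1.*2 + n.*2).
  pose G' : 'M[F]_(1.*2 + n.*2) := G.
  by exists (ulsubmx G'), (ursubmx G'), (dlsubmx G'), (drsubmx G'); rewrite submxK.
move=> hfix; have [a1 c0] : a = 1%:M /\ c = 0.
  apply: eq_col_mx; rewrite -hfix eG.
  suff -> : block_mx a b c d *m col_mx 1%:M 0 = col_mx a c :> 'M[F]_(1.*2 + n.*2, 1.*2) by [].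
  by rewrite mul_block_col !mulmx1 !mulmx0 !addr0.
have key : (block_mx 1%:M b 0 d)^T *m block_mx (sp_form F 1) 0 0 (sp_form F n) *m
    block_mx 1%:M b 0 d = block_mx (sp_form F 1) 0 0 (sp_form F n) :> 'M_(1.*2 + n.*2).
  by move/eqP: (hG); rewrite sp_form_succ eG a1 c0; exact.
move: key; rewrite tr_block_mx trmx1 trmx0 !mulmx_block.
rewrite !mul0mx !mulmx0 !mul1mx !mulmx1 !addr0 !add0r => /eq_block_mx [_ b0 _ hd].
have {}b0 : b = 0.
  by apply: (inverse_mulmx_eq0 (mulVmx (sp_form_unit F 1))); move: b0; rewrite mul0mx addr0 => ->.
rewrite b0 trmx0 !mul0mx add0r in hd.
have sd : is_sp d by apply/eqP.
by exists (MkSp sd); apply: val_inj; rewrite /= eG a1 b0 c0.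
Qed.

End Embedding.

(** If the ranks of g - 1 and h - 1 add up to that of gh - 1, the row space of
    h - 1 is contained in that of gh - 1 = (g - 1) h + (h - 1). *)
Lemma fixed_of_rank_add (F : fieldType) N k (g h : 'M[F]_N) (v : 'M[F]_(N, k)) :
  (\rank (g - 1%:M)%R + \rank (h - 1%:M)%R <= \rank (g *m h - 1%:M)%R)%N ->
  g *m h *m v = v -> h *m v = v /\ g *m v = v.
Proof.
move=> rk fv; suff hv : h *m v = v by split=> //; rewrite -{2}fv -mulmxA hv.
pose A := (g - 1%:M) *m h; pose B := h - 1%:M; pose Z := g *m h - 1%:M.
have eZ : Z = A + B by rewrite /A /B /Z mulmxBl mul1mx addrA subrK.
have sub : (Z <= A + B)%MS by rewrite eZ addmx_sub_adds.
have le : (\rank (A + B)%MS <= \rank Z)%N.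
  apply: leq_trans rk; apply: leq_trans (mxrank_adds_leqif _ _) _.
  by rewrite leq_add2r mxrankM_maxl.
have : (B <= Z)%MS.
  apply: submx_trans (addsmxSr A B) _.
  by have := mxrank_leqif_sup sub => -[_ <-]; rewrite eqn_leq le mxrankS.
case/submxP => X eB; apply/eqP; rewrite -subr_eq0; apply/eqP.
have -> : h *m v - v = B *m v by rewrite mulmxBl mul1mx.
by rewrite eB -mulmxA mulmxBl mul1mx fv subrr mulmx0.
Qed.

Lemma dsum_smod0 (F : fieldType) (B : smod F) : iso (dsum B (smod0 F)) B.
Proof.
exists (row_mx 1%:M 0), (col_mx 1%:M 0); split.
- rewrite mul_col_row !mulmx1 !mul0mx !mulmx0 (@scalar_mx_block _ _ 0).
  by congr block_mx; apply/matrixP => -[].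
- by rewrite mul_row_col mulmx1 mulmx0 addr0.
- rewrite /= /bdiag mul_row_block mul_mx_row !mul1mx mulmx1 !mul0mx !mulmx0 !addr0.
  by congr row_mx; apply/matrixP => ? -[].
- rewrite tr_row_mx trmx1 trmx0 mul_col_mx mul_col_row !mul1mx !mulmx1 !mul0mx !mulmx0.
  by rewrite /= /bdiag; congr block_mx; apply/matrixP => -[].
Qed.

Section Counting.
Variable F : finFieldType.
Hypothesis oddF : odd #|F|.

Lemma modified_type_embed n (U : Sp F n) x :
  modified_type U x <-> modified_type (sp_embed U) x.
Proof.
have [L [y [wL tL iL _]]] := sp_data oddF U.
have [k dk ik] := trivial_normal_form oddF (good_spm (1%g : Sp F 1)) (erefl _).
have k1 : k = 1%N by apply: double_inj; rewrite -dk.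
rewrite k1 /= in ik.
have i0 : iso (dsum (blk (l1 F)) (smod0 F)) (blk (l1 F)).
  exact: dsum_smod0.
have iL' : iso (model (l1 F :: L)) (spm (sp_embed U)).
  apply: iso_trans (spm_embed U); apply: iso_dsum iL.
  by apply: iso_sym; apply: iso_trans ik i0.
have wL' : wfL (l1 F :: L) by apply/wfL_cons; split=> //; apply: l1_wf.
have [y' ty'] := typ_exists wL'.
rewrite (modified_type_model oddF wL tL iL) (modified_type_model oddF wL' ty' iL').
suff -> : modification y = modification y' by [].
apply: (modification_eq oddF wL wL' tL ty') => f r n1.
  by rewrite cnt_cons /atl /= -xpair_eqE eq_sym (negPf n1) add0n.
by rewrite sgn_cons /atl /= -xpair_eqE eq_sym (negPf n1).
Qed.

(** The coefficient of z in the product of the class sums of x and y. *)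
Definition coef_set n (x y : sfun F) (z : Sp F n) : {set Sp F n} :=
  [set g | (g \in sp_class n x) && ((g^-1 * z)%g \in sp_class n y)].

Lemma coef_setE n x y (z g : Sp F n) :
  (g \in coef_set x y z) = (g \in sp_class n x) && ((g^-1 * z)%g \in sp_class n y).
Proof. by rewrite in_set. Qed.

Lemma sp_classP n x (U : Sp F n) : (U \in sp_class n x) <-> modified_type U x.
Proof. by rewrite inE; split=> [/asboolP|h]; last apply/asboolP. Qed.

Lemma sp_class_conj n x (U P : Sp F n) : ((P * U * P^-1)%g \in sp_class n x) = (U \in sp_class n x).
Proof.
have i : iso (spm U) (spm (P * U * P^-1)%g) by apply/conjugate_of_iso; exists P.
apply/idP/idP => /sp_classP h; apply/sp_classP; apply: modified_type_iso h => //.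
exact: iso_sym.
Qed.

Lemma coef_conj n x y (z P : Sp F n) :
  #|coef_set x y (P * z * P^-1)%g| = #|coef_set x y z|.
Proof.
have cE (u : Sp F n) : (u ^ P^-1 = P * u * P^-1)%g by rewrite conjgE invgK mulgA.
have cj v (u : Sp F n) : ((u ^ P^-1)%g \in sp_class n v) = (u \in sp_class n v).
  by rewrite cE sp_class_conj.
have inS (g : Sp F n) : ((g ^ P^-1)%g \in coef_set x y (P * z * P^-1)%g) = (g \in coef_set x y z).
  by rewrite !coef_setE -cE -conjVg -conjMg !cj.
rewrite -[RHS](card_imset _ (conjg_inj P^-1%g)); apply: eq_card => G.
apply/idP/imsetP => [GS|[g gS ->]]; last by rewrite inS.
by exists (G ^ P)%g; rewrite -?inS conjgK.
Qed.

Lemma coef_class n x y w (z z' : Sp F n) : z \in sp_class n w -> z' \in sp_class n w ->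
  #|coef_set x y z| = #|coef_set x y z'|.
Proof.
move=> /sp_classP h /sp_classP h'.
by have [P ->] := modified_type_conj oddF h h'; rewrite coef_conj.
Qed.

(** If the weights add up, every factorization of the image of z in the larger
    group comes from the smaller group, since both factors fix what z fixes. *)
Lemma coef_embed n x y w (z : Sp F n) : z \in sp_class n w ->
  sf_weight w = (sf_weight x + sf_weight y)%N ->
  #|coef_set x y (sp_embed z)| = #|coef_set x y z|.
Proof.
move=> /sp_classP zw ew; rewrite -[RHS](card_imset _ (@sp_embed_inj F n)).
have emb v (g : Sp F n) : (sp_embed g \in sp_class n.+1 v) = (g \in sp_class n v).
  apply/idP/idP => /sp_classP h; apply/sp_classP; first exact/modified_type_embed.
  exact: (proj1 (modified_type_embed _ _) h).
have inS (g : Sp F n) : (sp_embed g \in coef_set x y (sp_embed z)) = (g \in coef_set x y z).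
  by rewrite !coef_setE -sp_embedV -sp_embedM !emb.
apply: eq_card => G; apply/idP/imsetP => [GS|[g gS ->]]; last by rewrite inS.
suff : exists g, G = sp_embed g by case=> g eG; exists g; rewrite // -inS -eG.
move: GS; rewrite coef_setE => /andP [/sp_classP Gx /sp_classP Hy].
apply: sp_embed_fix.
pose v : 'M[F]_(n.+1.*2, 1.*2) := (col_mx 1%:M 0 : 'M[F]_(1.*2 + n.*2, 1.*2)).
have GH : (G : 'M_(_)) *m (G^-1 * sp_embed z)%g = sp_embed z.
  by have := congr1 (@Spval F n.+1) (mulKVg G (sp_embed z)).
have rk : (\rank ((G : 'M_(_)) - 1%:M)%R + \rank (((G^-1 * sp_embed z)%g : 'M_(_)) - 1%:M)%R <=
    \rank ((G : 'M_(_)) *m (G^-1 * sp_embed z)%g - 1%:M)%R)%N.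
  rewrite GH (modified_type_rank oddF Gx) (modified_type_rank oddF Hy) -ew.
  by rewrite -(modified_type_rank oddF (proj1 (modified_type_embed _ _) zw)).
have fv : (G : 'M_(_)) *m (G^-1 * sp_embed z)%g *m v = v.
  rewrite GH.
  have : block_mx 1%:M 0 0 (z : 'M_(n.*2)) *m col_mx 1%:M 0 = col_mx 1%:M 0 :> 'M[F]_(1.*2 + n.*2, 1.*2).
    by rewrite mul_block_col !mulmx1 !mulmx0 !addr0.
  exact.
by have [_] := fixed_of_rank_add rk fv.
Qed.

Lemma structure_constant_coef n x y w (z : Sp F n) : z \in sp_class n w ->
  structure_constant n x y w (Posz #|coef_set x y z|).
Proof.
move=> zw.
have [t ht] := boolp.choice (fun U : Sp F n => modified_type_exists oddF U).
have tE (U : Sp F n) v : (U \in sp_class n v) = (t U == v).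
  apply/idP/eqP => [/sp_classP h|<-]; last exact/sp_classP.
  exact: modified_type_unique (ht U) h.
pose a v : int := if [pick g | t g == v] is Some g then Posz #|coef_set x y g| else 0.
have aE U : a (t U) = #|coef_set x y U|.
  rewrite /a; case: pickP => [g|/(_ U)]; rewrite ?eqxx // => tg.
  have gU : g \in sp_class n (t U) by rewrite tE.
  have UU : U \in sp_class n (t U) by rewrite tE eqxx.
  by rewrite (coef_class x y gU UU).
pose S := undup [seq t U | U <- enum {: Sp F n}].
have tS U : t U \in S by rewrite mem_undup map_f ?mem_enum.
have tz : t z = w by apply/eqP; rewrite -tE.
have KE v (g : Sp F n) : Ksum n v g = (t g == v)%:R.
  rewrite /Ksum sum_ffunE.
  rewrite (eq_bigr (fun h => (g == h)%:R)); last by move=> h _; rewrite ffunE.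
  rewrite -tE; have [gv|ngv] := boolP (g \in sp_class n v).
    by rewrite (bigD1 g) //= eqxx big1 ?addr0 // => h /andP [_ /negPf]; rewrite eq_sym => ->.
  by rewrite big1 // => h hv; case: eqP ngv => // ->; rewrite hv.
exists S, a; split.
- split; first exact: undup_uniq.
  move=> v; rewrite mem_undup; split.
    case/mapP => U _ ->; split; first exact: modified_type_Pst (ht U).
    by apply/set0Pn; exists U; rewrite tE.
  case=> _ /set0Pn [U]; rewrite tE => /eqP <-; by rewrite map_f ?mem_enum.
- by rewrite -tz.
- apply/ffunP => g; rewrite ffunE sum_ffunE.
  have zE (k : {ffun Sp F n -> int}) (c : int) : (k *~ c) g = k g *~ c.
    case: c => c; first exact: ffunMnE.
    by rewrite NegzE -!nmulrn ffunE ffunMnE.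
  transitivity (\sum_(v <- S) ((t g == v)%:R : int) *~ a v); last first.
    apply: eq_bigr => v _.
    exact: (esym (etrans (zE _ _) (congr1 (fun r : int => r *~ a v) (KE v g)))).
  rewrite (bigD1_seq (t g)) ?undup_uniq //= eqxx aE.
  rewrite [X in _ = _ + X]big1 => [|v nv]; last by rewrite eq_sym (negPf nv) mul0rz.
  rewrite addr0 -pmulrn.
  rewrite -[RHS]/(#|coef_set x y g|%:R) -sumr_const [RHS]big_mkcond.
  apply: eq_bigr => h _; rewrite !KE coef_setE !tE.
  by case: (t h == x); case: (_ == y).
- by rewrite -tz aE.
Qed.

End Counting.

Theorem theorem4p30 (F : finFieldType) (hq : odd #|F|)
    (lam mu eta : sfun F)
    (hlam : Pst lam) (hmu : Pst mu) (heta : Pst eta)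
    (hweight : sf_weight eta = (sf_weight lam + sf_weight mu)%N) :
  exists c : nat, forall n : nat,
    (sf_weight (completion eta) <= n.*2)%N ->
    structure_constant n lam mu eta (Posz c).
Proof.
case: heta => y sy ey; have wL := labels_wf sy; have tL := typ_labels hq sy.
have wC := core_wf wL; have tC := completion_typ hq wL tL; rewrite -ey in tC.
have [m [z iz]] := darboux hq (good_model hq wC).
have dm_ : sf_weight (completion eta) = m.*2.
  by rewrite (typ_weight tC) -dm_model // (iso_dim iz).
have z_eta : z \in sp_class m eta.
  apply/sp_classP/(modified_type_model hq wC tC iz); rewrite {1}ey.
  apply: (modification_eq hq wL wC tL tC) => f r n1; last by rewrite sgn_core.
  by rewrite cnt_core (negPf n1).
exists #|coef_set lam mu z| => n; rewrite dm_ leq_double => mn.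
have [u u_eta <-] : exists2 u : Sp F n, u \in sp_class n eta & #|coef_set lam mu u| = #|coef_set lam mu z|.
  rewrite -(subnK mn); elim: (n - m)%N => [|k [u u_eta eu]]; first by exists z.
  exists (sp_embed u); last by rewrite (coef_embed hq u_eta hweight).
  apply/sp_classP; apply: (proj1 (modified_type_embed hq u eta)); exact/sp_classP.
exact: structure_constant_coef.
Qed.
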